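(* Let $G$ be a maximal outerplanar graph. Then $G$ has a planar flat visibility representation of height at most $2\,bd^{\mathit{free}}(G)+1$.
   Context: A maximal outerplanar graph is a simple graph $G$ with $n\ge 3$ vertices having a planar embedding (the standard embedding) in which all vertices lie on the outer face and form an $n$-cycle, and all interior faces are triangles. An edge $(u,v)$ of $G$ is a cutting edge if $G-\{u,v\}$ is disconnected, and a non-cutting edge otherwise. For a cutting edge $(u,v)$ there are exactly two cut-components: maximal outerplanar subgraphs $G_1,G_2$ with $G_1\cap G_2=\{u,v\}$ (the edge $(u,v)$) and $G_1\cup G_2=G$. The dual tree of $G$ has a node for each interior face of the standard embedding, two nodes being adjacent iff the faces share an edge. An outerplanar path is a maximal outerplanar graph whose dual tree is a path $f_1,\dots,f_k$; it connects edges $e,e'$ if $e$ is incident to $f_1$ and $e'$ to $f_k$ (a triangle connects any two of its edges). Bonnet: for a non-cutting edge $(u,v)$ of $G$, a bonnet with cap $(u,v)$ is a subgraph $U$ of $G$ with at least 3 vertices that is the union of three outerplanar paths $P$ (the ribbon), $F_1$, $F_2$ (the fans, which may be empty) such that: (1') $P$ connects two non-cutting edges of $G$ and contains $u$, $v$ and their common neighbour; (2) $F_1$ contains only $u$ and neighbours of $u$, and $F_2$ contains only $v$ and neighbours of $v$; (3) $F_1,F_2$ are edge-disjoint, $F_1$ and $P$ have exactly one edge in common (incident to $u$), and $F_2$ and $P$ have exactly one edge in common (incident to $v$); (4) all neighbours of $u$ and $v$ in $G$ belong to $U$. An anchor-edge of $U$ is an edge of $U$ that is a cutting edge of $G$ but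 not of $U$; the hanging subgraph $S_{a,b}$ at anchor-edge $(a,b)$ is the cut-component of $G$ with respect to $(a,b)$ not containing $(u,v)$. A bonnet system of $G$ with root-edge $(u,v)$ (a non-cutting edge) consists of a bonnet $U_0$ in $G$ with cap $(u,v)$ with anchor-edges $(u_i,v_i)$, $i=1,\dots,k$ ($k\ge 0$), and, for each $i$, a bonnet system $\mathcal U_i$ of the hanging subgraph $S_i$ (itself maximal outerplanar) with root-edge $(u_i,v_i)$. Its depth is $1+\max_i d(\mathcal U_i)$ (the maximum over an empty set being $0$). $bd(G;u,v)$ is the minimum depth of a bonnet system of $G$ with root-edge $(u,v)$, and $bd^{\mathit{free}}(G)$ is the minimum of $bd(G;u,v)$ over all non-cutting edges $(u,v)$. A flat visibility representation represents each vertex by a horizontal line segment and each edge by a horizontal or vertical line segment joining the segments of its endpoints; it is planar if no two elements intersect unless the corresponding graph elements are incident. All segment endpoints have integer $y$-coordinates; a layer is a horizontal line with integer $y$-coordinate meeting the drawing, and the height is the number of layers. *)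

(* Defs.v *)
From mathcomp Require Import all_boot all_order all_algebra.
From mathcomp Require Import boolp classical_sets cardinality reals.

Set Implicit Arguments.
Unset Strict Implicit.
Unset Printing Implicit Defensive.

Import Order.TTheory GRing.Theory Num.Theory.

(* Finite simple graphs whose vertices are taken from a finite type V.  The
   vertex set is part of the data so that subgraphs live in the same type;
   edges are two-element sets of vertices. *)
Record graph (V : finType) := Graph {
  vset : {set V};
  eset : {set {set V}};
  eset_wf : [forall e in eset, (e \subset vset) && (#|e| == 2)]
}.

Section Graphs.
Variable V : finType.
Implicit Types (G H U P F : graph V) (c f : seq V) (fs : seq (seq V)).
Implicit Types (e r : {set V}).

Definition adj G : rel V := fun x y => [set x; y] \in eset G.

Definition subgraph H G := vset H \subset vset G /\ eset H \subset eset G.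

Definition adj_minus G (A : {set V}) : rel V :=
  fun x y => [&& x \notin A, y \notin A & adj G x y].

(* The graph G - A is connected. *)
Definition connected_minus G (A : {set V}) : bool :=
  [forall x in vset G :\: A, forall y in vset G :\: A,
     connect (adj_minus G A) x y].

Definition cutting G e := (e \in eset G) && ~~ connected_minus G e.
Definition noncutting G e := (e \in eset G) && connected_minus G e.

(* An embedding with all vertices on the outer face, this face being bounded
   by an n-cycle, is given by that cycle: c lists the vertices in cyclic order,
   as the corners of a convex polygon, and the other edges are diagonals. *)

(* The corners a, x, b, y occur in this order exactly when the segments ab and
   xy cross; a rotation of this pattern is the same pattern for the same
   two edges (up to exchanging them), so no rotation of c is needed. *)
Definition noncrossing G c :=
  forall a x b y, subseq [:: a; x; b; y] c -> ~~ (adj G a b && adj G x y).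

(* An interior face is a convex polygon all of whose sides are edges and none
   of whose diagonals is an edge.  It is represented by its corners in the
   order of c, hence by exactly one sequence. *)
Definition interior_face G c f :=
  [/\ 3 <= size f, subseq f c, cycle (adj G) f &
      {in f &, forall x y, adj G x y -> y = next f x \/ x = next f y}].

Definition face_edges f : {set {set V}} := [set [set x; next f x] | x in f].

Definition standard_embedding G c :=
  [/\ 3 <= size c, uniq c, c =i vset G & cycle (adj G) c] /\
  noncrossing G c /\ (forall f, interior_face G c f -> size f = 3).

Definition maximal_outerplanar G := exists c, standard_embedding G c.

Definition dual_adj f f' : bool :=
  (f != f') && [exists e, (e \in face_edges f) && (e \in face_edges f')].

(* fs = [:: f_1; ..; f_k] lists the nodes of the dual tree, which is the path
   f_1, ..., f_k. *)
Definition dual_path G c fs :=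
  [/\ uniq fs, (forall f, f \in fs <-> interior_face G c f) &
      forall i j, i < size fs -> j < size fs ->
        dual_adj (nth [::] fs i) (nth [::] fs j) = (i.+1 == j) || (j.+1 == i)].

Definition outerplanar_path P :=
  exists c fs, standard_embedding P c /\ dual_path P c fs.

Definition path_connects P e e' :=
  exists c fs, [/\ standard_embedding P c, dual_path P c fs,
    e \in face_edges (head [::] fs) & e' \in face_edges (last [::] fs)].

Definition is_union G H1 H2 :=
  vset G = vset H1 :|: vset H2 /\ eset G = eset H1 :|: eset H2.

Definition cut_component G e H := exists H',
  [/\ maximal_outerplanar H, maximal_outerplanar H', is_union G H H',
      vset H :&: vset H' = e & eset H :&: eset H' = [set e]].

(* F is a fan at u attached to the ribbon P; an empty fan shares no edge with
   P, so the condition on the common edge concerns nonempty fans only. *)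
Definition fan G P u F :=
  vset F = finset.set0 \/
  [/\ outerplanar_path F,
      (forall x, x \in vset F -> x = u \/ adj G u x) &
      exists2 e, eset F :&: eset P = [set e] & u \in e].

(* The ribbon connects two distinct edges e and e'; distinctness is not
   automatic when P is a single triangle. *)
Definition ribbon G u v P := exists e e',
  [/\ noncutting G e, noncutting G e', e != e' & path_connects P e e'] /\
  [/\ u \in vset P, v \in vset P &
      forall x, adj G u x -> adj G v x -> x \in vset P].

Definition bonnet_with_cap G u v U := [/\ noncutting G [set u; v],
  subgraph U G, 3 <= #|vset U|,
  (exists P F1 F2,
     [/\ vset U = vset P :|: vset F1 :|: vset F2,
         eset U = eset P :|: eset F1 :|: eset F2,
         ribbon G u v P,
         fan G P u F1 /\ fan G P v F2 &
         eset F1 :&: eset F2 = finset.set0]) &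
  forall x, adj G u x \/ adj G v x -> x \in vset U].

Definition bonnet G r U := exists u v, r = [set u; v] /\ bonnet_with_cap G u v U.

Definition anchors G U : {set {set V}} :=
  [set e in eset U | cutting G e && ~~ cutting U e].

Definition hanging G r e S := cut_component G e S /\ r \notin eset S.

(* bonnet_system G r d: there is a bonnet system of G with root-edge r and
   depth d. *)
Inductive bonnet_system : graph V -> {set V} -> nat -> Prop :=
| BonnetSystem G r U (S : {set V} -> graph V) (d : {set V} -> nat) :
    noncutting G r ->
    bonnet G r U ->
    (forall e, e \in anchors G U -> hanging G r e (S e)) ->
    (forall e, e \in anchors G U -> bonnet_system (S e) e (d e)) ->
    bonnet_system G r (\max_(e in anchors G U) d e).+1.

(* The least element of a nonempty set of natural numbers; the value 0 for the
   empty set is a junk value. *)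
Definition minimum (A : nat -> Prop) : nat :=
  xget 0 (fun m => A m /\ forall k, A k -> m <= k).

Definition bd G r : nat := minimum (bonnet_system G r).

Definition bd_free G : nat :=
  minimum (fun k => exists2 r, noncutting G r & k = bd G r).

End Graphs.

Local Open Scope ring_scope.

(* Segments are given by their endpoints, which have integer y-coordinates. *)
Record segment (R : realType) := Segment { seg_src : R * int; seg_tgt : R * int }.

Record drawing (R : realType) (V : finType) := Drawing {
  vseg : V -> segment R;
  eseg : {set V} -> segment R
}.

Section Drawings.
Variables (R : realType) (V : finType).
Implicit Types (s : segment R) (z : R * R) (G : graph V) (D : drawing R V).

Definition point_of (p : R * int) : R * R := (p.1, p.2%:~R).

Definition horizontal s := (seg_src s).2 = (seg_tgt s).2.
Definition vertical s := (seg_src s).1 = (seg_tgt s).1.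

(* The bounding box of the endpoints, which is the segment itself for the
   horizontal and vertical segments considered here. *)
Definition on_seg s z : bool :=
  let p := point_of (seg_src s) in let q := point_of (seg_tgt s) in
  (Num.min p.1 q.1 <= z.1 <= Num.max p.1 q.1) &&
  (Num.min p.2 q.2 <= z.2 <= Num.max p.2 q.2).

Definition joins s s1 s2 :=
  (on_seg s1 (point_of (seg_src s)) /\ on_seg s2 (point_of (seg_tgt s))) \/
  (on_seg s2 (point_of (seg_src s)) /\ on_seg s1 (point_of (seg_tgt s))).

Definition flat_visibility_representation G D :=
  (forall v, v \in vset G ->
     horizontal (vseg D v) /\ seg_src (vseg D v) <> seg_tgt (vseg D v)) /\
  (forall u v, adj G u v ->
     (horizontal (eseg D [set u; v]) \/ vertical (eseg D [set u; v])) /\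
     joins (eseg D [set u; v]) (vseg D u) (vseg D v)).

(* Two edges with a common endpoint may meet, but only on the segment of that
   endpoint. *)
Definition planar_drawing G D :=
  [/\ forall u v z, u \in vset G -> v \in vset G -> u != v ->
        ~~ (on_seg (vseg D u) z && on_seg (vseg D v) z),
      forall v e z, v \in vset G -> e \in eset G -> v \notin e ->
        ~~ (on_seg (vseg D v) z && on_seg (eseg D e) z) &
      forall e e' z, e \in eset G -> e' \in eset G -> e != e' ->
        on_seg (eseg D e) z -> on_seg (eseg D e') z ->
        exists2 w, w \in e :&: e' & on_seg (vseg D w) z].

Definition drawn G D z :=
  (exists2 v, v \in vset G & on_seg (vseg D v) z) \/
  (exists2 e, e \in eset G & on_seg (eseg D e) z).

Definition layers G D : set int :=
  fun m => exists x : R, drawn G D (x, m%:~R).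

Definition height_at_most G D (h : nat) : Prop := (layers G D #<= `I_h)%card.

End Drawings.

(* Main.v *)
Require Import Defs.
From mathcomp Require Import all_boot all_order all_algebra reals.
From mathcomp Require Import zify.
From mathcomp Require boolp classical_sets cardinality.

Set Implicit Arguments.
Unset Strict Implicit.
Unset Printing Implicit Defensive.

(** Rooted at a non-cutting edge uv, a maximal outerplanar graph is a binary
tree of triangles.  The ribbon of a bonnet with cap uv is a path of this tree
through the root triangle, and all triangles at u and v belong to the bonnet;
hence a bonnet system of depth d gives a recursive decomposition of the tree
([depth_le] below).  Such a tree is drawn on 2d+1 rows with u and v sharing the
top row, by induction on d.  Below the top row, the ribbon uses 2d rows: its
vertices on the side of uv are in the first of them, the others in the last one.
A hanging subgraph has a drawing on 2d-1 rows with its root edge along the top;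
it is inserted, upside down for an edge of the lower side, inside the triangle
of the ribbon at its anchor-edge, and avoids the row of the third corner (so the
drawing does not respect the standard embedding).  The fan at u fits in the
triangle by which the ribbon leaves u.

The value bd of a root edge is attained because every non-cutting edge is the
root-edge of some bonnet system: take the triangles at u as ribbon and the other
triangles at v as fan. *)

(** * Rooted triangulations *)

(** The factor 2: if hanging subgraphs get [h] rows, then avoiding the row of the third corner costs
    one more row and the top row shared by u and v another one, so a level takes [h + 2] rows; depth
    0 is a bare edge, drawn on one row.

    In a word of columns, a cell holds at most one vertex and a column carries at most one edge.
    Planarity is thus built into the data: a layout only has to show that each vertex fills an
    interval of one row and that each edge occurs.

    The combinatorial obstacle is that ribbons, fans and cut-components are abstract subgraphs, with
    embeddings of their own. No uniqueness of embeddings is proved; instead, a subgraph is located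
    in the tree of G by connectedness after deleting one or two vertices, and by the fact that the
    ends of an edge have at most one common neighbour on each side of it. *)

Inductive tree (A : Type) := Leaf | Node of tree A & A & tree A.
Arguments Leaf {A}.

Section Trees.
Variable V : finType.
Implicit Types (t s : tree V) (u v x y z : V) (H : tree V -> Prop).

(** The ends of the root edge are parameters instead of data, so that a subtree can be read on the
    side of the triangle it hangs from. In-order traversal follows the outer cycle from one end to
    the other. *)
Fixpoint inn t : seq V :=
  if t is Node L z R then inn L ++ z :: inn R else [::].

Fixpoint edges t u v : {set {set V}} :=
  if t is Node L z R then [set u; v] |: (edges L u z :|: edges R z v)
  else [set [set u; v]].

Fixpoint mirror t : tree V :=
  if t is Node L z R then Node (mirror R) z (mirror L) else Leaf.

(* In the next three definitions t is a triangulated polygon with root edge uv,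
   and H is meant to hold for the hanging subgraphs.  A fan at u goes on with the
   side at u (the left subtree), a ribbon with either side; as long as its sides
   meet u, it can be left for a fan. *)
Fixpoint fan_with H t : Prop :=
  if t is Node A z B then fan_with H A /\ H B else True.

Fixpoint ribbon_with H t : Prop :=
  if t is Node A z B then
    (ribbon_with H A /\ H B) \/ (H A /\ ribbon_with H B)
  else True.

Fixpoint fan_ribbon_with H t : Prop :=
  if t is Node A z B then
    (fan_ribbon_with H A /\ H B) \/ (fan_with H A /\ ribbon_with H B)
  else True.

Fixpoint depth_le d t : Prop :=
  match t, d with
  | Leaf, _ => True
  | Node L z R, 0 => False
  | Node L z R, d'.+1 => fan_ribbon_with (depth_le d') L /\
                         fan_ribbon_with (depth_le d') (mirror R)
  end.

Lemma mirrorK : involutive mirror.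
Proof. by elim=> //= L -> z R ->. Qed.

Lemma inn_mirror t : inn (mirror t) = rev (inn t).
Proof. by elim: t => //= L -> z R ->; rewrite rev_cat rev_cons cat_rcons. Qed.

Lemma edges_mirror t u v : edges (mirror t) v u = edges t u v.
Proof.
elim: t u v => [|L IHL z R IHR] u v /=; first by rewrite setUC.
by rewrite IHL IHR (setUC [set v]) (setUC (edges R z v)).
Qed.

Lemma depth_le_leaf d : depth_le d Leaf.
Proof. by case: d. Qed.

Lemma depth_le_mirror d t : depth_le d t -> depth_le d (mirror t).
Proof. by case: t d => [|L z R] [|d] //= [hL hR]; rewrite mirrorK. Qed.

Lemma fan_with_mono H H' t : (forall s, H s -> H' s) -> fan_with H t -> fan_with H' t.
Proof. by move=> hH; elim: t => //= A IHA z B _ [/IHA hA /hH]. Qed.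

Lemma ribbon_with_mono H H' t :
  (forall s, H s -> H' s) -> ribbon_with H t -> ribbon_with H' t.
Proof.
move=> hH; elim: t => //= A IHA z B IHB [] [hA hB]; [left|right]; split; auto.
Qed.

Lemma fan_ribbon_with_mono H H' t :
  (forall s, H s -> H' s) -> fan_ribbon_with H t -> fan_ribbon_with H' t.
Proof.
move=> hH; elim: t => //= A IHA z B IHB [] [hA hB]; [left|right]; split; auto.
- exact: fan_with_mono hA.
- exact: ribbon_with_mono hB.
Qed.

Lemma depth_le_mono d d' t : d <= d' -> depth_le d t -> depth_le d' t.
Proof.
elim: d d' t => [|d IH] [|d'] [|L z R] //= le_d [hL hR].
by split; apply: fan_ribbon_with_mono (IH d' ^~ le_d) _.
Qed.

End Trees.

(** * Grid drawings as words of columns *)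

Section Words.
Variable V : finType.
Implicit Types (x y z a b : V) (e : {set V}) (X : seq V) (E : {set {set V}}).
Implicit Types (h j : nat).

(* A drawing is a list of columns, from left to right.  A column lists, from
   one row to the next, the vertex met in each row, and carries at most one
   edge (the label [set0] stands for none). *)
Definition column := (seq (option V) * {set V})%type.
Implicit Types (c : column) (w : seq column).

Definition at_row x j c :=
  exists p q, [/\ c.1 = p ++ Some x :: q, size p = j, Some x \notin p & Some x \notin q].

Definition absent x w := forall c, c \in w -> Some x \notin c.1.
Definition full x j w := forall c, c \in w -> at_row x j c.
Definition starts x j w :=
  exists w1 w2, [/\ w = w1 ++ w2, w1 <> [::], full x j w1 & absent x w2].
Definition ends x j w :=
  exists w1 w2, [/\ w = w1 ++ w2, w2 <> [::], absent x w1 & full x j w2].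
Definition spans x w :=
  exists w1 w2 w3 j, [/\ w = w1 ++ w2 ++ w3, w2 <> [::], absent x w1, full x j w2 &
    absent x w3].

Definition vert_edge a b w := exists c p k q,
  [/\ c \in w, c.2 = [set a; b] & c.1 = p ++ Some a :: nseq k None ++ Some b :: q].

(** The edge fills the empty cell of the middle column. The lengths below the row are compared as
    well as those above it, which makes the notion stable under turning the columns upside down. *)
Definition hor_edge a b w := exists w1 c1 c c2 w2,
  [/\ w = w1 ++ [:: c1; c; c2] ++ w2, c.2 = [set a; b] &
   exists p1 q1 p q p2 q2,
   [/\ c1.1 = p1 ++ Some a :: q1, c.1 = p ++ None :: q, c2.1 = p2 ++ Some b :: q2,
       size p1 = size p /\ size p = size p2 & size q1 = size q /\ size q = size q2]].

Definition has_edge w e :=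
  exists a b, e = [set a; b] /\ (vert_edge a b w \/ hor_edge a b w).

(** [E] is only a lower bound on the edges, whereas [X] is exact up to membership: the absence of
    other vertices is what lets words be put side by side. *)
Definition word_for h X E w :=
  [/\ forall c, c \in w -> size c.1 = h,
      forall x, x \in X -> spans x w,
      forall x, x \notin X -> absent x w &
      forall e, e \in E -> has_edge w e].

Lemma absent_cat x w1 w2 : absent x (w1 ++ w2) <-> absent x w1 /\ absent x w2.
Proof.
split=> [h|[h1 h2] c]; last by rewrite mem_cat => /orP[/h1|/h2].
by split=> c hc; apply: h; rewrite mem_cat hc ?orbT.
Qed.

Lemma full_cat x j w1 w2 : full x j (w1 ++ w2) <-> full x j w1 /\ full x j w2.
Proof.
split=> [h|[h1 h2] c]; last by rewrite mem_cat => /orP[/h1|/h2].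
by split=> c hc; apply: h; rewrite mem_cat hc ?orbT.
Qed.

Lemma starts_spans x j w : starts x j w -> spans x w.
Proof. by case=> w1 [w2 [-> n h1 h2]]; exists [::], w1, w2, j. Qed.

Lemma ends_spans x j w : ends x j w -> spans x w.
Proof. by case=> w1 [w2 [-> n h1 h2]]; exists w1, w2, [::], j; rewrite cats0. Qed.

Lemma full_starts x j w : w <> [::] -> full x j w -> starts x j w.
Proof. by move=> n h; exists w, [::]; rewrite cats0. Qed.

Lemma full_ends x j w : w <> [::] -> full x j w -> ends x j w.
Proof. by move=> n h; exists [::], w. Qed.

Lemma ends_starts_spans x j w1 w2 : ends x j w1 -> starts x j w2 -> spans x (w1 ++ w2).
Proof.
case=> a [b [-> nb ha hb]] [c [d [-> nc hc hd]]].
exists a, (b ++ c), d, j; rewrite !catA; split=> //; first by case: (b) nb.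
by apply/full_cat.
Qed.

Lemma spans_absent x w1 w2 : spans x w1 -> absent x w2 -> spans x (w1 ++ w2).
Proof.
case=> a [b [c [j [-> nb ha hb hc]]]] h.
by exists a, b, (c ++ w2), j; rewrite !catA; split=> //; apply/absent_cat.
Qed.

Lemma absent_spans x w1 w2 : absent x w1 -> spans x w2 -> spans x (w1 ++ w2).
Proof.
move=> h [a [b [c [j [-> nb ha hb hc]]]]].
by exists (w1 ++ a), b, c, j; rewrite !catA; split=> //; apply/absent_cat.
Qed.

Lemma absent_ends x j w1 w2 : absent x w1 -> ends x j w2 -> ends x j (w1 ++ w2).
Proof.
move=> h [a [b [-> nb ha hb]]].
by exists (w1 ++ a), b; rewrite !catA; split=> //; apply/absent_cat.
Qed.

Lemma starts_absent x j w1 w2 : starts x j w1 -> absent x w2 -> starts x j (w1 ++ w2).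
Proof.
case=> [a [b [-> nb ha hb]]] h.
by exists a, (b ++ w2); rewrite !catA; split=> //; apply/absent_cat.
Qed.

Lemma full_starts_cat x j w1 w2 : full x j w1 -> starts x j w2 -> starts x j (w1 ++ w2).
Proof.
move=> h [a [b [-> nb ha hb]]].
exists (w1 ++ a), b; rewrite !catA; split=> //; last by apply/full_cat.
by case: (w1).
Qed.

Lemma ends_full_cat x j w1 w2 : ends x j w1 -> full x j w2 -> ends x j (w1 ++ w2).
Proof.
case=> [a [b [-> nb ha hb]]] h.
exists a, (b ++ w2); rewrite !catA; split=> //; last by apply/full_cat.
by case: (b) nb.
Qed.

Lemma absent_rev x w : absent x w -> absent x (rev w).
Proof. by move=> h c; rewrite mem_rev => /h. Qed.

Lemma full_rev x j w : full x j w -> full x j (rev w).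
Proof. by move=> h c; rewrite mem_rev => /h. Qed.

Lemma rev_nnil (T : Type) (s : seq T) : s <> [::] -> rev s <> [::].
Proof. by case: s => // a s _; rewrite rev_cons; case: (rev s). Qed.

Lemma starts_rev x j w : starts x j w -> ends x j (rev w).
Proof.
case=> [a [b [-> nb ha hb]]]; exists (rev b), (rev a); rewrite rev_cat.
split=> //; [exact: rev_nnil|exact: absent_rev|exact: full_rev].
Qed.

Lemma ends_rev x j w : ends x j w -> starts x j (rev w).
Proof.
case=> [a [b [-> nb ha hb]]]; exists (rev b), (rev a); rewrite rev_cat.
split=> //; [exact: rev_nnil|exact: full_rev|exact: absent_rev].
Qed.

Lemma spans_rev x w : spans x w -> spans x (rev w).
Proof.
case=> [a [b [c [j [-> nb ha hb hc]]]]]; exists (rev c), (rev b), (rev a), j.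
rewrite !rev_cat catA.
by split=> //; [exact: rev_nnil|exact: absent_rev|exact: full_rev|exact: absent_rev].
Qed.

Lemma has_edge_catl w1 w2 e : has_edge w1 e -> has_edge (w1 ++ w2) e.
Proof.
case=> a [b [-> [[c [p [k [q [hc h1 h2]]]]]|[u1 [c1 [c [c2 [u2 [-> h1 h2]]]]]]]]];
  exists a, b; split=> //; [left|right].
- by exists c, p, k, q; rewrite mem_cat hc.
- by exists u1, c1, c, c2, (u2 ++ w2); rewrite !catA.
Qed.

Lemma has_edge_catr w1 w2 e : has_edge w2 e -> has_edge (w1 ++ w2) e.
Proof.
case=> a [b [-> [[c [p [k [q [hc h1 h2]]]]]|[u1 [c1 [c [c2 [u2 [-> h1 h2]]]]]]]]];
  exists a, b; split=> //; [left|right].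
- by exists c, p, k, q; rewrite mem_cat hc orbT.
- by exists (w1 ++ u1), c1, c, c2, u2; rewrite !catA.
Qed.

Lemma has_edge_rev w e : has_edge w e -> has_edge (rev w) e.
Proof.
case=> a [b [-> [[c [p [k [q [hc h1 h2]]]]]|[u1 [c1 [c [c2 [u2 [-> h1 h2]]]]]]]]].
- by exists a, b; split=> //; left; exists c, p, k, q; rewrite mem_rev.
- exists b, a; split; first by rewrite setUC.
  right; exists (rev u2), c2, c, c1, (rev u1).
  rewrite !rev_cat -catA; split=> //; first by rewrite h1 setUC.
  case: h2 => p1 [q1 [p [q [p2 [q2 [e1 e2 e3 [e4 e5] [e6 e7]]]]]]].
  exists p2, q2, p, q, p1, q1; split=> //; lia.
Qed.

Lemma word_rev h X E w : word_for h X E w -> word_for h X E (rev w).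
Proof.
case=> h1 h2 h3 h4; split.
- by move=> c; rewrite mem_rev => /h1.
- by move=> x /h2/spans_rev.
- by move=> x /h3/absent_rev.
- by move=> e /h4/has_edge_rev.
Qed.

Lemma word_weaken h X X' E E' w : X =i X' -> E' \subset E ->
  word_for h X E w -> word_for h X' E' w.
Proof.
move=> hX hE [h1 h2 h3 h4]; split=> //.
- by move=> x; rewrite -hX => /h2.
- by move=> x; rewrite -hX => /h3.
- by move=> e /(fintype.subsetP hE)/h4.
Qed.

(** A vertex of both words reaches the common border from both sides in the same row, so its two
    intervals merge; any other vertex is absent from one of the words. *)
Lemma word_cat h X1 X2 E1 E2 w1 w2 :
  word_for h X1 E1 w1 -> word_for h X2 E2 w2 ->
  (forall x, x \in X1 -> x \in X2 -> exists j, ends x j w1 /\ starts x j w2) ->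
  word_for h (X1 ++ X2) (E1 :|: E2) (w1 ++ w2).
Proof.
move=> [a1 a2 a3 a4] [b1 b2 b3 b4] hs; split.
- by move=> c; rewrite mem_cat => /orP[/a1|/b1].
- move=> x; rewrite mem_cat; case x1: (x \in X1); case x2: (x \in X2) => //= _.
  + by have [j [h1 h2]] := hs x x1 x2; exact: ends_starts_spans h1 h2.
  + by apply: spans_absent; [apply: a2|apply: b3; rewrite x2].
  + by apply: absent_spans; [apply: a3; rewrite x1|apply: b2].
- by move=> x; rewrite mem_cat negb_or => /andP[/a3 ? /b3 ?]; apply/absent_cat.
- by move=> e /setUP[/a4/has_edge_catl|/b4/has_edge_catr].
Qed.

Definition embed (p q : seq (option V)) c : column := (p ++ c.1 ++ q, c.2).
Definition flip c : column := (rev c.1, c.2).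

Lemma absent_embed x p q w : Some x \notin p -> Some x \notin q ->
  absent x w -> absent x (map (embed p q) w).
Proof. by move=> hp hq h _ /mapP[c /h hc ->]; rewrite !mem_cat !negb_or hp hq hc. Qed.

Lemma full_embed x j p q w : Some x \notin p -> Some x \notin q ->
  full x j w -> full x (size p + j) (map (embed p q) w).
Proof.
move=> hp hq h _ /mapP[c /h [p' [q' [e1 e2 e3 e4]]] ->].
exists (p ++ p'), (q' ++ q); rewrite /= e1 -!catA size_cat e2.
by rewrite !mem_cat !negb_or hp hq e3 e4.
Qed.

Lemma map_nnil (T T' : Type) (f : T -> T') s : s <> [::] -> map f s <> [::].
Proof. by case: s. Qed.

Lemma starts_embed x j p q w : Some x \notin p -> Some x \notin q ->
  starts x j w -> starts x (size p + j) (map (embed p q) w).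
Proof.
move=> hp hq [w1 [w2 [-> h1 h2 h3]]]; exists (map (embed p q) w1), (map (embed p q) w2).
by rewrite map_cat; split=> //; [apply: map_nnil|apply: full_embed|apply: absent_embed].
Qed.

Lemma ends_embed x j p q w : Some x \notin p -> Some x \notin q ->
  ends x j w -> ends x (size p + j) (map (embed p q) w).
Proof.
move=> hp hq [w1 [w2 [-> h1 h2 h3]]]; exists (map (embed p q) w1), (map (embed p q) w2).
by rewrite map_cat; split=> //; [apply: map_nnil|apply: absent_embed|apply: full_embed].
Qed.

Lemma spans_embed x p q w : Some x \notin p -> Some x \notin q ->
  spans x w -> spans x (map (embed p q) w).
Proof.
move=> hp hq [w1 [w2 [w3 [j [-> h1 h2 h3 h4]]]]].
exists (map (embed p q) w1), (map (embed p q) w2), (map (embed p q) w3), (size p + j).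
rewrite !map_cat; split=> //; [exact: map_nnil|exact: absent_embed|exact: full_embed|].
exact: absent_embed.
Qed.

Lemma has_edge_embed p q w e : has_edge w e -> has_edge (map (embed p q) w) e.
Proof.
case=> a [b [-> [[c [p' [k [q' [hc h1 h2]]]]]|[u1 [c1 [c [c2 [u2 [-> h1 h2]]]]]]]]];
  exists a, b; split=> //; [left|right].
- exists (embed p q c), (p ++ p'), k, (q' ++ q); split=> //; first exact: map_f.
  by rewrite /= h2; repeat rewrite -!catA /=.
- exists (map (embed p q) u1), (embed p q c1), (embed p q c), (embed p q c2),
    (map (embed p q) u2).
  rewrite !map_cat; split=> //.
  case: h2 => p1 [q1 [p0 [q0 [p2 [q2 [e1 e2 e3 [e4 e5] [e6 e7]]]]]]].
  exists (p ++ p1), (q1 ++ q), (p ++ p0), (q0 ++ q), (p ++ p2), (q2 ++ q).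
  rewrite /= e1 e2 e3 -!catA !size_cat; split=> //; lia.
Qed.

Lemma word_embed h X E w p q X' : word_for h X E w -> w <> [::] ->
  (forall x, x \in X -> Some x \notin p /\ Some x \notin q) ->
  (forall x, x \notin X' -> Some x \notin p /\ Some x \notin q) ->
  (forall x, x \in X' -> exists j, full x j (map (embed p q) w)) ->
  word_for (size p + h + size q) (X' ++ X) E (map (embed p q) w).
Proof.
move=> [a1 a2 a3 a4] nw h1 h2 h3; split.
- by move=> _ /mapP[c /a1 hc ->]; rewrite !size_cat hc addnA.
- move=> x; rewrite mem_cat => /orP[/h3[j hj]|hx].
    exact/starts_spans/full_starts/hj/map_nnil.
  by have [? ?] := h1 x hx; apply: spans_embed => //; apply: a2.
- move=> x; rewrite mem_cat negb_or => /andP[/h2[? ?] ?].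
  by apply: absent_embed => //; apply: a3.
- by move=> e /a4/has_edge_embed.
Qed.

Lemma absent_flip x w : absent x w -> absent x (map flip w).
Proof. by move=> h _ /mapP[c /h hc ->]; rewrite mem_rev. Qed.

Lemma full_flip h x j w : (forall c, c \in w -> size c.1 = h) ->
  full x j w -> full x (h - j.+1) (map flip w).
Proof.
move=> hw hf _ /mapP[c hc ->]; have := hw c hc.
have [p [q [e1 e2 e3 e4]]] := hf c hc.
rewrite e1 size_cat /= => sz; exists (rev q), (rev p).
rewrite /= e1 rev_cat rev_cons cat_rcons size_rev !mem_rev; split=> //; lia.
Qed.

Lemma starts_flip h x j w : (forall c, c \in w -> size c.1 = h) ->
  starts x j w -> starts x (h - j.+1) (map flip w).
Proof.
move=> hw [w1 [w2 [ew h1 h2 h3]]]; exists (map flip w1), (map flip w2).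
rewrite ew map_cat; split=> //; [exact: map_nnil| |exact: absent_flip].
by apply: full_flip => // c hc; apply: hw; rewrite ew mem_cat hc.
Qed.

Lemma ends_flip h x j w : (forall c, c \in w -> size c.1 = h) ->
  ends x j w -> ends x (h - j.+1) (map flip w).
Proof.
move=> hw [w1 [w2 [ew h1 h2 h3]]]; exists (map flip w1), (map flip w2).
rewrite ew map_cat; split=> //; [exact: map_nnil|exact: absent_flip|].
by apply: full_flip => // c hc; apply: hw; rewrite ew mem_cat hc orbT.
Qed.

Lemma spans_flip h x w : (forall c, c \in w -> size c.1 = h) ->
  spans x w -> spans x (map flip w).
Proof.
move=> hw [w1 [w2 [w3 [j [ew h1 h2 h3 h4]]]]].
exists (map flip w1), (map flip w2), (map flip w3), (h - j.+1).
rewrite ew !map_cat; split=> //; [exact: map_nnil|exact: absent_flip| |exact: absent_flip].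
by apply: full_flip => // c hc; apply: hw; rewrite ew !mem_cat hc orbT.
Qed.

Lemma rev_nseq (T : Type) (a : T) k : rev (nseq k a) = nseq k a.
Proof. by elim: k => // k IH; rewrite -{1}addn1 nseqD rev_cat IH. Qed.

Lemma has_edge_flip w e : has_edge w e -> has_edge (map flip w) e.
Proof.
case=> a [b [-> [[c [p' [k [q' [hc h1 h2]]]]]|[u1 [c1 [c [c2 [u2 [-> h1 h2]]]]]]]]].
- exists b, a; split; first by rewrite setUC.
  left; exists (flip c), (rev q'), k, (rev p'); split; first exact: map_f.
    by rewrite /= h1 setUC.
  rewrite /= h2 !(rev_cat, rev_cons, cat_rcons, rev_nseq) -?catA. by [].
- exists a, b; split=> //; right.
  exists (map flip u1), (flip c1), (flip c), (flip c2), (map flip u2).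
  rewrite !map_cat; split=> //.
  case: h2 => p1 [q1 [p0 [q0 [p2 [q2 [e1 e2 e3 [e4 e5] [e6 e7]]]]]]].
  exists (rev q1), (rev p1), (rev q0), (rev p0), (rev q2), (rev p2).
  rewrite /= e1 e2 e3 !size_rev !rev_cat !rev_cons !cat_rcons; split=> //; lia.
Qed.

Lemma word_flip h X E w : word_for h X E w -> word_for h X E (map flip w).
Proof.
case=> h1 h2 h3 h4; split.
- by move=> _ /mapP[c /h1 <- ->]; rewrite size_rev.
- by move=> x /h2/(spans_flip h1).
- by move=> x /h3/absent_flip.
- by move=> e /h4/has_edge_flip.
Qed.

End Words.

(** * The outer cycle of a triangulated polygon *)

Section Verts.
Variable V : finType.
Implicit Types (t s A B : tree V) (u v x y z m : V).

Definition verts t u v : seq V := u :: inn t ++ [:: v].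

Lemma mem_verts t u v x : (x \in verts t u v) = [|| x == u, x \in inn t | x == v].
Proof. by rewrite inE mem_cat inE. Qed.

Lemma verts_mirror t u v : verts (mirror t) v u = rev (verts t u v).
Proof. by rewrite /verts inn_mirror rev_cons rev_cat rcons_cat -cats1. Qed.

Lemma verts_node A m B u v : verts (Node A m B) u v = u :: inn A ++ verts B m v.
Proof. by rewrite /verts /= -catA. Qed.

Lemma mem_verts_node A m B u v x :
  (x \in verts (Node A m B) u v) = (x \in verts A u m) || (x \in verts B m v).
Proof. by rewrite !mem_verts /= mem_cat inE; do !case: (_ \in _); do !case: eqP. Qed.

Lemma uniq_verts_mirror t u v : uniq (verts (mirror t) v u) = uniq (verts t u v).
Proof. by rewrite verts_mirror rev_uniq. Qed.

Lemma uniq_verts_node A m B u v : uniq (verts (Node A m B) u v) ->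
  [/\ uniq (verts A u m), uniq (verts B m v),
      forall x, x \in verts A u m -> x \in verts B m v -> x = m,
      u \notin verts B m v & v \notin verts A u m].
Proof.
move=> uq; rewrite /verts /= -catA cat_cons mem_cat !inE mem_cat inE !negb_or in uq.
rewrite cat_uniq -!andbA in uq; case/and5P: uq => uA um uB uv /and3P[inA hB0 /andP[mB uqB]].
have hB x : x \in m :: inn B ++ [:: v] -> x \notin inn A by move=> xB; move/hasPn: hB0; apply.
have mA : m \notin inn A by apply: hB; rewrite inE eqxx.
have vA : v \notin inn A by apply: hB; rewrite inE mem_cat inE eqxx !orbT.
have nvm : v != m by apply: contraNneq mB => <-; rewrite mem_cat inE eqxx orbT.
rewrite /verts; split=> /=.
- by rewrite mem_cat inE negb_or uA um cat_uniq inA /= orbF mA.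
- by rewrite mB.
- move=> x xA xB; move: xA; rewrite inE mem_cat inE => /or3P[/eqP xu|xA|/eqP //].
    by move: xB; rewrite xu inE (negPf um) mem_cat (negPf uB) inE (negPf uv).
  by have := hB x xB; rewrite xA.
- by rewrite inE mem_cat inE !negb_or um uB uv.
- by rewrite inE mem_cat inE !negb_or eq_sym uv vA nvm.
Qed.

Lemma uniq_verts_neq t u v : uniq (verts t u v) -> u != v.
Proof. by rewrite /verts /= mem_cat inE negb_or => /andP[/andP[]]. Qed.

Lemma edges_node A m B u v :
  edges (Node A m B) u v = [set u; v] |: (edges A u m :|: edges B m v).
Proof. by []. Qed.

End Verts.

(** * Layout of a tree *)

Section Layout.
Variable V : finType.
Implicit Types (t s A B : tree V) (u v x y z m : V) (w : seq (column V)).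

(* Row 0 is the top row; [starts x j], [ends x j] and [full x j] say that x
   occupies row j from the left end, up to the right end and all along. *)
Definition root_word h t u v w :=
  [/\ word_for h (verts t u v) (edges t u v) w, starts u 0 w & ends v 0 w].

(** Here [h] is the height of the hanging subgraphs. A fan adds the row of u, which reaches both
    borders, and y begins right below it. A ribbon adds the row of a third corner, and the ends of
    its root edge reach the right border in the extreme rows. When both are combined, u has a top
    row of its own and y reaches the right border at the bottom. *)
Definition fan_word h t u y w :=
  [/\ word_for h.+1 (verts t u y) (edges t u y) w, full u 0 w & starts y 1 w].

Definition ribbon_word h t x y w :=
  [/\ word_for h.+1 (verts t x y) (edges t x y) w, ends x 0 w & ends y h w].

Definition fan_ribbon_word h t u y w :=
  [/\ word_for h.+2 (verts t u y) (edges t u y) w, full u 0 w & ends y h.+1 w].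

Definition rung a b k l : seq (column V) :=
  [:: (Some a :: nseq k None ++ Some b :: nseq l None, [set a; b])].

Lemma rungP a b k l : a != b ->
  [/\ word_for (k + l).+2 [:: a; b] [set [set a; b]] (rung a b k l),
      full a 0 (rung a b k l) & full b k.+1 (rung a b k l)].
Proof.
move=> nab.
have fa : full a 0 (rung a b k l).
  move=> c; rewrite inE => /eqP->; exists [::], (nseq k None ++ Some b :: nseq l None).
  split=> //; rewrite mem_cat inE !mem_nseq !andbF !orbF /=.
  by apply: contra nab => /eqP[->].
have fb : full b k.+1 (rung a b k l).
  move=> c; rewrite inE => /eqP->; exists (Some a :: nseq k None), (nseq l None).
  rewrite /= size_nseq inE !mem_nseq !andbF orbF; split=> //.
  by apply: contra nab => /eqP[->].
split=> //; split.
- by move=> c; rewrite inE => /eqP->; rewrite /= size_cat /= !size_nseq; lia.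
- move=> x; rewrite !inE => /orP[]/eqP->.
  + exact/starts_spans/full_starts/fa.
  + exact/starts_spans/full_starts/fb.
- move=> x; rewrite !inE negb_or => /andP[xa xb] c; rewrite inE => /eqP->.
  rewrite /= inE mem_cat inE !mem_nseq !andbF !orbF /= negb_or.
  by apply/andP; split; [apply: contra xa|apply: contra xb] => /eqP[->].
- move=> e /set1P->; exists a, b; split=> //; left.
  exists (Some a :: nseq k None ++ Some b :: nseq l None, [set a; b]), [::], k, (nseq l None).
  by rewrite inE.
Qed.

Lemma full_head x p q w : Some x \notin p -> Some x \notin q -> absent x w ->
  full x 0 (map (embed (Some x :: p) q) w).
Proof.
move=> hp hq hw _ /mapP[c /hw hc ->]; exists [::], (p ++ c.1 ++ q).
by rewrite !mem_cat !negb_or hp hc hq.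
Qed.

Lemma full_last x h w : (forall c, c \in w -> size c.1 = h) -> absent x w ->
  full x h (map (embed [::] [:: Some x]) w).
Proof.
move=> sz hw _ /mapP[c hc ->]; exists c.1, [::]; split=> //; [exact: sz|exact: hw].
Qed.

Lemma starts_nnil x j w : starts x j w -> w <> [::].
Proof. by case=> -[|c w1] [w2 [-> //]]. Qed.

Lemma ends_nnil x j w : ends x j w -> w <> [::].
Proof. by case=> -[|c w1] [w2 [-> //]]. Qed.


Definition over u k := embed (Some u :: nseq k None) [::].
Definition under y := embed [::] [:: Some y].

Lemma notin_over x u k : x != u -> Some x \notin Some u :: nseq k None.
Proof. by move=> xu; rewrite inE mem_nseq andbF orbF; apply: contra xu => /eqP[->]. Qed.

Lemma notin_under x y : x != y -> Some x \notin [:: Some y].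
Proof. exact: (@notin_over x y 0). Qed.

Lemma word_over u k h X E w : w <> [::] -> u \notin X -> word_for h X E w ->
  word_for (k + h).+1 (u :: X) E (map (over u k) w) /\ full u 0 (map (over u k) w).
Proof.
move=> nw uX ok.
have fu : full u 0 (map (over u k) w).
  by apply: full_head; rewrite ?mem_nseq ?andbF //; case: ok => _ _ /(_ u uX).
split=> //; have -> : (k + h).+1 = size (Some u :: nseq k None) + h + @size (option V) [::].
  by rewrite /= size_nseq addn0.
apply: (@word_embed _ h X E w _ _ [:: u]) => //.
- move=> x xX; have xu : x != u by apply: contraTneq xX => ->.
  by split; [apply: notin_over xu|rewrite in_nil].
- by move=> x; rewrite mem_seq1 => xu; split; [apply: notin_over xu|rewrite in_nil].
- by move=> x; rewrite mem_seq1 => /eqP->; exists 0.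
Qed.

Lemma starts_over x j u k w : x != u -> starts x j w -> starts x (k + j).+1 (map (over u k) w).
Proof.
move=> xu /(@starts_embed _ x j (Some u :: nseq k None) [::] w (notin_over _ xu)).
by rewrite /= size_nseq; apply.
Qed.

Lemma ends_over x j u k w : x != u -> ends x j w -> ends x (k + j).+1 (map (over u k) w).
Proof.
move=> xu /(@ends_embed _ x j (Some u :: nseq k None) [::] w (notin_over _ xu)).
by rewrite /= size_nseq; apply.
Qed.

Lemma word_under y h X E w : w <> [::] -> y \notin X -> word_for h X E w ->
  word_for h.+1 (y :: X) E (map (under y) w) /\ full y h (map (under y) w).
Proof.
move=> nw yX ok.
have fy : full y h (map (under y) w).
  by case: ok => ? _ /(_ y yX) ? _; apply: full_last.
split=> //; have -> : h.+1 = @size (option V) [::] + h + size [:: Some y] by rewrite addn1.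
apply: (@word_embed _ h X E w _ _ [:: y]) => //.
- move=> x xX; have xy : x != y by apply: contraTneq xX => ->.
  by split; [rewrite in_nil|apply: notin_under xy].
- by move=> x; rewrite mem_seq1 => /eqP->; exists h.
Qed.

Lemma full_under x j y w : x != y -> full x j w -> full x j (map (under y) w).
Proof. by move=> xy; apply: (@full_embed _ x j [::]) => //; apply: notin_under. Qed.

Lemma starts_under x j y w : x != y -> starts x j w -> starts x j (map (under y) w).
Proof. by move=> xy; apply: (@starts_embed _ x j [::]) => //; apply: notin_under. Qed.

Lemma ends_under x j y w : x != y -> ends x j w -> ends x j (map (under y) w).
Proof. by move=> xy; apply: (@ends_embed _ x j [::]) => //; apply: notin_under. Qed.

(** [H] describes the trees that may hang and [h] is the height allotted to each; its positivity
    keeps the extreme rows of a ribbon distinct. *)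
Variables (H : tree V -> Prop) (h : nat).
Hypothesis h_gt0 : 0 < h.
Hypothesis HP : forall t u v, H t -> uniq (verts t u v) -> exists w, root_word h t u v w.

Lemma cat_nnil (T : Type) (s1 s2 : seq T) : s1 <> [::] -> s1 ++ s2 <> [::].
Proof. by case: s1. Qed.

Lemma full_shared x j w1 w2 : w1 <> [::] -> w2 <> [::] -> full x j w1 -> full x j w2 ->
  exists j, ends x j w1 /\ starts x j w2.
Proof. by move=> *; exists j; split; [apply: full_ends|apply: full_starts]. Qed.

(* The rungs of the fan alternate with mirrored hanging subgraphs, from left to
   right. *)
Lemma fan_layout t u y : fan_with H t -> uniq (verts t u y) ->
  exists w, fan_word h t u y w.
Proof.
elim: t u y => [|A IHA m B _] u y => [_|[hA hB]] uq.
  have [wf fu fy] := rungP 0 h.-1 (uniq_verts_neq uq).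
  exists (rung u y 0 h.-1); split=> //; last exact: full_starts.
  by move: wf; rewrite add0n prednK.
have nuy := uniq_verts_neq uq.
have [uA uB AB unB ynA] := uniq_verts_node uq.
have num := uniq_verts_neq uA; have nmy := uniq_verts_neq uB.
have [wA [okA fA sA]] := IHA _ _ hA uA.
have [wB [/word_rev okB /starts_rev sB /ends_rev eB]] := HP hB uB.
have [wf fu fy] := rungP 0 h.-1 nuy; rewrite add0n prednK // in wf.
set w0 := rung _ _ _ _ in wf fu fy.
have nB := starts_nnil eB.
have [ok1 f1] := word_over 0 nB unB okB.
have nyu : y != u by rewrite eq_sym.
have nmu : m != u by rewrite eq_sym.
have s1 := starts_over 0 nyu eB; have e1 := ends_over 0 nmu sB.
set w1 := map _ _ in ok1 f1 s1 e1; have n1 : w1 <> [::] := starts_nnil s1.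
have nA : wA <> [::] by apply: starts_nnil sA.
have ay : absent y wA by case: okA => _ _ /(_ y ynA).
have am : absent m w0.
  by case: wf => _ _ wf _; apply: wf; rewrite !inE negb_or nmu nmy.
exists ((w0 ++ w1) ++ wA); split.
- have ok01 : word_for h.+1 ([:: u; y] ++ (u :: verts B m y))
      ([set [set u; y]] :|: edges B m y) (w0 ++ w1).
    apply: word_cat wf ok1 _ => x; rewrite !in_cons in_nil orbF => /orP[]/eqP-> _.
      exact: full_shared fu f1.
    by exists 1; split=> //; apply: full_ends.
  apply: (word_weaken _ _ (word_cat ok01 okA _)).
  + move=> x; rewrite mem_verts_node !mem_cat !(mem_verts, in_cons) ?in_nil.
    by do !case: (_ \in inn _); do !case: (_ == _).
  + by rewrite edges_node -setUA (setUC (edges B _ _)).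
  + move=> x; rewrite mem_cat !in_cons in_nil orbF => /orP[/orP[]/eqP->|/orP[/eqP->|xB]] xA.
    * by apply: full_shared fA => //; apply/full_cat.
    * by case/negP: ynA.
    * by apply: full_shared fA => //; apply/full_cat.
    * by rewrite (AB _ xA xB); exists 1; split=> //; apply: absent_ends e1.
- by apply/full_cat; split=> //; apply/full_cat.
- by apply: starts_absent => //; apply: full_starts_cat.
Qed.

(** The last column is a rung between the extreme rows, where x and y reach the border. If the
    ribbon goes on across xm, then m and y are both in the bottom row, and the drawing of [B] is
    turned upside down into the [h] rows below that of x. If it goes on across my, the drawing of
    [A] fits upright above the row of y. *)
Lemma ribbon_layout t x y : ribbon_with H t -> uniq (verts t x y) ->
  exists w, ribbon_word h t x y w.
Proof.
elim: t x y => [|A IHA m B IHB] x y => [_|hAB] uq;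
  have nxy := uniq_verts_neq uq; have [wf fx fy] := rungP h.-1 0 nxy;
  rewrite addn0 prednK // in wf fy; have nw0 : rung x y h.-1 0 <> [::] by [].
  exists (rung x y h.-1 0); split=> //; exact: full_ends.
set w0 := rung _ _ _ _ in wf fx fy nw0.
have [uA uB AB xnB ynA] := uniq_verts_node uq.
have nxm := uniq_verts_neq uA; have nmy := uniq_verts_neq uB.
have nmx : m != x by rewrite eq_sym.
have nyx : y != x by rewrite eq_sym.
case: hAB => [[hA hB]|[hA hB]].
- have [wA [okA e0 e1]] := IHA _ _ hA uA.
  have [wB [okB sB eB]] := HP hB uB.
  have szB : forall c, c \in wB -> size c.1 = h by case: okB.
  have {okB} okB := word_flip okB.
  have {}sB := starts_flip szB sB; have {}eB := ends_flip szB eB.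
  rewrite !subn1 in sB eB.
  have [ok1 f1] := word_over 0 (starts_nnil sB) xnB okB.
  have s1 := starts_over 0 nmx sB; have {}eB := ends_over 0 nyx eB.
  rewrite add0n prednK // in s1 eB.
  set w1 := map _ _ in ok1 f1 s1 eB; have n1 : w1 <> [::] := starts_nnil s1.
  have ay : absent y wA by case: okA => _ _ /(_ y ynA).
  exists ((wA ++ w1) ++ w0); split.
  + have ok01 : word_for h.+1 (verts A x m ++ (x :: verts B m y))
      (edges A x m :|: edges B m y) (wA ++ w1).
      apply: word_cat okA ok1 _ => z zA; rewrite in_cons => /orP[/eqP->|zB].
        by exists 0; split=> //; apply: full_starts.
      by rewrite (AB _ zA zB); exists h.
    apply: (word_weaken _ _ (word_cat ok01 wf _)).
    * move=> z; rewrite mem_verts_node !mem_cat !(mem_verts, in_cons) ?in_nil.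
      by do !case: (_ \in inn _); do !case: (_ == _).
    * by rewrite edges_node setUC.
    * move=> z _; rewrite !in_cons in_nil orbF => /orP[]/eqP->.
        by exists 0; split; [apply: ends_full_cat|apply: full_starts].
      by exists h; split; [apply: absent_ends|apply: full_starts].
  + by apply: ends_full_cat => //; apply: ends_full_cat.
  + by apply: ends_full_cat => //; apply: absent_ends.
- have [wB [okB e0 e1]] := IHB _ _ hB uB.
  have [wA [/word_rev okA /starts_rev eA /ends_rev sA]] := HP hA uA.
  have [ok1 f1] := word_under (starts_nnil sA) ynA okA.
  have s1 := starts_under nmy sA; have {}eA := ends_under nxy eA.
  set w1 := map _ _ in ok1 f1 s1 eA; have n1 : w1 <> [::] := starts_nnil s1.
  have ax : absent x wB by case: okB => _ _ /(_ x xnB).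
  exists ((wB ++ w1) ++ w0); split.
  + have ok01 : word_for h.+1 (verts B m y ++ (y :: verts A x m))
      (edges B m y :|: edges A x m) (wB ++ w1).
      apply: word_cat okB ok1 _ => z zB; rewrite in_cons => /orP[/eqP->|zA].
        by exists h; split=> //; apply: full_starts.
      by rewrite (AB _ zA zB); exists 0.
    apply: (word_weaken _ _ (word_cat ok01 wf _)).
    * move=> z; rewrite mem_verts_node !mem_cat !(mem_verts, in_cons) ?in_nil.
      by do !case: (_ \in inn _); do !case: (_ == _).
    * by rewrite edges_node setUC (setUC (edges B _ _)).
    * move=> z _; rewrite !in_cons in_nil orbF => /orP[]/eqP->.
        by exists 0; split; [apply: absent_ends|apply: full_starts].
      by exists h; split; [apply: ends_full_cat|apply: full_starts].
  + by apply: ends_full_cat => //; apply: absent_ends.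
  + by apply: ends_full_cat => //; apply: ends_full_cat.
Qed.

(* Where the ribbon leaves u, the rest of the ribbon is put on the left, below
   the top row of u, and the fan at u on its right, above the bottom row of y. *)
Lemma fan_ribbon_layout t u y : fan_ribbon_with H t -> uniq (verts t u y) ->
  exists w, fan_ribbon_word h t u y w.
Proof.
elim: t u y => [|A IHA m B _] u y => [_|hAB] uq;
  have nuy := uniq_verts_neq uq; have [wf fu fy] := rungP h 0 nuy;
  rewrite addn0 in wf; have nw0 : rung u y h 0 <> [::] by [].
  exists (rung u y h 0); split=> //; exact: full_ends.
set w0 := rung _ _ _ _ in wf fu fy nw0.
have [uA uB AB unB ynA] := uniq_verts_node uq.
have num := uniq_verts_neq uA; have nmy := uniq_verts_neq uB.
have nmu : m != u by rewrite eq_sym.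
have nyu : y != u by rewrite eq_sym.
case: hAB => [[hA hB]|[hA hB]].
- have [wA [okA f0 e1]] := IHA _ _ hA uA.
  have [wB [okB sB eB]] := HP hB uB.
  have szB : forall c, c \in wB -> size c.1 = h by case: okB.
  have {okB} okB := word_flip okB.
  have {}sB := starts_flip szB sB; have {}eB := ends_flip szB eB.
  rewrite !subn1 in sB eB.
  (* One empty row under u: the flipped drawing takes the lowest [h] of the [h + 2] rows, with m and
     y at the bottom. *)
  have [ok1 f1] := word_over 1 (starts_nnil sB) unB okB.
  have s1 := starts_over 1 nmu sB; have {}eB := ends_over 1 nyu eB.
  rewrite add1n prednK // in s1 eB.
  set w1 := map _ _ in ok1 f1 s1 eB; have n1 : w1 <> [::] := starts_nnil s1.
  have ay : absent y wA by case: okA => _ _ /(_ y ynA).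
  have nA := ends_nnil e1.
  exists ((wA ++ w1) ++ w0); split.
  + have ok01 : word_for h.+2 (verts A u m ++ (u :: verts B m y))
      (edges A u m :|: edges B m y) (wA ++ w1).
      apply: word_cat okA ok1 _ => z zA; rewrite in_cons => /orP[/eqP->|zB].
        exact: full_shared f0 f1.
      by rewrite (AB _ zA zB); exists h.+1.
    apply: (word_weaken _ _ (word_cat ok01 wf _)).
    * move=> z; rewrite mem_verts_node !mem_cat !(mem_verts, in_cons) ?in_nil.
      by do !case: (_ \in inn _); do !case: (_ == _).
    * by rewrite edges_node setUC.
    * move=> z _; rewrite !in_cons in_nil orbF => /orP[]/eqP->.
        apply: full_shared fu => //; first exact: cat_nnil.
        exact/full_cat.
      by exists h.+1; split; [apply: absent_ends|apply: full_starts].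
  + by apply/full_cat; split=> //; apply/full_cat.
  + by apply: ends_full_cat => //; apply: absent_ends.
- have [wB [okB e0 e1]] := ribbon_layout hB uB.
  have [wA [okA fA sA]] := fan_layout hA uA.
  have [okB1 fB1] := word_over 0 (ends_nnil e0) unB okB.
  (* Between ribbon and fan, m is in row 1 on both sides of the border: the top row of the ribbon
     has been lowered by one, and the fan begins with m in row 1. *)
  have {}e0 := ends_over 0 nmu e0; have {}e1 := ends_over 0 nyu e1.
  set wB1 := map _ _ in okB1 fB1 e0 e1; have nB1 : wB1 <> [::] := ends_nnil e0.
  have [ok1 f1] := word_under (starts_nnil sA) ynA okA.
  have s1 := starts_under nmy sA; have {}fA := full_under nuy fA.
  set w1 := map _ _ in ok1 f1 s1 fA; have n1 : w1 <> [::] := starts_nnil s1.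
  exists ((wB1 ++ w1) ++ w0); split.
  + have ok01 : word_for h.+2 ((u :: verts B m y) ++ (y :: verts A u m))
      (edges B m y :|: edges A u m) (wB1 ++ w1).
      apply: word_cat okB1 ok1 _ => z; rewrite in_cons => /orP[/eqP-> _|zB].
        exact: full_shared fB1 fA.
      rewrite in_cons => /orP[/eqP->|zA]; first by exists h.+1; split=> //; apply: full_starts.
      by rewrite (AB _ zA zB); exists 1.
    apply: (word_weaken _ _ (word_cat ok01 wf _)).
    * move=> z; rewrite mem_verts_node !mem_cat !(mem_verts, in_cons) ?in_nil.
      by do !case: (_ \in inn _); do !case: (_ == _).
    * by rewrite edges_node setUC (setUC (edges B _ _)).
    * move=> z _; rewrite !in_cons in_nil orbF => /orP[]/eqP->.
        apply: full_shared fu => //; first exact: cat_nnil.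
        exact/full_cat.
      by exists h.+1; split; [apply: ends_full_cat|apply: full_starts].
  + by apply/full_cat; split=> //; apply/full_cat.
  + by apply: ends_full_cat => //; apply: ends_full_cat.
Qed.


Lemma word_add_edge k X E e w : word_for k X E w -> has_edge w e -> word_for k X (e |: E) w.
Proof. by case=> h1 h2 h3 h4 he; split=> // f /setU1P[->|/h4]. Qed.

Lemma leaf_layout k u v : 0 < k -> u != v -> exists w, root_word k Leaf u v w.
Proof.
case: k => // k _ nuv.
pose cu : column V := (Some u :: nseq k None, set0).
pose cm : column V := (None :: nseq k None, [set u; v]).
pose cv : column V := (Some v :: nseq k None, set0).
have hd x (y : {set V}) : at_row x 0 (Some x :: nseq k None, y).
  by exists [::], (nseq k None); rewrite mem_nseq andbF.
have su : starts u 0 [:: cu; cm; cv].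
  exists [:: cu], [:: cm; cv]; split=> // c; rewrite !in_cons in_nil orbF.
    by move=> /eqP->; apply: hd.
  by move=> /orP[]/eqP->; rewrite in_cons mem_nseq andbF orbF //; apply: contra nuv => /eqP[->].
have ev : ends v 0 [:: cu; cm; cv].
  exists [:: cu; cm], [:: cv]; split=> // c; rewrite !in_cons in_nil orbF.
    by move=> /orP[]/eqP->; rewrite in_cons mem_nseq andbF orbF //; apply: contra nuv => /eqP[->].
  by move=> /eqP->; apply: hd.
exists [:: cu; cm; cv]; split=> //; split.
- by move=> c; rewrite !in_cons in_nil orbF => /or3P[]/eqP-> /=; rewrite size_nseq.
- move=> x; rewrite mem_verts /= => /orP[]/eqP->; [exact: starts_spans su|exact: ends_spans ev].
- move=> x; rewrite mem_verts /= negb_or => /andP[xu xv] c; rewrite !in_cons in_nil orbF.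
  by move=> /or3P[]/eqP->; rewrite in_cons mem_nseq andbF orbF.
- move=> e /set1P->; exists u, v; split=> //; right.
  exists [::], cu, cm, cv, [::]; split=> //.
  by exists [::], (nseq k None), [::], (nseq k None), [::], (nseq k None).
Qed.

(** Both sides of the root triangle are drawn alike, the right one from the mirrored tree and read
    backwards. The column between them carries the horizontal edge uv in the top row, where u ends
    and v begins, and continues c in the bottom row. *)
Lemma root_layout L c R u v : fan_ribbon_with H L -> fan_ribbon_with H (mirror R) ->
  uniq (verts (Node L c R) u v) -> exists w, root_word h.+2 (Node L c R) u v w.
Proof.
move=> hL hR uq.
have [uL uR LR unR vnL] := uniq_verts_node uq.
have nuc := uniq_verts_neq uL; have ncv := uniq_verts_neq uR.
have ncu : c != u by rewrite eq_sym.
have nvc : v != c by rewrite eq_sym.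
have [wL [okL fu eL]] := fan_ribbon_layout hL uL.
rewrite -uniq_verts_mirror in uR.
have [wR [/word_rev okR /full_rev fv /ends_rev eR]] := fan_ribbon_layout hR uR.
have {}okR : word_for h.+2 (verts R c v) (edges R c v) (rev wR).
  by apply: word_weaken okR; [move=> x; rewrite verts_mirror mem_rev|rewrite edges_mirror].
set wR' := rev wR in okR fv eR.
pose cm : column V := (nseq h.+1 None ++ [:: Some c], [set u; v]).
have fc : full c h.+1 [:: cm].
  move=> x; rewrite mem_seq1 => /eqP->; exists (nseq h.+1 None), [::].
  by rewrite size_nseq mem_nseq andbF.
have okm : word_for h.+2 [:: c] set0 [:: cm].
  split=> [x|x|x|x].
  - by rewrite mem_seq1 => /eqP-> /=; rewrite size_cat size_nseq addn1.
  - by rewrite mem_seq1 => /eqP->; apply/starts_spans/full_starts/fc.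
  - rewrite mem_seq1 => xc y; rewrite mem_seq1 => /eqP->; rewrite mem_cat mem_seq1 mem_nseq andbF /=.
    by apply: contra xc => /eqP[->].
  - by rewrite in_set0.
have au : absent u [:: cm] by case: okm => _ _ h3 _; apply: h3; rewrite mem_seq1.
have av : absent v [:: cm] by case: okm => _ _ h3 _; apply: h3; rewrite mem_seq1.
have auR : absent u wR' by case: okR => _ _ h3 _; apply: h3.
have avL : absent v wL by case: okL => _ _ h3 _; apply: h3.
have nL := ends_nnil eL; have nR := starts_nnil eR.
have hw : has_edge ((wL ++ [:: cm]) ++ wR') [set u; v].
  exists u, v; split=> //; right.
  case/lastP: (wL) nL okL fu => // w1 c1 _ okL fu.
  case: (wR') nR okR fv => // c2 w2 _ okR fv.
  exists w1, c1, cm, c2, w2; split=> //; first by rewrite -cats1 -!catA.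
  have in1 : c1 \in rcons w1 c1 by rewrite mem_rcons in_cons eqxx.
  have in2 : c2 \in c2 :: w2 by rewrite in_cons eqxx.
  have [p1 [q1 [e1 /size0nil p10 _ _]]] := fu _ in1; rewrite p10 in e1.
  have [p2 [q2 [e2 /size0nil p20 _ _]]] := fv _ in2; rewrite p20 in e2.
  case: okL => /(_ _ in1) s1 _ _ _; case: okR => /(_ _ in2) s2 _ _ _.
  exists [::], q1, [::], (nseq h None ++ [:: Some c]), [::], q2; split=> //.
  by move: s1 s2; rewrite e1 e2 /= size_cat size_nseq /= addn1 => -[->] [->].
exists ((wL ++ [:: cm]) ++ wR'); split.
- apply: (@word_weaken _ _ ((verts L u c ++ [:: c]) ++ verts R c v) _
    ([set u; v] |: ((edges L u c :|: set0) :|: edges R c v))).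
  + move=> x; rewrite mem_verts_node !mem_cat !(mem_verts, in_cons) ?in_nil.
    by do !case: (_ \in inn _); do !case: (_ == _).
  + by rewrite setU0.
  apply: word_add_edge hw; apply: word_cat okR _; first apply: word_cat okL okm _.
  + by move=> x _; rewrite mem_seq1 => /eqP->; exists h.+1; split=> //; apply: full_starts.
  + move=> x; rewrite mem_cat mem_seq1 => /orP[xL|/eqP->] xR.
      by rewrite (LR x xL xR); exists h.+1; split=> //; apply: ends_full_cat.
    by exists h.+1; split=> //; apply: ends_full_cat.
- by apply: starts_absent => //; apply: starts_absent => //; apply: full_starts.
- by apply: absent_ends; [apply/absent_cat|apply: full_ends].
Qed.

End Layout.

(** A bare edge takes one row and [root_layout] adds two rows per level, whence [d.*2.+1]; a leaf at
    positive depth just leaves rows empty. *)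
Lemma depth_layout (V : finType) d (t : tree V) u v :
  depth_le d t -> uniq (verts t u v) -> exists w, root_word d.*2.+1 t u v w.
Proof.
elim: d t u v => [|d IH] t u v; case: t => [|L c R] //.
- by move=> _ /uniq_verts_neq; apply: leaf_layout.
- by move=> _ /uniq_verts_neq; apply: leaf_layout.
- by case=> hL hR; apply: (root_layout _ IH hL hR).
Qed.

(** * Geometric realization *)

Section CellGeometry.
Variable V : finType.
Implicit Types (x a b : V) (e : {set V}) (w : seq (column V)).

Definition no_column : column V := ([::], set0).

Definition cell w i k : option V := nth None (nth no_column w i).1 k.

Definition vertex_at w x (p : nat * nat * nat) :=
  let: (l, r, j) := p in
  l <= r /\ forall i k, cell w i k = Some x <-> k = j /\ l <= i <= r.

(** The triple is a column and two rows; equal rows stand for a horizontal edge, with its ends in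
    the adjacent columns. That column [i] bears the label [e] keeps distinct edges in distinct
    columns. *)
Definition edge_at w e (p : nat * nat * nat) :=
  let: (i, k1, k2) := p in
  exists a b,
  [/\ e = [set a; b], i < size w, (nth no_column w i).2 = e &
   [/\ k1 < k2, cell w i k1 = Some a, cell w i k2 = Some b &
       forall k, k1 < k < k2 -> cell w i k = None] \/
   [/\ k1 = k2, 0 < i, cell w i.-1 k1 = Some a, cell w i k1 = None &
       cell w i.+1 k1 = Some b]].

Lemma spans_vertex_at w x : spans x w -> exists p, vertex_at w x p.
Proof.
case=> w1 [w2 [w3 [j [-> n2 h1 h2 h3]]]].
have s2 : 0 < size w2 by case: (w2) n2.
exists (size w1, (size w1 + size w2).-1, j); split; first lia.
move=> i k; rewrite /cell !nth_cat.
have abs_nth w0 i0 : absent x w0 -> nth None (nth no_column w0 i0).1 k <> Some x.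
  move=> h0; case: (ltnP i0 (size w0)) => hi; last by rewrite (nth_default _ hi) nth_nil.
  have := h0 _ (mem_nth no_column hi).
  move: (nth _ _ _).1 => s hn he; case: (ltnP k (size s)) => hk.
    by rewrite -he mem_nth in hn.
  by rewrite nth_default in he.
case: ltnP => hi1; first by split=> [/(abs_nth _ _ h1)//|[_ ?]]; exfalso; lia.
case: ltnP => hi2; last by split=> [/(abs_nth _ _ h3)//|[_ ?]]; exfalso; lia.
have [p [q [-> <- hp hq]]] := h2 _ (mem_nth no_column hi2).
rewrite nth_cat; case: ltnP => hk.
  split=> [he|[? _]]; last lia.
  by rewrite -he mem_nth in hp.
split=> [|[-> _]]; last by rewrite subnn.
case e: (k - size p) => [|m] /=; first by move=> _; split; lia.
case: (ltnP m (size q)) => hm; last by rewrite nth_default.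
by move=> he; rewrite -he mem_nth in hq.
Qed.

Lemma has_edge_at w e : has_edge w e -> exists p, edge_at w e p.
Proof.
case=> a [b [-> [[c [p [k [q [hc h1 h2]]]]]|[w1 [c1 [c [c2 [w2 [-> h1 h2]]]]]]]]].
- have hi : index c w < size w by rewrite index_mem.
  exists (index c w, size p, size p + k.+1); exists a, b.
  rewrite /cell nth_index // h1 h2; split=> //; left; split.
  + lia.
  + by rewrite nth_cat ltnn subnn.
  + rewrite nth_cat ltnNge leq_addr /= addKn /= nth_cat size_nseq ltnn subnn //.
  + move=> m /andP[hm1 hm2]; rewrite nth_cat ltnNge (ltnW hm1) /=.
    have -> : m - size p = (m - size p).-1.+1 by lia.
    rewrite /= nth_cat size_nseq; case: ltnP => hk; last lia.
    by rewrite nth_nseq hk.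
- case: h2 => p1 [q1 [p [q [p2 [q2 [e1 e2 e3 [s1 s2] _]]]]]].
  have cN j : nth no_column (w1 ++ [:: c1; c; c2] ++ w2) (j + size w1) =
              nth no_column ([:: c1; c; c2] ++ w2) j.
    by rewrite nth_cat ltnNge leq_addl addnK.
  have := cN 2; have := cN 1; have := cN 0; rewrite /= add0n add1n add2n => n0 n1 n2.
  exists ((size w1).+1, size p, size p); exists a, b.
  rewrite /cell /= n0 n1 n2 size_cat /=.
  split=> //; first by rewrite -addn1 ltn_add2l.
  right; rewrite e1 e2 e3; split=> //.
  + by rewrite -s1 nth_cat ltnn subnn.
  + by rewrite nth_cat ltnn subnn.
  + by rewrite s2 nth_cat ltnn subnn.
Qed.

End CellGeometry.

Section Realization.
Import Order.TTheory GRing.Theory Num.Theory.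
Local Open Scope ring_scope.
Variable R : realType.
Implicit Types (b : nat * nat * nat * nat) (z : R * R).

Definition box_seg b : segment R :=
  let: (x1, x2, y1, y2) := b in Segment (x1%:R, y1%:Z) (x2%:R, y2%:Z).

Lemma on_box_seg x1 x2 y1 y2 z : (x1 <= x2)%N -> (y1 <= y2)%N ->
  on_seg (box_seg (x1, x2, y1, y2)) z =
  (x1%:R <= z.1 <= x2%:R) && (y1%:R <= z.2 <= y2%:R).
Proof.
move=> hx hy; rewrite /on_seg /= -!pmulrn.
by rewrite !(min_l, max_r) ?ler_nat.
Qed.

Lemma boxes_overlap x1 x2 y1 y2 x1' x2' y1' y2' z :
  (x1 <= x2)%N -> (y1 <= y2)%N -> (x1' <= x2')%N -> (y1' <= y2')%N ->
  on_seg (box_seg (x1, x2, y1, y2)) z -> on_seg (box_seg (x1', x2', y1', y2')) z ->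
  [/\ (x1 <= x2')%N, (x1' <= x2)%N, (y1 <= y2')%N & (y1' <= y2)%N].
Proof.
move=> h1 h2 h3 h4; rewrite !on_box_seg // => /andP[/andP[a1 a2] /andP[a3 a4]].
move=> /andP[/andP[b1 b2] /andP[b3 b4]].
split; rewrite -(ler_nat R).
- exact: le_trans a1 b2.
- exact: le_trans b1 a2.
- exact: le_trans a3 b4.
- exact: le_trans b3 a4.
Qed.

Lemma on_box_point x1 x2 y1 y2 (x y : nat) : (x1 <= x <= x2)%N -> (y1 <= y <= y2)%N ->
  on_seg (box_seg (x1, x2, y1, y2)) (point_of (x%:R, y%:Z)).
Proof.
move=> /andP[hx1 hx2] /andP[hy1 hy2]; rewrite on_box_seg /=; last 2 first.
- exact: leq_trans hx2.
- exact: leq_trans hy2.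
by rewrite -pmulrn !ler_nat hx1 hx2 hy1.
Qed.

Lemma box_layer x1 x2 y1 y2 x (m : int) : (x1 <= x2)%N -> (y1 <= y2)%N ->
  on_seg (box_seg (x1, x2, y1, y2)) (x, m%:~R) -> exists2 k : nat, m = k & (k <= y2)%N.
Proof.
move=> hx hy; rewrite on_box_seg // => /andP[_ /= /andP[h1 h2]].
move: h1 h2; rewrite !pmulrn !ler_int; case: m => // k h1 h2.
by exists k.
Qed.

(* Rescaling by 3 leaves room for the endpoints: a vertex met in the columns
   l, .., r fills [3l+1, 3r+3], a vertical edge of column i has abscissa 3i+2,
   and a horizontal one fills [3i, 3i+4]. *)
Definition vertex_box (p : nat * nat * nat) : nat * nat * nat * nat :=
  let: (l, r, j) := p in ((3 * l).+1, (3 * r).+3, j, j)%N.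

Definition edge_box (p : nat * nat * nat) : nat * nat * nat * nat :=
  let: (i, k1, k2) := p in
  if k1 == k2 then (3 * i, (3 * i).+4, k1, k2)%N else ((3 * i).+2, (3 * i).+2, k1, k2)%N.

Lemma edge_box_vert i k1 k2 : (k1 < k2)%N ->
  edge_box (i, k1, k2) = ((3 * i).+2, (3 * i).+2, k1, k2)%N.
Proof. by rewrite /edge_box ltn_neqAle => /andP[/negPf->]. Qed.

Lemma edge_box_hor i k : edge_box (i, k, k) = (3 * i, (3 * i).+4, k, k)%N.
Proof. by rewrite /edge_box eqxx. Qed.

Variable V : finType.

(** A point common to two segments gives inequalities between indices, and these produce a cell with
    two contents: two vertices, or a foreign vertex where an edge has an end or needs an empty cell.
    Two edges have different columns and do not meet at all. *)
Lemma word_drawing (G : graph V) h X w :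
  vset G =i X -> word_for h X (eset G) w ->
  exists D : drawing R V, [/\ flat_visibility_representation G D, planar_drawing G D &
    height_at_most G D h].
Proof.
move=> eX [hsz hX hnX hE].
have [fv fvP] : {f : V -> nat * nat * nat & forall x, x \in vset G -> vertex_at w x (f x)}.
  apply: (boolp.choice (P := fun x p => x \in vset G -> vertex_at w x p)) => x.
  case xG: (x \in vset G); last by exists (0, 0, 0)%N.
  by rewrite eX in xG; have [p hp] := spans_vertex_at (hX x xG); exists p.
have [fe feP] : {f : {set V} -> nat * nat * nat & forall e, e \in eset G -> edge_at w e (f e)}.
  apply: (boolp.choice (P := fun e p => e \in eset G -> edge_at w e p)) => e.
  case eG: (e \in eset G); last by exists (0, 0, 0)%N.
  by have [p hp] := has_edge_at (hE e eG); exists p.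
have endG e x : e \in eset G -> x \in e -> x \in vset G.
  by move=> eG xe; have /forall_inP /(_ e eG) /andP[/fintype.subsetP /(_ x xe)] := eset_wf G.
have vcell x y i k l r j l' r' j' : vertex_at w x (l, r, j) -> vertex_at w y (l', r', j') ->
    cell w i k = Some x -> cell w i k = Some y -> x = y.
  by move=> _ _ -> [].
exists (Drawing (fun x => box_seg (vertex_box (fv x))) (fun e => box_seg (edge_box (fe e)))).
have rowlt i k x : cell w i k = Some x -> (k < h)%N.
  rewrite /cell; case: (ltnP i (size w)) => hi; last by rewrite (nth_default _ hi) nth_nil.
  rewrite -(hsz _ (mem_nth (no_column V) hi)).
  by case: (ltnP k (size _)) => // hk; rewrite nth_default.
split; first split.
- move=> x xG /=; have := fvP x xG; case: (fv x) => [[l r] j] /= [lr _].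
  split=> // -[] /eqP; rewrite eqr_nat; lia.
- move=> x y xy; have := feP _ xy; case efe: (fe [set x; y]) => [[i k1] k2] [a [b [e1 e2 e3 hor]]].
  have eab : [set a; b] \in eset G by rewrite -e1.
  have aG := endG _ _ eab (set21 a b); have bG := endG _ _ eab (set22 a b).
  have ja : joins (box_seg (edge_box (i, k1, k2))) (box_seg (vertex_box (fv a)))
      (box_seg (vertex_box (fv b))).
    left; move: (fvP _ aG) (fvP _ bG).
    case: (fv a) => [[l r] j] [lr hv]; case: (fv b) => [[l' r'] j'] [lr' hv'].
    case: hor => [[lt /hv[ek ha] /hv'[ek' hb] _]|[<- i0 /hv[-> ha] _ /hv'[-> hb]]].
      by rewrite edge_box_vert // ek ek'; split; apply: on_box_point; lia.
    (* The abscissa [3i] is the last one of column [i - 1], and [3i + 4] is the first one of column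
       [i + 1]. *)
    by rewrite edge_box_hor; split; apply: on_box_point; lia.
  split.
    rewrite [eseg _ _]/= efe; case: hor => [[lt _ _ _]|[<- _ _ _ _]].
      by right; rewrite edge_box_vert.
    by left; rewrite edge_box_hor.
  rewrite /= efe.
  have : x \in [set a; b] by rewrite -e1 set21.
  have : y \in [set a; b] by rewrite -e1 set22.
  have nxy : x != y.
    have /forall_inP /(_ _ xy) /andP[_] := eset_wf G.
    by rewrite cards2; case: (x == y).
  rewrite !inE => /orP[]/eqP yy /orP[]/eqP xx; subst; rewrite ?eqxx // in nxy.
  by case: ja => ja; [right|left].
- split.
  + move=> x y z xG yG xy /=; apply/negP => /andP[].
    move: (fvP _ xG) (fvP _ yG).
    case: (fv x) => [[l r] j] [lr hv]; case: (fv y) => [[l' r'] j'] [lr' hv'] /=.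
    move=> o1 o2; have [] := boxes_overlap _ _ _ _ o1 o2; try lia.
    move=> h1 h2 h3 h4.
    have c1 : cell w (maxn l l') j = Some x by apply/hv; split=> //; lia.
    have c2 : cell w (maxn l l') j = Some y by apply/hv'; split; lia.
    by move: c1 xy; rewrite c2 => -[->]; rewrite eqxx.
  + move=> x e z xG eG xe /=; apply/negP => /andP[].
    move: (fvP _ xG) (feP _ eG).
    case: (fv x) => [[l r] j] [lr hv]; case: (fe e) => [[i k1] k2] [a [b [e1 e2 e3 hor]]].
    have [xa xb] : x <> a /\ x <> b.
      by split=> xx; move: xe; rewrite e1 xx ?set21 ?set22.
    have nxt i' k c : cell w i' k = c -> c <> Some x -> ~ (k = j /\ l <= i' <= r)%N.
      by move=> ec nc /hv; rewrite ec.
    have sx y : x <> y -> Some y <> Some x by move=> n [/esym].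
    case: hor => [[lt ca cb cn]|[ek i0 ca cn cb]].
      rewrite edge_box_vert // => o1 o2; have [] := boxes_overlap _ _ _ _ o1 o2; try lia.
      move=> h1 h2 h3 h4.
      have cnj : (k1 < j < k2)%N -> cell w i j = None by apply: cn.
      have n1 := nxt _ _ _ ca (sx _ xa); have n2 := nxt _ _ _ cb (sx _ xb).
      have n3 : ~ (k1 < j < k2)%N by move=> /cnj/nxt/(_ _); case=> //; split=> //; lia.
      have [?|?] : (j = k1 \/ j = k2)%N by lia.
        by apply: n1; split; lia.
      by apply: n2; split; lia.
    rewrite -ek edge_box_hor => o1 o2; have [] := boxes_overlap _ _ _ _ o1 o2; try lia.
    move=> h1 h2 h3 h4.
    have n1 := nxt _ _ _ ca (sx _ xa); have n2 := nxt _ _ _ cb (sx _ xb).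
    have n3 : ~ (k1 = j /\ l <= i <= r)%N by apply: nxt cn _.
    have [?|[?|?]] : (l <= i.-1 <= r \/ l <= i <= r \/ l <= i.+1 <= r)%N by lia.
    * by apply: n1; split=> //; lia.
    * by apply: n3; split=> //; lia.
    * by apply: n2; split=> //; lia.
  + move=> e e' z eG eG' ne /=.
    move: (feP _ eG) (feP _ eG').
    case: (fe e) => [[i k1] k2] [a [b [e1 e2 e3 hor]]].
    case: (fe e') => [[i' k1'] k2'] [a' [b' [e1' e2' e3' hor']]] o1 o2; exfalso.
    have ni : i <> i' by move=> ii; move: ne; rewrite -e3 -e3' ii eqxx.
    case: hor => [[lt ca cb cn]|[ek i0 ca cn cb]];
    case: hor' => [[lt' ca' cb' cn']|[ek' i0' ca' cn' cb']].
    * move: o1 o2; rewrite !edge_box_vert // => o1 o2.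
      by have [] := boxes_overlap _ _ _ _ o1 o2; lia.
    * move: o1 o2; rewrite -ek' edge_box_hor edge_box_vert // => o1 o2.
      by have [] := boxes_overlap _ _ _ _ o1 o2; lia.
    * move: o1 o2; rewrite -ek edge_box_hor edge_box_vert // => o1 o2.
      by have [] := boxes_overlap _ _ _ _ o1 o2; lia.
    (* Here arithmetic leaves the case of adjacent columns and one row; then one edge would have an
       end in the cell that the other needs empty. *)
    * move: o1 o2; rewrite -ek -ek' !edge_box_hor => o1 o2.
      have [] := boxes_overlap _ _ _ _ o1 o2; try lia.
      move=> h1 h2 h3 h4; have kk : k1 = k1' by lia.
      have [ii|ii] : (i' = i.+1 \/ i = i'.+1)%N by lia.
        by move: ca'; rewrite ii /= -kk cn.
      by move: ca; rewrite ii /= kk cn'.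
- apply: (cardinality.card_le_trans _ (cardinality.card_image_le Posz _)).
  apply: cardinality.subset_card_le => m [x] [[y yG]|[e eG]] /=.
  + move: (fvP _ yG); case: (fv y) => [[l r] j] [lr hv] /= /box_layer[]; try lia.
    move=> k -> hk; exists k => //=; apply: leq_ltn_trans hk _.
    have /rowlt // : cell w l j = Some y by apply/hv; lia.
  + move: (feP _ eG); case: (fe e) => [[i k1] k2] [a [b [e1 e2 e3 hor]]].
    have lk : (k1 <= k2)%N by case: hor => -[]; lia.
    have k2h : (k2 < h)%N by case: hor => [[_ _ /rowlt]|[<- _ /rowlt]].
    by rewrite /edge_box; case: eqP => _ /box_layer[]; try lia; move=> k -> hk;
      exists k => //=; apply: leq_ltn_trans hk _.
Qed.

End Realization.

(** * Graphs glued from two trees *)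

Section GraphBasics.
Variable V : finType.
Implicit Types (G : graph V) (a b c x y z : V) (e A : {set V}).

Lemma adj_sym G a b : adj G a b = adj G b a.
Proof. by rewrite /adj setUC. Qed.

Lemma edge_ends G e a : e \in eset G -> a \in e -> a \in vset G.
Proof. by move=> eG ae; have /forall_inP /(_ e eG) /andP[/fintype.subsetP /(_ a ae)] := eset_wf G. Qed.

Lemma adj_neq G a b : adj G a b -> a != b.
Proof.
by move=> ab; have /forall_inP /(_ _ ab) /andP[_] := eset_wf G; rewrite cards2; case: (a == b).
Qed.

Lemma adj_vset G a b : adj G a b -> a \in vset G /\ b \in vset G.
Proof. by move=> ab; split; apply: edge_ends ab _; rewrite !inE eqxx ?orbT. Qed.

Lemma adj_minus_sym G A : symmetric (adj_minus G A).
Proof. by move=> a b; rewrite /adj_minus adj_sym; case: (a \in A); case: (b \in A). Qed.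

Lemma connect_adj_minus_sym G A : connect_sym (adj_minus G A).
Proof. by apply: fingraph.sym_connect_sym; apply: adj_minus_sym. Qed.

Lemma sorted_connected_minus G A (l : seq V) : sorted (adj G) l ->
  (forall a, a \in l -> a \notin A) -> (forall a, a \in vset G -> a \notin A -> a \in l) ->
  connected_minus G A.
Proof.
case: l => [|a0 l] /= hl lA Al.
  apply/forall_inP => a; rewrite in_setD => /andP[aA aG].
  by have := Al a aG aA.
have c0 a : a \in a0 :: l -> connect (adj_minus G A) a0 a.
  move=> al; have : path (adj_minus G A) a0 l.
    elim: l a0 hl lA {Al al} => //= b l IH a0 /andP[ab bl] lA.
    rewrite /adj_minus ab !lA ?in_cons ?eqxx ?orbT //=.
    by apply: IH => // c cl; apply: lA; rewrite in_cons cl orbT.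
  by move/path_connect; apply.
apply/forall_inP => a; rewrite in_setD => /andP[aA aG].
apply/forall_inP => b; rewrite in_setD => /andP[bA bG].
apply: (connect_trans (y := a0)); last exact/c0/Al.
by rewrite connect_adj_minus_sym; apply/c0/Al.
Qed.

(** Some step of a walk from a to b in G - A leaves C. In this form connectedness is exploited
    below. *)
Lemma connected_exit G A (C : pred V) a b : connected_minus G A ->
  a \in vset G -> b \in vset G -> a \notin A -> b \notin A -> C a -> ~~ C b ->
  exists a' b', [/\ adj G a' b', a' \notin A, b' \notin A, C a' & ~~ C b'].
Proof.
move=> /forall_inP hG aG bG aA bA Ca Cb.
have /hG /forall_inP h : a \in vset G :\: A by rewrite in_setD aA.
have /h /connectP[p hp eb] : b \in vset G :\: A by rewrite in_setD bA.
elim: p a Ca hp eb {h aG aA} => [|c p IH] a Ca /= => [_ eb|/andP[ac cp] eb].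
  by rewrite eb Ca in Cb.
case Cc: (C c); first exact: (IH c).
by case/and3P: ac => aA cA ac; exists a, c; rewrite Cc.
Qed.

(** Rotated to begin with a, the outer cycle leaves a spanning path of the other vertices. *)
Lemma cycle_connected_minus1 G (l : seq V) a : uniq l -> l =i vset G -> cycle (adj G) l ->
  a \in vset G -> connected_minus G [set a].
Proof.
move=> ul lG cl aG; have al : a \in l by rewrite lG.
case: (rot_to al) => i l' el.
have : cycle (adj G) (a :: l') by rewrite -el rot_cycle.
have : uniq (a :: l') by rewrite -el rot_uniq.
move=> /= /andP[al' _]; rewrite rcons_path => /andP[/path_sorted h _].
apply: (sorted_connected_minus h) => b.
  by move=> bl; rewrite in_set1; apply: contraNneq al' => <-.
by rewrite -lG -(mem_rot i) el in_cons in_set1 => /orP[->|].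
Qed.

Lemma set2_eq (T : finType) (p q r s : T) : [set p; q] = [set r; s] ->
  (p = r /\ q = s) \/ (p = s /\ q = r).
Proof.
move=> e.
have : p \in [set r; s] by rewrite -e set21.
have : q \in [set r; s] by rewrite -e set22.
have : r \in [set p; q] by rewrite e set21.
have : s \in [set p; q] by rewrite e set22.
rewrite !in_set2.
by do 4 (case/orP => /eqP ?); subst; auto.
Qed.

End GraphBasics.

(** * Two triangulated polygons on the two sides of an edge *)

Section Glued.
Variable V : finType.
Implicit Types (G : graph V) (t s o A B : tree V) (a b c u v w x y z m : V) (e : {set V}).

Lemma root_edge t u v : [set u; v] \in edges t u v.
Proof. by case: t => [|L z R]; rewrite /= !inE eqxx. Qed.

Lemma edges_verts t u v e a : e \in edges t u v -> a \in e -> a \in verts t u v.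
Proof.
elim: t u v => [|L IHL z R IHR] u v.
  by move=> /set1P->; rewrite in_set2 mem_verts => /orP[]->; rewrite ?orbT.
rewrite edges_node !in_setU in_set1 mem_verts_node => /or3P[/eqP->||].
- by rewrite in_set2 !mem_verts => /orP[]->; rewrite ?orbT.
- by move=> /IHL h /h ->.
- by move=> /IHR h /h ->; rewrite orbT.
Qed.

Lemma edges_path G t u v : edges t u v \subset eset G -> path (adj G) u (inn t ++ [:: v]).
Proof.
elim: t u v => [|L IHL z R IHR] u v.
  by move=> /fintype.subsetP h; rewrite /= andbT; apply: h; rewrite in_set1.
rewrite edges_node !subUset => /and3P[_ /IHL hL /IHR hR].
by rewrite /= -catA cat_cons -cat_rcons -cats1 cat_path hL last_cat.
Qed.

(** The sides of the root triangle meet in its apex only, so a vertex joined to x within one and to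
    y within the other is that apex: inside the polygon the root edge lies in one triangle. *)
Lemma apex_unique t x y w : uniq (verts t x y) -> w != x -> w != y ->
  [set x; w] \in edges t x y -> [set w; y] \in edges t x y -> exists A B, t = Node A w B.
Proof.
case: t => [|A z B] uq wx wy.
  by move=> /set1P /set2_eq[[_ /eqP]|[_ /eqP]]; rewrite ?(negPf wx) ?(negPf wy).
have [uA uB AB xB yA] := uniq_verts_node uq.
rewrite edges_node !in_setU !in_set1 => /or3P[/eqP/set2_eq||].
- by case=> -[_ /eqP]; rewrite ?(negPf wx) ?(negPf wy).
- move=> /edges_verts /(_ (set22 _ _)) wA /or3P[/eqP/set2_eq||].
  + by case=> -[/eqP]; rewrite ?(negPf wx) ?(negPf wy).
  + by move=> /edges_verts /(_ (set22 _ _)); rewrite (negPf yA).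
  + by move=> /edges_verts /(_ (set21 _ _)) wB; rewrite (AB _ wA wB); exists A, B.
- by move=> /edges_verts /(_ (set21 _ _)); rewrite (negPf xB).
Qed.

(* G is the union of the triangulated polygons s and o, on both sides of the
   edge xy. *)
Definition glued G x y s o :=
  [/\ uniq (x :: inn s ++ y :: inn o), vset G =i x :: inn s ++ y :: inn o &
      eset G = edges s x y :|: edges o y x].

(** Moves the distinguished edge across the triangle xyz to its side xz, with y as apex of the
    triangle now behind it. As [o] is read from y to x, the outer cycle is unchanged. *)
Lemma glued_left G x y A z B o : glued G x y (Node A z B) o -> glued G x z A (Node B y o).
Proof.
case=> uq eV eE; split.
- by move: uq; rewrite /= -catA.
- by move=> a; rewrite eV /= -catA.
- apply/setP => e; rewrite eE /= !in_setU !in_set1.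
  case: eqP => [->|_]; first by rewrite (setUC [set x]) root_edge !orbT.
  case: eqP => [->|_]; first by rewrite (setUC [set z]) root_edge.
  by rewrite !orFb orbA.
Qed.

Lemma glued_perm G x y s o x' y' s' o' :
  perm_eq (x :: inn s ++ y :: inn o) (x' :: inn s' ++ y' :: inn o') ->
  edges s x y :|: edges o y x = edges s' x' y' :|: edges o' y' x' ->
  glued G x y s o -> glued G x' y' s' o'.
Proof.
move=> hp he [uq eV eE]; split.
- by rewrite -(perm_uniq hp).
- by move=> a; rewrite eV (perm_mem hp).
- by rewrite eE.
Qed.

Lemma glued_swap G x y s o : glued G x y s o -> glued G y x o s.
Proof.
apply: glued_perm; last by rewrite setUC.
by rewrite -!cat_cons perm_catC.
Qed.

Lemma glued_mirror G x y s o : glued G x y s o -> glued G y x (mirror s) (mirror o).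
Proof.
apply: glued_perm; last by rewrite !edges_mirror.
by apply/permP => p; rewrite /= !count_cat /= !inn_mirror !count_rev; lia.
Qed.

Lemma glued_right G x y A z B o : glued G x y (Node A z B) o -> glued G z y B (Node o x A).
Proof.
apply: glued_perm.
  by apply/permP => p; rewrite /= !count_cat /= !count_cat /=; lia.
apply/setP => e; rewrite /= !in_setU !in_set1.
case: eqP => [->|_]; first by rewrite (setUC [set x]) root_edge !orbT.
case: eqP => [->|_]; first by rewrite (setUC [set y]) root_edge !orbT.
by rewrite !orFb; case: (e \in edges A _ _); case: (e \in edges B _ _); rewrite ?orbT ?orbF.
Qed.

Section GluedFacts.
Variables (G : graph V) (x y : V) (s o : tree V).
Hypothesis g : glued G x y s o.

Lemma glued_uniq : [/\ uniq (verts s x y), uniq (verts o y x), x != y,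
  forall a, a \in inn s -> a \notin verts o y x & forall a, a \in inn o -> a \notin verts s x y].
Proof.
case: g => uq _ _; move: uq; rewrite cons_uniq cat_uniq cons_uniq.
case/andP=> xs /and3P[us hs /andP[yo uo]].
move: xs; rewrite mem_cat in_cons !negb_or => /and3P[xs xy xo].
have h a : a \in y :: inn o -> a \notin inn s by move=> ha; move/hasPn: hs; apply.
have ys : y \notin inn s by apply: h; rewrite in_cons eqxx.
split=> //.
- by rewrite /verts cons_uniq mem_cat negb_or xs mem_seq1 xy cat_uniq us /= orbF ys.
- by rewrite /verts cons_uniq mem_cat negb_or yo mem_seq1 eq_sym xy cat_uniq uo /= orbF xo.
- move=> a as_; rewrite mem_verts !negb_or; apply/and3P; split.
  + by apply: contraNneq ys => <-.
  + by apply: contraL as_ => ao; apply: h; rewrite in_cons ao orbT.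
  + by apply: contraNneq xs => <-.
- move=> a ao; rewrite mem_verts !negb_or; apply/and3P; split.
  + by apply: contraNneq xo => <-.
  + by apply: h; rewrite in_cons ao orbT.
  + by apply: contraNneq yo => <-.
Qed.

Lemma glued_vset a : (a \in vset G) = (a \in verts s x y) || (a \in inn o).
Proof.
case: g => _ -> _; rewrite mem_verts in_cons mem_cat in_cons.
by do !case: (_ \in inn _); do !case: (_ == _).
Qed.

Lemma glued_edge : adj G x y.
Proof. by case: g => _ _ e; rewrite /adj e in_setU root_edge. Qed.

Lemma glued_edges e : (e \in eset G) = (e \in edges s x y) || (e \in edges o y x).
Proof. by case: g => _ _ ->; rewrite in_setU. Qed.

Lemma glued_adj_inn a b : a \in inn s -> adj G a b -> [set a; b] \in edges s x y.
Proof.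
move=> ha; rewrite /adj glued_edges => /orP[//|/edges_verts /(_ (set21 _ _)) h].
by have [_ _ _ /(_ a ha)] := glued_uniq; rewrite h.
Qed.

Lemma glued_exit a b : a \in inn s -> adj G a b -> b \in verts s x y.
Proof. by move=> ha /(glued_adj_inn ha) /edges_verts; apply; apply: set22. Qed.

(** The two sides of xy share no other vertex, so a common neighbour of x and y is joined to both
    within one side and is the apex there. This locates the triangles of a subgraph without any
    embedding of it. *)
Lemma glued_common w : adj G x w -> adj G w y ->
  (exists A B, s = Node A w B) \/ (exists A B, o = Node A w B).
Proof.
move=> xw wy; have wx : w != x by rewrite eq_sym (adj_neq xw).
have wny := adj_neq wy; have [us uo _ hs ho] := glued_uniq.
have mix : w \in verts s x y -> w \in verts o y x -> False.
  rewrite mem_verts (negPf wx) (negPf wny) /= orbF => /hs.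
  by rewrite mem_verts (negPf wx) (negPf wny) /= orbF => /negPf->.
move: xw wy; rewrite /adj !glued_edges.
case/orP=> h1 /orP[] h2.
- by left; apply: apex_unique us wx wny h1 h2.
- by case: mix; [apply: edges_verts h1 _; apply: set22|apply: edges_verts h2 _; apply: set21].
- by case: mix; [apply: edges_verts h2 _; apply: set21|apply: edges_verts h1 _; apply: set22].
- by right; apply: apex_unique uo wny wx _ _; rewrite setUC.
Qed.

Lemma glued_subset : edges s x y \subset eset G.
Proof. by case: g => _ _ ->; apply: subsetUl. Qed.

Lemma glued_disconnected : s <> Leaf -> o <> Leaf -> ~~ connected_minus G [set x; y].
Proof.
move=> ns no; apply/negP => hc; have [us uo xy hs ho] := glued_uniq.
have [a ha] : exists a, a \in inn s.
  by case: s ns => // A z B _; exists z; rewrite mem_cat in_cons eqxx orbT.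
have [b hb] : exists b, b \in inn o.
  by case: o no => // A z B _; exists z; rewrite mem_cat in_cons eqxx orbT.
have nxy t p q c : uniq (verts t p q) -> c \in inn t -> c \notin [set p; q].
  rewrite /verts /= mem_cat negb_or cat_uniq => /andP[/andP[pt _]] /and3P[_ qt _] ct.
  rewrite in_set2 negb_or; apply/andP; split.
    by apply: contraNneq pt => <-.
  by apply: contraNneq qt => <-; rewrite /= orbF.
have aG : a \in vset G by rewrite glued_vset mem_verts ha orbT.
have bG : b \in vset G by rewrite glued_vset hb orbT.
have bxy : b \notin [set x; y] by rewrite setUC; apply: nxy uo hb.
have bs : b \notin inn s by have := ho b hb; rewrite mem_verts !negb_or => /and3P[].
have [a' [b' [ab aA bA Ca Cb]]] :=
  connected_exit hc aG bG (nxy _ _ _ _ us ha) bxy (C := mem (inn s)) ha bs.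
have := glued_exit Ca ab; rewrite mem_verts; move: bA; rewrite in_set2 negb_or.
by rewrite inE in Cb; case/andP=> /negPf-> /negPf->; rewrite (negPf Cb).
Qed.

Lemma glued_connected : o = Leaf -> connected_minus G [set x; y].
Proof.
move=> eo; have [us _ _ _ _] := glued_uniq.
have /edges_path hp := glued_subset.
have hi : sorted (adj G) (inn s).
  by move: hp; rewrite cat_path => /andP[/path_sorted].
apply: (sorted_connected_minus hi) => a.
  move=> ha; move: us; rewrite /verts /= mem_cat negb_or cat_uniq.
  case/andP=> /andP[xs _] /and3P[_ ys _]; rewrite in_set2 negb_or.
  apply/andP; split; first by apply: contraNneq xs => <-.
  by apply: contraNneq ys => <-; rewrite /= orbF.
rewrite glued_vset eo in_nil orbF mem_verts in_set2 negb_or.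
by case/or3P=> [->|//|->]; rewrite ?andbF.
Qed.

End GluedFacts.

(** A walk from one side to the other has to step on x or y; if one side is empty, the boundary path
    of the other one survives. *)
Lemma glued_noncutting G x y s o : glued G x y s o ->
  noncutting G [set x; y] <-> s = Leaf \/ o = Leaf.
Proof.
move=> g; rewrite /noncutting -[_ \in _]/(adj G x y) (glued_edge g) /=; split.
  move=> h; have n := glued_disconnected g.
  case: s n {g} => [|A z B] n; first by left.
  case: o n => [|A' z' B'] n; first by right.
  by have := n; rewrite h; case.
case=> [es|eo]; last exact: glued_connected g eo.
by rewrite setUC; apply: glued_connected (glued_swap g) es.
Qed.

Lemma glued_cutting G x y s o : glued G x y s o -> s <> Leaf -> o <> Leaf ->
  cutting G [set x; y].
Proof.
move=> g ns no; rewrite /cutting -[_ \in _]/(adj G x y) (glued_edge g) /=.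
exact: glued_disconnected g ns no.
Qed.

(** Descends to [e], crossing one triangle per step. The far side only grows, so whatever lay beyond
    the first edge, a root edge in particular, still lies beyond the last one; the size bound is for
    later inductions. *)
Lemma glued_locate G x y s o e : glued G x y s o -> e \in edges s x y ->
  exists x' y' s' o', [/\ e = [set x'; y'], glued G x' y' s' o',
    edges o y x \subset edges o' y' x' & size (inn s') <= size (inn s)].
Proof.
elim: s x y o => [|A IHA z B IHB] x y o g.
  by move=> /set1P->; exists x, y, Leaf, o.
rewrite edges_node !in_setU in_set1 => /or3P[/eqP->||].
- by exists x, y, (Node A z B), o.
- move=> /(IHA _ _ _ (glued_left g)) [x' [y' [s' [o' [h1 h2 h3 h4]]]]].
  exists x', y', s', o'; split=> //.
    apply: fintype.subset_trans h3; rewrite edges_node.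
    by apply: fintype.subset_trans (subsetUr _ _); apply: subsetUr.
  by apply: leq_trans h4 _; rewrite /= size_cat leq_addr.
- move=> /(IHB _ _ _ (glued_right g)) [x' [y' [s' [o' [h1 h2 h3 h4]]]]].
  exists x', y', s', o'; split=> //.
    apply: fintype.subset_trans h3; rewrite edges_node.
    by apply: fintype.subset_trans (subsetUr _ _); apply: subsetUl.
  by apply: leq_trans h4 _; rewrite /= size_cat /=; lia.
Qed.

End Glued.

(** * From embeddings to trees and back *)

Section Triangulation.
Variable V : finType.
Implicit Types (G : graph V) (t s o A B : tree V) (a b u v w x y z : V) (e : {set V}).
Implicit Types (c f m p q : seq V).

Lemma next_cat (f1 f2 : seq V) a b : uniq (f1 ++ a :: b :: f2) -> next (f1 ++ a :: b :: f2) a = b.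
Proof.
move=> uf; rewrite -(next_rot (size f1) uf) rot_size_cat.
by rewrite /= eqxx.
Qed.

Lemma next_last (f : seq V) a b : uniq (a :: rcons f b) -> next (a :: rcons f b) b = a.
Proof.
move=> uf; rewrite -(next_rot (size (a :: f)) uf) -rcons_cons -cats1 rot_size_cat.
by rewrite /= eqxx.
Qed.

Lemma mem_split (s : seq V) a : a \in s -> exists p q, s = p ++ a :: q.
Proof. by case/splitPr=> p q; exists p, q. Qed.

Lemma edge_pair G e : e \in eset G -> exists a b, e = [set a; b] /\ adj G a b.
Proof.
move=> eG; have /forall_inP /(_ e eG) /andP[_ /cards2P[a [b [_ eab]]]] := eset_wf G.
by exists a, b; rewrite /adj -eab.
Qed.

(* A shortest polygon with the given side has no diagonal, hence is a face. *)
Lemma embedding_apex G c x p : standard_embedding G c -> 2 <= size p ->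
  subseq (x :: p) c -> cycle (adj G) (x :: p) ->
  exists2 z, adj G x z & z \in p /\ adj G z (last x p).
Proof.
case=> [[_ uc _ _] [_ faces]].
have [n] := ubnP (size p); elim: n x p => // n IH x p lt_p p2 sub cyc.
have [f f0] : exists f, f = x :: p by exists (x :: p).
rewrite -f0 in sub cyc.
have uf : uniq f := subseq_uniq sub uc.
have sf : 3 <= size f by rewrite f0.
pose chord := [exists a, [exists b, [&& a \in f, b \in f, adj G a b, b != next f a & a != next f b]]].
case: (boolP chord) => [/existsP[a0 /existsP[b0]]|/existsPn noch]; last first.
  have /faces : interior_face G c f.
    split=> // a b af bf ab; have /existsPn /(_ b) := noch a.
    by rewrite af bf ab /= negb_and !negbK => /orP[]/eqP; auto.
  rewrite f0 /= => -[sp]; move: cyc; rewrite f0.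
  case: (p) sp => [|z [|y [|]]] //= _ /and4P[xz zy yx _].
  by exists z => //; rewrite mem_head.
move=> hch; have [a [b [f1 [m [f2 [ef ab nb na]]]]]] : exists a b f1 m f2,
    [/\ f = f1 ++ a :: m ++ b :: f2, adj G a b, b != next f a & a != next f b].
  case/and5P: hch => af bf ab nb na.
  have [f1 [r ef]] := mem_split af.
  move: bf; rewrite {1}ef mem_cat in_cons => /or3P[bf|/eqP eb|bf].
  - have [g1 [m eg]] := mem_split bf; exists b0, a0, g1, m, r.
    by rewrite adj_sym; split=> //; rewrite ef eg -catA.
  - by have := adj_neq ab; rewrite eb eqxx.
  - have [m [f2 m_er]] := mem_split bf; exists a0, b0, f1, m, f2.
    by split=> //; rewrite ef m_er.
clear chord hch.
have m0 : m != [::].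
  by apply/eqP => em; move: nb uf; rewrite ef em cat0s => nb uf; rewrite next_cat ?eqxx in nb.
have f12 : (f1 != [::]) || (f2 != [::]).
  rewrite -negb_and; apply/negP => /andP[/eqP e1 /eqP e2].
  move: na uf; rewrite ef e1 e2 cat0s cats1 => na uf.
  by rewrite next_last ?eqxx in na.
have sub' : subseq (f1 ++ a :: b :: f2) c.
  apply: subseq_trans sub; rewrite ef; apply: cat_subseq => //.
  by rewrite /= eqxx; apply: (@suffix_subseq _ m).
have mp : 0 < size m by case: (m) m0.
rewrite f0 in ef; case: f1 ef f12 sub' {nb na} => [|x' f1] [ex ep] f12 sub'.
  have f2s : 0 < size f2 by case: (f2) f12.
  subst a; have sz : size p = size m + (size f2).+1 by rewrite ep size_cat.
  have cyc' : cycle (adj G) (x :: b :: f2).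
    move: cyc; rewrite f0 /= ep !rcons_path /= cat_path /= last_cat /= ab.
    by case/andP=> /and3P[_ _ ->] ->.
  have l1 : size (b :: f2) < n.
    by move: lt_p mp; rewrite sz /=; clear; lia.
  have [z xz [zf zl]] := IH x (b :: f2) l1 f2s sub' cyc'.
  by exists z => //; rewrite ep mem_cat zf orbT last_cat.
subst x'; have sz : size p = size f1 + (size m + (size f2).+1).+1.
  by rewrite ep size_cat /= size_cat.
have cyc' : cycle (adj G) (x :: f1 ++ a :: b :: f2).
  move: cyc; rewrite f0 /= ep !rcons_path /= !(cat_path, last_cat) /= !(cat_path, last_cat) /= ab.
  by case/andP=> /and3P[-> -> /and3P[_ _ ->]] ->.
have l1 : size (f1 ++ a :: b :: f2) < n.
  by move: lt_p mp; rewrite sz size_cat /=; clear; lia.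
have l2 : 1 < size (f1 ++ a :: b :: f2) by rewrite size_cat /= !addnS.
have [z xz [zf zl]] := IH x (f1 ++ a :: b :: f2) l1 l2 sub' cyc'.
exists z => //; split.
  rewrite ep; move: zf; rewrite !(mem_cat, in_cons) => /or4P[] ->; rewrite ?orbT //.
by move: zl; rewrite ep !(last_cat, last_cons).
Qed.

(** The apex z of xy splits [m], and both parts are treated by induction. No edge is missed: an edge
    from one part to the other, except xy, would cross xz or zy. *)
Lemma embedding_tree G c : standard_embedding G c ->
  forall m p q x y, c = p ++ x :: m ++ y :: q -> adj G x y ->
  exists t, [/\ inn t = m, edges t x y \subset eset G &
    forall a b, a \in x :: rcons m y -> b \in x :: rcons m y -> adj G a b ->
      [set a; b] \in edges t x y].
Proof.
move=> emb m; have [[_ uc _ cc] [nc _]] := emb.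
have [n] := ubnP (size m); elim: n m => // n IH m lt_m p q x y ec xy.
case: (boolP (m == [::])) => [/eqP m0|m0].
  exists Leaf; rewrite m0; split=> //.
    by apply/fintype.subsetP => e /set1P->.
  move=> a b; rewrite /= !in_cons !in_nil !orbF in_set1.
  move=> /orP[]/eqP-> /orP[]/eqP-> // /adj_neq; rewrite ?eqxx //.
  by rewrite setUC.
have sub : subseq (x :: rcons m y) c.
  rewrite ec -cats1; apply: (subseq_trans _ (suffix_subseq _ _)).
  by rewrite -cat_cons -[y :: q]cat1s catA -cat_cons; apply: prefix_subseq.
have cyc : cycle (adj G) (x :: rcons m y).
  rewrite /= rcons_path last_rcons adj_sym xy andbT.
  move: cc; rewrite ec -(rot_cycle (size p)) rot_size_cat /= -cats1 -!catA.
  by rewrite -cat1s -!catA catA cats1 cat_path => /andP[].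
have sz : 2 <= size (rcons m y) by rewrite size_rcons; case: (m) m0.
have [z xz [zm zy]] := embedding_apex emb sz sub cyc.
rewrite last_rcons in zy.
have {}zm : z \in m by move: zm; rewrite mem_rcons in_cons (negPf (adj_neq zy)).
have [m1 [m2 em]] := mem_split zm.
have [||A [iA sA hA]] := IH m1 _ p (m2 ++ y :: q) x z _ xz.
- by move: lt_m; rewrite em size_cat /=; lia.
- by rewrite ec em -catA.
have [||B [iB sB hB]] := IH m2 _ (p ++ x :: m1) q z y _ zy.
- by move: lt_m; rewrite em size_cat /=; lia.
- by rewrite ec em -!catA.
have cross a b : a \in x :: m1 -> b \in rcons m2 y -> adj G a b -> a = x /\ b = y.
  move=> ha hb ab.
  move: ha; rewrite in_cons => /orP[/eqP ax|am].
    split=> //; move: hb; rewrite mem_rcons in_cons => /orP[/eqP//|bm].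
    rewrite ax in ab; have := nc x z b y; rewrite ab zy; case/(_ _)/negP => //.
    rewrite ec em; apply: subseq_trans (suffix_subseq _ _).
    rewrite /= eqxx -catA; apply: subseq_trans (suffix_subseq _ _) => /=.
    rewrite eqxx -cat1s; apply: cat_subseq; first by rewrite sub1seq.
    by rewrite sub1seq mem_head.
  have := nc x a z b; rewrite xz ab; case/(_ _)/negP => //.
  rewrite ec em; apply: subseq_trans (suffix_subseq _ _).
  rewrite /= eqxx -catA -cat1s; apply: cat_subseq; first by rewrite sub1seq.
  rewrite /= eqxx sub1seq mem_cat in_cons; move: hb; rewrite mem_rcons in_cons.
  by case/orP=> ->; rewrite ?orbT.
exists (Node A z B); split.
- by rewrite /= iA iB.
- by rewrite edges_node !subUset sA sB !andbT; apply/fintype.subsetP => e /set1P->.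
- have memE a : a \in x :: rcons m y -> [\/ a \in x :: m1, a = z | a \in rcons m2 y].
    rewrite in_cons mem_rcons in_cons em mem_cat in_cons => /or3P[/eqP->|/eqP->|/or3P[h|/eqP->|h]].
    + by constructor 1; rewrite mem_head.
    + by constructor 3; rewrite mem_rcons mem_head.
    + by constructor 1; rewrite in_cons h orbT.
    + by constructor 2.
    + by constructor 3; rewrite mem_rcons in_cons h orbT.
  have L a : a \in x :: m1 -> a \in x :: rcons m1 z.
    by rewrite !in_cons mem_rcons in_cons => /orP[]->; rewrite ?orbT.
  have Lz : z \in x :: rcons m1 z by rewrite in_cons mem_rcons mem_head orbT.
  have Rz : z \in z :: rcons m2 y by rewrite mem_head.
  have R a : a \in rcons m2 y -> a \in z :: rcons m2 y by rewrite in_cons => ->; rewrite orbT.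
  move=> a b /memE ha /memE hb ab; rewrite edges_node !in_setU in_set1.
  case: ha hb => ha [] hb.
  + by rewrite hA ?orbT //; apply: L.
  + by rewrite hA ?orbT // ?hb //; apply: L.
  + by have [-> ->] := cross _ _ ha hb ab; rewrite eqxx.
  + by rewrite hA ?orbT // ?ha //; apply: L.
  + by move: (adj_neq ab); rewrite ha hb eqxx.
  + by rewrite hB ?orbT // ?ha //; apply: R.
  + by rewrite adj_sym in ab; have [-> ->] := cross _ _ hb ha ab; rewrite setUC eqxx.
  + by rewrite hB ?orbT // ?hb //; apply: R.
  + by rewrite hB ?orbT //; apply: R.
Qed.

Lemma embedding_glued G c : standard_embedding G c ->
  exists x y t, t <> Leaf /\ glued G x y t Leaf.
Proof.
move=> emb; have [[sc uc ec cc] _] := emb.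
case: c sc uc ec cc emb => [|x p] //; case/lastP: p => [|m y] // sc uc ec cc emb.
have xy : adj G x y by move: cc; rewrite /= rcons_path last_rcons adj_sym => /andP[].
have [|t [im sm hm]] := embedding_tree emb (p := [::]) (q := [::]) (m := m) _ xy.
  by rewrite /= cats1.
exists x, y, t; split; first by move=> tL; move: sc; rewrite -im tL.
split; first by rewrite im cats1.
  by move=> a; rewrite -ec im cats1.
apply/setP => e; rewrite in_setU in_set1; apply/idP/orP => [eG|[]].
- left; have [a [b [-> ab]]] := edge_pair eG; have [aG bG] := adj_vset ab.
  by apply: hm => //; rewrite ec.
- exact: (fintype.subsetP sm).
- by move=> /eqP->; rewrite setUC.
Qed.

(** Located in the tree, the edge has one side empty; the other side, mirrored if necessary, is the
    new tree. It is no leaf because G has a third vertex. *)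
Lemma noncutting_root G x y s u v : glued G x y s Leaf -> s <> Leaf -> noncutting G [set u; v] ->
  exists2 t, t <> Leaf & glued G u v t Leaf.
Proof.
move=> g ns nc; have /andP[uvG _] := nc.
have uvs : [set u; v] \in edges s x y.
  move: uvG; rewrite (glued_edges g) => /orP[//|/set1P->].
  by rewrite setUC root_edge.
have [x' [y' [s' [o' [euv g' sub _]]]]] := glued_locate g uvs.
have [t [g2]] : exists t, glued G x' y' t Leaf /\ (t = Leaf -> s' = Leaf /\ o' = Leaf).
  rewrite euv in nc; have [eL|eL] := (glued_noncutting g').1 nc.
    exists (mirror o'); rewrite eL in g' *; split.
      by have := glued_mirror (glued_swap g').
    by rewrite -{2}(mirrorK o') => ->.
  by exists s'; rewrite eL in g' *.
move=> hL; have nt : t <> Leaf.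
  move=> tL; have [_ eV _] := g; have [_ eV' _] := g2.
  case: (s) ns eV g {uvs} => // A z B _ eV g.
  have [us _ xy _ _] := glued_uniq g; have [uA uB _ _ _] := uniq_verts_node us.
  have uq : uniq (z :: [:: x; y]).
    rewrite cons_uniq !in_cons in_nil orbF negb_or eq_sym (uniq_verts_neq uA) (uniq_verts_neq uB).
    by rewrite /= mem_seq1 xy.
  have sz : size (z :: [:: x; y]) <= size [:: x'; y'].
    apply: uniq_leq_size uq _ => a ha.
    have : a \in vset G.
      rewrite eV; move: ha; rewrite !(in_cons, mem_cat) !in_nil !orbF.
      by case/or3P=> ->; rewrite ?orbT.
    by rewrite eV' tL /= !in_cons.
  by [].
case: (set2_eq euv) => -[-> ->]; first by exists t.
exists (mirror t); first by move=> e; apply: nt; rewrite -(mirrorK t) e.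
by have := glued_mirror g2.
Qed.

End Triangulation.

(** * From trees back to embeddings *)

Section TreeEmbedding.
Variable V : finType.
Implicit Types (G : graph V) (t s o A B : tree V) (a b u v w x y z m p q : V) (e : {set V}).
Implicit Types (f : V -> nat) (l : seq V).

(** Here [f] gives positions on the outer cycle; comparing them replaces planar geometry. *)
Definition increasing f l := sorted ltn (map f l).

Lemma increasing_subseq f l l' : subseq l' l -> increasing f l -> increasing f l'.
Proof. by move=> /(map_subseq f) h; apply: (subseq_sorted ltn_trans h). Qed.

Lemma increasing_node f A m B u v : increasing f (verts (Node A m B) u v) ->
  increasing f (verts A u m) /\ increasing f (verts B m v).
Proof.
move=> h; split; apply: increasing_subseq h.
  by rewrite /verts /= eqxx -catA; apply: cat_subseq => //; rewrite sub1seq mem_head.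
by rewrite verts_node; apply: (@suffix_subseq _ (u :: inn A)).
Qed.

Lemma increasing_root f t u v : increasing f (verts t u v) -> f u < f v.
Proof.
by move/(increasing_subseq (l' := [:: u; v])); rewrite /increasing /= andbT; apply;
   rewrite /verts eqxx sub1seq mem_cat mem_head orbT.
Qed.

Lemma increasing_bounds f t u v a : increasing f (verts t u v) -> a \in verts t u v ->
  f u <= f a <= f v.
Proof.
elim: t u v => [|A IHA m B IHB] u v h.
  by have := increasing_root h; rewrite mem_verts /= => uv /orP[]/eqP->; rewrite leqnn ltnW.
have [hA hB] := increasing_node h.
have := increasing_root hA; have := increasing_root hB => hm hu.
by rewrite mem_verts_node => /orP[/(IHA _ _ hA)|/(IHB _ _ hB)]; clear -hm hu; lia.
Qed.

(** Edges on different sides of the root triangle are separated by the position of m, and the root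
    edge encloses all positions. *)
Lemma tree_noncrossing f t u v a p b q : increasing f (verts t u v) ->
  [set a; b] \in edges t u v -> [set p; q] \in edges t u v ->
  f a < f p -> f p < f b -> f b < f q -> False.
Proof.
elim: t u v => [|A IHA m B IHB] u v h eab epq h1 h2 h3.
  move: eab epq => /set1P /set2_eq[[eu ev]|[eu ev]] /set1P /set2_eq[[eu' ev']|[eu' ev']];
    move: h1 h2 h3; rewrite eu ev eu' ev'; clear; lia.
have [hA hB] := increasing_node h.
have bd c e : e \in edges (Node A m B) u v -> c \in e -> f u <= f c <= f v.
  by move=> he ce; apply: increasing_bounds h (edges_verts he ce).
have bA c e : e \in edges A u m -> c \in e -> f u <= f c <= f m.
  by move=> he ce; apply: increasing_bounds hA (edges_verts he ce).
have bB c e : e \in edges B m v -> c \in e -> f m <= f c <= f v.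
  by move=> he ce; apply: increasing_bounds hB (edges_verts he ce).
have Ia := bd _ _ eab (set21 _ _); have Ib := bd _ _ eab (set22 _ _).
have Ip := bd _ _ epq (set21 _ _); have Iq := bd _ _ epq (set22 _ _).
move: eab epq; rewrite edges_node !in_setU !in_set1.
case/or3P=> [/eqP/set2_eq[[ea eb]|[ea eb]]|eA|eB].
- by exfalso; move: h3 Iq; rewrite eb; clear; lia.
- by exfalso; move: h1 Ip; rewrite ea; clear -h2 h3 Iq; lia.
- have Ja := bA _ _ eA (set21 _ _); have Jb := bA _ _ eA (set22 _ _).
  case/or3P=> [/eqP/set2_eq[[ep eq]|[ep eq]]|eA'|eB'].
  + by exfalso; move: h1 Ia; rewrite ep; clear; lia.
  + by exfalso; move: h2 Ib; rewrite ep; clear -h3; lia.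
  + exact: IHA hA eA eA' h1 h2 h3.
  + by have := bB _ _ eB' (set21 _ _); clear -Jb h2; lia.
- have Ja := bB _ _ eB (set21 _ _); have Jb := bB _ _ eB (set22 _ _).
  case/or3P=> [/eqP/set2_eq[[ep eq]|[ep eq]]|eA'|eB'].
  + by exfalso; move: h1 Ia; rewrite ep; clear; lia.
  + by exfalso; move: h2 Ib; rewrite ep; clear -h3; lia.
  + by have := bA _ _ eA' (set22 _ _); clear -Jb h3 Ja h1 h2; lia.
  + exact: IHB hB eB eB' h1 h2 h3.
Qed.

(** An edge with a vertex strictly between its ends is the root edge of a subtree other than a leaf,
    whose apex is z. *)
Lemma tree_apex f t u v a p b : increasing f (verts t u v) ->
  [set a; b] \in edges t u v -> p \in verts t u v -> f a < f p -> f p < f b ->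
  exists z, [/\ f a < f z, f z < f b, [set a; z] \in edges t u v & [set z; b] \in edges t u v].
Proof.
elim: t u v => [|A IHA m B IHB] u v h eab hp h1 h2.
  have := increasing_root h.
  move: eab hp => /set1P /set2_eq[[ea eb]|[ea eb]]; rewrite mem_verts /= => /orP[]/eqP ep;
    move: h1 h2; rewrite ea eb ep; clear; lia.
have [hA hB] := increasing_node h.
have bA c e : e \in edges A u m -> c \in e -> f u <= f c <= f m.
  by move=> he ce; apply: increasing_bounds hA (edges_verts he ce).
have bB c e : e \in edges B m v -> c \in e -> f m <= f c <= f v.
  by move=> he ce; apply: increasing_bounds hB (edges_verts he ce).
have um := increasing_root hA; have mv := increasing_root hB.
move: eab; rewrite edges_node !in_setU !in_set1.
case/or3P=> [/eqP/set2_eq[[ea eb]|[ea eb]]|eA|eB].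
- exists m; rewrite ea eb; split=> //.
    by rewrite !in_setU root_edge orbT.
  by rewrite !in_setU root_edge !orbT.
- by exfalso; move: h1 h2; rewrite ea eb; clear -um mv; lia.
- have Jb := bA _ _ eA (set22 _ _).
  have pA : p \in verts A u m.
    move: hp; rewrite mem_verts_node => /orP[//|/(increasing_bounds hB) hp].
    by exfalso; clear -hp Jb h2; lia.
  have [z [z1 z2 z3 z4]] := IHA u m hA eA pA h1 h2.
  by exists z; split=> //; rewrite !in_setU ?z3 ?z4 ?orbT.
- have Ja := bB _ _ eB (set21 _ _).
  have pB : p \in verts B m v.
    move: hp; rewrite mem_verts_node => /orP[/(increasing_bounds hA) hp|//].
    by exfalso; clear -hp Ja h1; lia.
  have [z [z1 z2 z3 z4]] := IHB m v hB eB pB h1 h2.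
  by exists z; split=> //; rewrite !in_setU ?z3 ?z4 ?orbT.
Qed.

Lemma increasing_index l : uniq l -> increasing (index^~ l) l.
Proof.
move=> ul; rewrite /increasing.
have -> : [seq index i l | i <- l] = iota 0 (size l).
  case: l ul => // a0 l ul; apply: (@eq_from_nth _ 0); rewrite size_map ?size_iota // => i hi.
  by rewrite (nth_map a0) // index_uniq // nth_iota.
exact: iota_ltn_sorted.
Qed.

Lemma gap_or_mem f l a z : increasing f (a :: l) -> f a < f z -> f z < f (last a l) ->
  (exists2 b, b \in l & f b = f z) \/
  exists l1 p q l2, [/\ a :: l = l1 ++ p :: q :: l2, f p < f z & f z < f q].
Proof.
elim: l a => [|b l IH] a /=; first by move=> _ h1 h2; move: (ltn_trans h1 h2); rewrite ltnn.
move=> /andP[ab bl] az zl; case: (ltngtP (f b) (f z)) => [bz|zb|bz].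
- case: (IH b bl bz zl) => [[c cl fc]|[l1 [p [q [l2 [-> h1 h2]]]]]].
    by left; exists c => //; rewrite in_cons cl orbT.
  by right; exists (a :: l1), p, q, l2.
- by right; exists [::], a, b, l.
- by left; exists b => //; rewrite mem_head.
Qed.

(** Let x0 and xk be the first and last corners of a face. The edge joining them has a triangle with
    an apex z positioned between them. If z is no corner, it lies between two consecutive corners,
    and their edge crosses a side of this triangle. If it is a corner, its edges to x0 and xk are no
    diagonals, hence sides, and the face is this triangle. *)
Lemma glued_embedding G x y s : glued G x y s Leaf -> s <> Leaf ->
  standard_embedding G (verts s x y).
Proof.
move=> g ns; have [us _ xy _ _] := glued_uniq g.
set c := verts s x y; have inc := increasing_index us; rewrite -/c in inc us.
set pos := index^~ c in inc.
have edgeE a b : adj G a b -> [set a; b] \in edges s x y.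
  rewrite /adj (glued_edges g) => /orP[//|/set1P->].
  by rewrite setUC root_edge.
have cG : c =i vset G by move=> a; rewrite (glued_vset g) in_nil orbF.
have nc : noncrossing G c.
  move=> a p b q sub; apply/negP => /andP[/edgeE ab /edgeE pq].
  have := increasing_subseq sub inc; rewrite /increasing /= andbT => /and3P[h1 h2 h3].
  exact: tree_noncrossing inc ab pq h1 h2 h3.
have cyc : cycle (adj G) c.
  rewrite /c /verts /= rcons_path last_cat /= adj_sym (glued_edge g) andbT.
  exact: edges_path (glued_subset g).
split; [split=> //|split=> //].
  rewrite /c; case: (s) ns => // A z B _.
  by rewrite /verts /= !size_cat /=; clear; lia.
move=> l [sz sub cl nch].
have ul := subseq_uniq sub us; have incl := increasing_subseq sub inc.
have lc a : a \in l -> a \in c by apply: mem_subseq.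
case: l sz sub cl nch ul incl lc => [|x0 l] //; case/lastP: l => [|[|x1 l] xk] // _ sub cl nch ul incl lc.
have x0k : adj G x0 xk.
  by move: cl; rewrite [cycle _ _]/= !rcons_path last_rcons => /and3P[_ _]; rewrite adj_sym.
have [l01 l1k] : pos x0 < pos x1 /\ pos x1 < pos xk.
  have h : subseq [:: x0; x1; xk] (x0 :: rcons (x1 :: l) xk).
    by rewrite /= !eqxx -cats1 sub1seq mem_cat mem_head orbT.
  by have := increasing_subseq h incl; rewrite /increasing /= andbT => /andP[].
have x1c : x1 \in c by apply: lc; rewrite in_cons mem_head orbT.
have [z [z1 z2 e1 e2]] := tree_apex inc (edgeE _ _ x0k) x1c l01 l1k.
have a1 : adj G x0 z by rewrite /adj (glued_edges g) e1.
have a2 : adj G z xk by rewrite /adj (glued_edges g) e2.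
have zc : z \in c by apply: edges_verts e1 (set22 _ _).
have lst : last x0 (rcons (x1 :: l) xk) = xk by rewrite last_rcons.
have zl : pos z < pos (last x0 (rcons (x1 :: l) xk)) by rewrite lst.
case: (gap_or_mem incl z1 zl) => [[b bl fb]|[l1 [p [q [l2 [el pz zq]]]]]]; last first.
  have pq : adj G p q.
    move: cl; rewrite el -(rot_cycle (size l1)) rot_size_cat /= => /andP[] //.
  exfalso; case: l1 el => [[e3 e4 _]|a l1 el].
    by apply: tree_noncrossing inc (edgeE _ _ pq) (edgeE _ _ a2) pz zq _; rewrite -e4.
  have ap : pos x0 < pos p.
    have h : subseq [:: x0; p] (x0 :: rcons (x1 :: l) xk).
      by rewrite rcons_cons; move: el; rewrite rcons_cons => -[-> ->]; rewrite /= eqxx sub1seq mem_cat mem_head orbT.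
    by have := increasing_subseq h incl; rewrite /increasing /= andbT.
  exact: tree_noncrossing inc (edgeE _ _ a1) (edgeE _ _ pq) ap pz zq.
have {fb} bz : b = z.
  by apply: index_inj fb; rewrite // lc // in_cons bl orbT.
have {b bl bz} zl1 : z \in x1 :: l.
  by move: bl; rewrite bz mem_rcons in_cons (negPf (adj_neq a2)).
set l0 := x0 :: rcons (x1 :: l) xk in sub cl nch ul incl lc *.
have x0l : x0 \in l0 by rewrite mem_head.
have xkl : xk \in l0 by rewrite /l0 in_cons mem_rcons mem_head orbT.
have zl0 : z \in l0 by rewrite /l0 in_cons mem_rcons in_cons zl1 !orbT.
have n0 : next l0 x0 = x1 by rewrite /l0 /= eqxx.
have nk : next l0 xk = x0 by apply: next_last.
have zx1 : z = x1.
  case: (nch x0 z x0l zl0 a1) => [->//|].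
  have [l1 [l2 el]] := mem_split zl1.
  have [w [l3 e3]] : exists w l3, rcons l2 xk = w :: l3.
    by case: (l2) => [|w l3]; [exists xk, [::]|exists w, (rcons l3 xk)].
  have e0 : l0 = (x0 :: l1) ++ z :: w :: l3 by rewrite /l0 el rcons_cat rcons_cons e3.
  move: (ul); rewrite e0 => ul'; rewrite (next_cat ul') => e4.
  by move: ul'; rewrite /= mem_cat !in_cons -e4 eqxx !orbT.
case: l @l0 zl1 {nc} sub cl nch ul incl lc x0l xkl zl0 n0 nk {z1 z2 zl lst} => [//|x2 l].
move=> l0 _ sub cl nch ul incl lc x0l xkl zl0 n0 nk.
have n1 : next l0 x1 = x2 by apply: (@next_cat _ [:: x0]).
case: (nch z xk zl0 xkl a2); rewrite zx1 ?nk ?n1 => e4.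
  by move: ul; rewrite /l0 e4 /= mem_rcons mem_head !andbF.
by move: l01; rewrite e4 ltnn.
Qed.

End TreeEmbedding.

(** * Existence of bonnet systems *)

Section Pruning.
Variable V : finType.
Implicit Types (G S : graph V) (t s o A B : tree V) (a b u v w x y z m p q : V) (e : {set V}).

(** Pruning cuts subtrees down to leaves. A triangulated polygon inside t with the same root edge is
    of this form, by [edges_prune]. *)
Fixpoint prune s t : Prop :=
  match s, t with
  | Leaf, _ => True
  | Node A z B, Node A' z' B' => [/\ z = z', prune A A' & prune B B']
  | Node _ _ _, Leaf => False
  end.

(* The bonnet beyond one side of the root triangle: the ribbon t', a pruning of
   t, with all the triangles at the left end of the root edge. *)
Fixpoint fan_ext t t' : tree V :=
  if t is Node A z B then
    if t' is Node A' _ B' then Node (fan_ext A A') z B' else Node (fan_ext A Leaf) z Leaf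
  else Leaf.

Lemma prune_edges s t u v : prune s t -> edges s u v \subset edges t u v.
Proof.
elim: s t u v => [|A IHA z B IHB] [|A' z' B'] u v //.
  by move=> _; apply/fintype.subsetP => e /set1P->; apply: root_edge.
case=> <- /IHA hA /IHB hB; rewrite !edges_node.
by apply: setUS; apply: setUSS.
Qed.

Lemma prune_verts s t u v a : prune s t -> a \in verts s u v -> a \in verts t u v.
Proof.
elim: s t u v => [|A IHA z B IHB] [|A' z' B'] u v //.
  by move=> _; rewrite !mem_verts /= => /orP[]->; rewrite ?orbT.
case=> <- hA hB; rewrite !mem_verts_node => /orP[/(IHA _ _ _ hA)|/(IHB _ _ _ hB)] ->;
by rewrite ?orbT.
Qed.

Lemma prune_subseq s t : prune s t -> subseq (inn s) (inn t).
Proof.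
elim: s t => [|A IHA z B IHB] [|A' z' B'] //=; first by rewrite sub0seq.
case=> <- /IHA hA /IHB hB; by apply: cat_subseq => //=; rewrite eqxx.
Qed.

Lemma prune_uniq s t u v : prune s t -> uniq (verts t u v) -> uniq (verts s u v).
Proof.
move/prune_subseq=> h; apply: subseq_uniq; rewrite /verts /= eqxx.
by apply: cat_subseq.
Qed.

Lemma prune_mirror s t : prune s t -> prune (mirror s) (mirror t).
Proof. by elim: s t => [|A IHA z B IHB] [|A' z' B'] //= [-> /IHA hA /IHB hB]. Qed.

Lemma prune_fan_ext t t' : prune t' t -> prune (fan_ext t t') t.
Proof.
elim: t t' => [|A IHA z B IHB] [|A' z' B'] //=; first by split=> //; apply: IHA.
by case=> _ hA hB; split=> //; apply: IHA.
Qed.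

Lemma fan_ext_prune t t' : prune t' t -> prune t' (fan_ext t t').
Proof.
elim: t t' => [|A IHA z B IHB] [|A' z' B'] //= [-> hA hB]; split=> //; first exact: IHA.
by elim: (B') => //= ? ? ? ? ?.
Qed.

Lemma fan_ext_nbr t t' u y x : prune t' t -> uniq (verts t u y) -> [set u; x] \in edges t u y ->
  x \in verts (fan_ext t t') u y.
Proof.
elim: t t' u y => [|A IHA z B _] t' u y ht uq.
  move=> /set1P /set2_eq[[_ ->]|[_ ->]]; first by rewrite mem_verts eqxx !orbT.
  by rewrite mem_verts eqxx.
have [uA uB AB uB' yA] := uniq_verts_node uq.
rewrite edges_node !in_setU in_set1 => /or3P[/eqP/set2_eq[[_ ->]|[_ ->]]|hA|hB].
- by rewrite mem_verts eqxx !orbT.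
- by rewrite mem_verts eqxx.
- case: t' ht => [|A' z' B'] ht /=.
    by rewrite mem_verts_node (IHA Leaf _ _ _ uA hA).
  by case: ht => _ hA' _; rewrite mem_verts_node (IHA A' _ _ hA' uA hA).
- by have := edges_verts hB (set21 _ _); rewrite (negPf uB').
Qed.

Lemma tree_graph t u v : uniq (verts t u v) -> exists G, glued G u v t Leaf.
Proof.
move=> uq.
have wf : [forall e in edges t u v, (e \subset [set a in verts t u v]) && (#|e| == 2)].
  apply/forall_inP => e he; apply/andP; split.
    by apply/fintype.subsetP => a ae; rewrite inE; apply: edges_verts he ae.
  elim: t u v uq he => [|A IHA z B IHB] u v uq.
    by move=> /set1P->; rewrite cards2 (uniq_verts_neq uq).
  have [uA uB _ _ _] := uniq_verts_node uq.
  rewrite edges_node !in_setU in_set1 => /or3P[/eqP->|/(IHA _ _ uA)//|/(IHB _ _ uB)//].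
  by rewrite cards2 (uniq_verts_neq uq).
exists (Graph wf); split=> /=.
- by move: uq; rewrite /verts cats1.
- by move=> a; rewrite inE.
- apply/setP => e; rewrite in_setU in_set1.
  by case: eqP => [->|_]; rewrite ?orbF // setUC root_edge.
Qed.

Lemma glued_leaf_edges G x y s : glued G x y s Leaf -> eset G = edges s x y.
Proof.
move=> g; apply/setP => e; rewrite (glued_edges g) in_set1.
by case: eqP => [->|_]; rewrite ?orbF // setUC root_edge.
Qed.

Lemma glued_leaf_vset G x y s : glued G x y s Leaf -> vset G =i verts s x y.
Proof. by move=> g a; rewrite (glued_vset g) in_nil orbF. Qed.

Lemma edge_in_pair G e x y : e \in eset G -> (forall a, a \in e -> a \in [set x; y]) ->
  e = [set x; y].
Proof.
move=> eG xyP; have [a [b [eab ab]]] := edge_pair eG; apply/setP => c.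
have ha : a \in [set x; y] by apply: xyP; rewrite eab set21.
have hb : b \in [set x; y] by apply: xyP; rewrite eab set22.
move: ha hb (adj_neq ab); rewrite eab !in_set2.
by do 2 (case/orP => /eqP->); rewrite ?eqxx // orbC.
Qed.

Lemma glued_common_edge G x y s o e : glued G x y s o -> e \in edges s x y ->
  e \in edges o y x -> e = [set x; y].
Proof.
move=> g hs ho; have [us uo xy sh oh] := glued_uniq g.
apply: (@edge_in_pair G); first by rewrite (glued_edges g) hs.
move=> a ae; have as_ := edges_verts hs ae; have ao := edges_verts ho ae.
move: as_; rewrite mem_verts in_set2 => /or3P[->//|/sh|->]; last by rewrite orbT.
by rewrite ao.
Qed.

Lemma glued_card G x y s o : glued G x y s o -> #|vset G| = (size (inn s) + size (inn o)).+2.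
Proof. by case=> uq eV _; rewrite (eq_card eV) (card_uniqP uq) /= size_cat /= addnS. Qed.

Lemma glued_cut_component G S x y s o : glued G x y s o -> s <> Leaf -> o <> Leaf ->
  glued S x y s Leaf -> cut_component G [set x; y] S.
Proof.
move=> g ns no gS; have [us uo xy sh oh] := glued_uniq g.
have [S' gS'] := tree_graph uo; exists S'; split.
- by exists (verts s x y); apply: glued_embedding gS ns.
- by exists (verts o y x); apply: glued_embedding gS' no.
- split; apply/setP => a; rewrite !in_setU.
    rewrite (glued_vset g) (glued_leaf_vset gS) (glued_leaf_vset gS') !mem_verts.
    by do !case: (_ \in inn _); do !case: (_ == _).
  by rewrite (glued_edges g) (glued_leaf_edges gS) (glued_leaf_edges gS').
- apply/setP => a; rewrite in_setI (glued_leaf_vset gS) (glued_leaf_vset gS').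
  rewrite in_set2; apply/andP/orP => [[]|[]/eqP->]; rewrite !mem_verts ?eqxx ?orbT //.
  move=> h1 h2; case/or3P: h1 => [->|/sh|->]; [by left| |by right].
  by rewrite mem_verts h2.
- apply/setP => e; rewrite in_setI (glued_leaf_edges gS) (glued_leaf_edges gS').
  rewrite in_set1; apply/andP/eqP => [[]|->]; first exact: glued_common_edge g.
  by rewrite root_edge setUC root_edge.
Qed.

End Pruning.

(** * Fans, and a bonnet system for every non-cutting edge *)

Section Fans.
Variable V : finType.
Implicit Types (G S P F : graph V) (t s o A B : tree V) (a b u v w x y z m p q : V) (e : {set V}).
Implicit Types (f c : seq V).

Fixpoint fan_faces t u y : seq (seq V) :=
  if t is Node A z _ then [:: u; z; y] :: fan_faces A u z else [::].

Fixpoint fanlike t : Prop := if t is Node A _ B then fanlike A /\ B = Leaf else True.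

Lemma fanlike_fan_ext t : fanlike (fan_ext t Leaf).
Proof. by elim: t => //= A IHA z B _. Qed.

Lemma fan_faces_fan_ext t u y : fan_faces (fan_ext t Leaf) u y = fan_faces t u y.
Proof. by elim: t y => //= A IHA z B _ y; rewrite IHA. Qed.

Lemma fan_faces_mem t u y f : f \in fan_faces t u y ->
  exists p q, [/\ f = [:: u; p; q], p \in verts t u y & q \in verts t u y].
Proof.
elim: t y => //= A IHA z B _ y; rewrite in_cons => /orP[/eqP->|/IHA[p [q [-> hp hq]]]].
  by exists z, y; rewrite !mem_verts /= mem_cat mem_head !eqxx !orbT.
by exists p, q; rewrite !mem_verts_node hp hq.
Qed.

Lemma fan_faces_subseq t u y f : f \in fan_faces t u y -> subseq f (verts t u y).
Proof.
elim: t y => [|A IHA z B _] y //; rewrite [fan_faces _ _ _]/= in_cons => /orP[/eqP->|/IHA h].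
  rewrite /verts /= eqxx -catA; apply: subseq_trans (suffix_subseq _ _).
  by rewrite /= eqxx sub1seq mem_cat mem_head orbT.
apply: (subseq_trans h); rewrite /verts /= eqxx -catA; apply: cat_subseq => //.
by rewrite sub1seq mem_head.
Qed.

Lemma fan_faces_edges t u y p q : [:: u; p; q] \in fan_faces t u y ->
  [/\ [set u; p] \in edges t u y, [set p; q] \in edges t u y & [set u; q] \in edges t u y].
Proof.
elim: t y => //= A IHA z B _ y; rewrite in_cons !in_setU !in_set1.
case/orP=> [/eqP[-> ->]|/IHA[-> -> ->]]; last by rewrite !orbT.
by rewrite !root_edge eqxx !orbT.
Qed.

Lemma fan_edge t u y b d : fanlike t -> b != u -> d != u -> [set b; d] \in edges t u y ->
  [:: u; b; d] \in fan_faces t u y \/ [:: u; d; b] \in fan_faces t u y.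
Proof.
elim: t y => [|A IHA z B _] y /=.
  by move=> _ bu du /set1P/set2_eq[[eb _]|[_ ed]]; rewrite ?eb ?ed eqxx in bu du.
case=> fA -> bu du; rewrite !in_setU !in_set1 !in_cons.
case/or3P=> [/eqP/set2_eq[[eb _]|[_ ed]]|/(IHA _ fA bu du)|/eqP/set2_eq[[-> ->]|[-> ->]]].
- by rewrite eb eqxx in bu.
- by rewrite ed eqxx in du.
- by case=> ->; rewrite !orbT; auto.
- by rewrite eqxx; auto.
- by rewrite eqxx; auto.
Qed.

(** Away from u the edges of a fan form a path, and a path contains no triangle. *)
Lemma fan_triangle t u y a b d : fanlike t -> uniq (verts t u y) -> a != u -> b != u -> d != u ->
  a != b -> b != d -> a != d ->
  [set a; b] \in edges t u y -> [set b; d] \in edges t u y -> [set a; d] \in edges t u y -> False.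
Proof.
elim: t y => [|A IHA z B _] y.
  move=> _ _ au bu _ _ _ _ /set1P/set2_eq[[ea _]|[_ eb]].
    by rewrite ea eqxx in au.
  by rewrite eb eqxx in bu.
case=> fA -> uq au bu du ab bd ad; have [uA uB AB uB' yA] := uniq_verts_node uq.
have side p q : p != u -> q != u -> [set p; q] \in edges (Node A z Leaf) u y ->
    [set p; q] \in edges A u z \/ [set p; q] = [set z; y].
  move=> pu qu; rewrite edges_node !in_setU !in_set1.
  case/or3P=> [/eqP/set2_eq[[e _]|[_ e]]|->|/eqP->]; auto.
    by rewrite e eqxx in pu.
  by rewrite e eqxx in qu.
have zy : z != y := uniq_verts_neq uB.
have nA p q : [set p; q] \in edges A u z -> p != y /\ q != y.
  move=> h; split; apply/eqP => ey; move: yA; rewrite -ey.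
    by rewrite (edges_verts h) ?set21.
  by rewrite (edges_verts h) ?set22.
move=> /(side _ _ au bu) h1 /(side _ _ bu du) h2 /(side _ _ au du) h3.
case: h1 => h1; case: h2 => h2; case: h3 => h3.
- exact: IHA fA uA au bu du ab bd ad h1 h2 h3.
- have [n1 _] := nA _ _ h1; have [_ n2] := nA _ _ h2.
  by case: (set2_eq h3) => -[e1 e2]; [rewrite e2 eqxx in n2|rewrite e1 eqxx in n1].
- have [_ n1] := nA _ _ h1; have [_ n2] := nA _ _ h3.
  by case: (set2_eq h2) => -[e1 e2]; [rewrite e2 eqxx in n2|rewrite e1 eqxx in n1].
- have [n1 n2] := nA _ _ h1.
  have ed : d = y by case: (set2_eq h3) => -[e1 e2] //; rewrite e1 eqxx in n1.
  have ea : a = z by case: (set2_eq h3) => -[e1 e2] //; rewrite e1 eqxx in n1.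
  have eb : b = z by case: (set2_eq h2) => -[e1 e2] //; rewrite e1 eqxx in n2.
  by rewrite ea eb eqxx in ab.
- have [n1 _] := nA _ _ h2; have [_ n2] := nA _ _ h3.
  by case: (set2_eq h1) => -[e1 e2]; [rewrite e2 eqxx in n1|
    case: (set2_eq h1) (nA _ _ h3) => -[e3 e4] [m1 m2]; [rewrite e4 eqxx in n1|rewrite e3 eqxx in m1]].
- have [n1 n2] := nA _ _ h2.
  have ed : a = y by case: (set2_eq h3) => -[e1 e2] //; rewrite e2 eqxx in n2.
  have ea : d = z by case: (set2_eq h3) => -[e1 e2] //; rewrite e2 eqxx in n2.
  have eb : b = z by case: (set2_eq h1) => -[e1 e2] //; rewrite e2 eqxx in n1.
  by rewrite ea eb eqxx in bd.
- have [n1 n2] := nA _ _ h3.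
  have ed : b = y by case: (set2_eq h1) => -[e1 e2] //; rewrite e1 eqxx in n1.
  have ea : a = z by case: (set2_eq h1) => -[e1 e2] //; rewrite e1 eqxx in n1.
  have eb : d = z by case: (set2_eq h2) => -[e1 e2] //; rewrite e2 eqxx in n2.
  by rewrite ea eb eqxx in ad.
- case: (set2_eq h1) => -[e1 e2]; case: (set2_eq h2) => -[e3 e4]; subst; rewrite ?eqxx // in ab bd ad zy.
Qed.

Lemma dual_adj_sym f f' : dual_adj f f' = dual_adj f' f.
Proof.
rewrite /dual_adj eq_sym; congr (_ && _).
by apply/existsP/existsP => -[e]; exists e; rewrite andbC.
Qed.

Lemma face_edges_sub f e a : e \in face_edges f -> a \in e -> a \in f.
Proof.
move=> /imsetP[x xf ->]; rewrite in_set2 => /orP[/eqP->//|/eqP->].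
by rewrite mem_next.
Qed.

Lemma next3 a b d : a != b -> b != d -> a != d ->
  [/\ next [:: a; b; d] a = b, next [:: a; b; d] b = d & next [:: a; b; d] d = a].
Proof.
move=> ab bd ad; rewrite /= !eqxx.
by rewrite eq_sym (negPf ab) eq_sym (negPf ad) eq_sym (negPf bd).
Qed.

Lemma face_edges3 a b d : a != b -> b != d -> a != d ->
  face_edges [:: a; b; d] =i [:: [set a; b]; [set b; d]; [set d; a]].
Proof.
move=> ab bd ad e; have [na nb nd] := next3 ab bd ad.
apply/imsetP/idP => [[x]|].
  by rewrite !in_cons in_nil orbF => /or3P[]/eqP-> ->; rewrite ?na ?nb ?nd eqxx ?orbT.
rewrite !in_cons in_nil orbF => /or3P[]/eqP->.
- by exists a; rewrite ?na // !in_cons eqxx.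
- by exists b; rewrite ?nb // !in_cons eqxx orbT.
- by exists d; rewrite ?nd // !in_cons eqxx !orbT.
Qed.

(** Consecutive triangles share an edge at u. From the third triangle on, both z and y are avoided,
    whereas every side of the first one contains z or y. *)
Lemma fan_dual_adj t u y : uniq (verts t u y) -> forall i j,
  i < size (fan_faces t u y) -> j < size (fan_faces t u y) ->
  dual_adj (nth [::] (fan_faces t u y) i) (nth [::] (fan_faces t u y) j)
  = (i.+1 == j) || (j.+1 == i).
Proof.
elim: t y => [|A IHA z B _] y // uq.
have [uA uB AB uB' yA] := uniq_verts_node uq.
have uz := uniq_verts_neq uA; have zy := uniq_verts_neq uB; have uy := uniq_verts_neq uq.
have head_adj j : j < size (fan_faces A u z) ->
    dual_adj [:: u; z; y] (nth [::] (fan_faces A u z) j) = (j == 0).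
  case: A IHA uq uA AB yA => [|A1 z1 B1] // _ uq uA AB yA.
  have [uA1 uB1 AB1 _ zA1] := uniq_verts_node uA.
  have uz1 := uniq_verts_neq uA1; have z1z := uniq_verts_neq uB1.
  case: j => [_|j].
    rewrite /dual_adj /=; apply/andP; split.
      by apply/eqP => -[e _]; rewrite e eqxx in z1z.
    apply/existsP; exists [set u; z].
    rewrite !face_edges3 // !in_cons !eqxx /= (setUC [set u]) eqxx !orbT //.
  rewrite [size _]/= ltnS => hj.
  rewrite [nth _ _ _]/=; have [p [q [-> hp hq]]] := fan_faces_mem (mem_nth [::] hj).
  have yA1 : y \notin verts A1 u z1.
    by apply: contra yA; rewrite mem_verts_node => ->.
  apply: contraNF zA1 => /andP[_ /existsP[e /andP[h1 h2]]].
  have nf a : a \in e -> a \in verts A1 u z1.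
    move/(face_edges_sub h2); rewrite !in_cons in_nil orbF => /or3P[]/eqP-> //.
    by rewrite eqxx.
  move: h1 nf; rewrite face_edges3 // !in_cons in_nil orbF => /or3P[]/eqP-> nf.
  - by apply: nf; rewrite set22.
  - by apply: nf; rewrite set21.
  - by have := nf y (set21 _ _); rewrite (negPf yA1).
case=> [|i] [|j] /=.
- by rewrite /dual_adj eqxx.
- by rewrite ltnS => _ /head_adj->; rewrite eqSS eq_sym orbF.
- by rewrite ltnS dual_adj_sym => /head_adj-> _; rewrite eqSS eq_sym.
- by rewrite !ltnS !eqSS => hi hj; apply: IHA.
Qed.

Lemma fan_faces_uniq t u y : uniq (verts t u y) -> uniq (fan_faces t u y).
Proof.
elim: t y => [|A IHA z B _] y // uq; have [uA uB AB uB' yA] := uniq_verts_node uq.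
rewrite /= IHA // andbT; apply/negP => /fan_faces_mem[p [q [[_ eq] _ hq]]].
by rewrite eq hq in yA.
Qed.

(** A face is a triangle and has u among its corners by [fan_triangle]. As u begins the outer cycle
    it comes first, and the order of the cycle decides which of the other two corners is next. *)
Lemma fan_dual_path P u y t : glued P u y t Leaf -> fanlike t -> t <> Leaf ->
  dual_path P (verts t u y) (fan_faces t u y).
Proof.
move=> g ft nt; have [us _ _ _ _] := glued_uniq g; have emb := glued_embedding g nt.
have eP := glued_leaf_edges g; have incr := increasing_index us.
split; [exact: fan_faces_uniq| |exact: fan_dual_adj].
move=> f; split=> [hf|hf].
  have [p [q [ef _ _]]] := fan_faces_mem hf; have hs := fan_faces_subseq hf.
  have uf := subseq_uniq hs us; subst f.
  have [e1 e2 e3] := fan_faces_edges hf.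
  split=> //.
    by rewrite /= /adj eP e1 e2 setUC e3.
  have /andP[/andP[up uq] pq] : (u != p) && (u != q) && (p != q).
    by move: uf; rewrite /= !in_cons !in_nil !orbF negb_or andbT.
  have [nu np nq] := next3 up pq uq.
  move=> a b; rewrite !in_cons !in_nil !orbF => /or3P[]/eqP-> /or3P[]/eqP-> /adj_neq;
    rewrite ?eqxx // => _; auto.
have [[_ _ _ _] [_ faces]] := emb.
have := faces f hf; case: hf => _ sub cyc _.
case: f sub cyc => [|a [|b [|d []]]] // sub cyc _.
have uf := subseq_uniq sub us.
move: (uf); rewrite /= !in_cons !in_nil !orbF negb_or andbT => /andP[/andP[ab ad] bd].
move: cyc; rewrite /= andbT /adj eP => /and3P[e1 e2 e3].
have au : a = u.
  apply/eqP; apply/negPn/negP => au.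
  have abu : b != u.
    apply/negP => /eqP bu; move: sub; rewrite /verts bu /= (negPf au) => /mem_subseq /(_ u).
    rewrite !in_cons eqxx orbT => /(_ isT); move: us; rewrite /verts /= => /andP[/negPf->].
    by [].
  have adu : d != u.
    apply/negP => /eqP bu; move: sub; rewrite /verts bu /= (negPf au) => /mem_subseq /(_ u).
    rewrite !in_cons eqxx !orbT => /(_ isT); move: us; rewrite /verts /= => /andP[/negPf->].
    by [].
  by apply: (fan_triangle ft us au abu adu ab bd ad e1 e2); rewrite setUC.
subst a; case: (@fan_edge t u y b d ft _ _ e2); rewrite 1?eq_sym // => h.
have h1 := increasing_subseq sub incr; have h2 := increasing_subseq (fan_faces_subseq h) incr.
move: h1 h2; rewrite /increasing /= !andbT => /andP[_ h1] /andP[_ h2].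
by have := ltn_trans h1 h2; rewrite ltnn.
Qed.

(** At the end of the left spine nothing lies behind the side at u, so the ribbon formed by the
    triangles at u ends at a non-cutting edge. That [w] differs from y makes it distinct from the
    root edge. *)
Lemma fan_last_edge G u y t o : glued G u y t o -> t <> Leaf -> exists w,
  [/\ w \in verts t u y, w != y, noncutting G [set u; w] &
      [set u; w] \in face_edges (last [::] (fan_faces t u y))].
Proof.
elim: t y o => [|A IHA z B _] y o // g _.
have [us _ _ _ _] := glued_uniq g; have [uA uB AB uB' yA] := uniq_verts_node us.
have uz := uniq_verts_neq uA; have zy := uniq_verts_neq uB; have uy := uniq_verts_neq us.
case: A IHA g us uA AB yA => [|A1 z1 B1] IHA g us uA AB yA.
  exists z; split=> //.
  - by rewrite mem_verts_node mem_verts eqxx !orbT.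
  - by apply/(glued_noncutting (glued_left g)); left.
  - by rewrite /= face_edges3 // in_cons eqxx.
have nA : Node A1 z1 B1 <> Leaf by [].
have [w [w1 w2 w3 w4]] := IHA z _ (glued_left g) nA.
exists w; split=> //; first by rewrite mem_verts_node w1.
by apply: contraNneq yA => <-.
Qed.


Lemma empty_graph : exists F : graph V, vset F = set0 /\ eset F = set0.
Proof.
have wf : [forall e in (set0 : {set {set V}}), (e \subset (set0 : {set V})) && (#|e| == 2)].
  by apply/forall_inP => e; rewrite in_set0.
by exists (Graph wf).
Qed.

Lemma fan_embedding P u y t : glued P u y t Leaf -> fanlike t -> t <> Leaf ->
  standard_embedding P (verts t u y) /\ dual_path P (verts t u y) (fan_faces t u y).
Proof. by move=> g ft nt; split; [apply: glued_embedding|apply: fan_dual_path]. Qed.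

Lemma fan_ext_nleaf t t' : t <> Leaf -> fan_ext t t' <> Leaf.
Proof. by case: t => // A z B _; case: t'. Qed.

Lemma fan_nbr t u y x : fanlike t -> uniq (verts t u y) -> x \in verts t u y -> x != u ->
  [set u; x] \in edges t u y.
Proof.
elim: t y => [|A IHA z B _] y.
  by move=> _ _; rewrite mem_verts /= => /orP[]/eqP->; rewrite ?eqxx // in_set1.
case=> fA -> uq; have [uA _ _ _ _] := uniq_verts_node uq.
rewrite mem_verts_node edges_node !in_setU => /orP[xA xu|].
  by rewrite IHA ?orbT.
rewrite mem_verts /= => /orP[]/eqP-> _; first by rewrite root_edge orbT.
by rewrite in_set1 eqxx.
Qed.

Lemma bonnet_exists G u v t : glued G u v t Leaf -> t <> Leaf ->
  exists U, bonnet_with_cap G u v U.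
Proof.
case: t => // L c R g _; have [us _ uv _ _] := glued_uniq g.
have [uL uR LR unR vnL] := uniq_verts_node us.
have eG := glued_leaf_edges g; have vG := glued_leaf_vset g.
set t1 := fan_ext L Leaf; set t2 := fan_ext (mirror R) Leaf.
pose tP := Node t1 c Leaf; pose tU := Node t1 c (mirror t2).
have pr1 : prune t1 L by apply: prune_fan_ext.
have pr2 : prune t2 (mirror R) by apply: prune_fan_ext.
have pr2' : prune (mirror t2) R by rewrite -(mirrorK R); apply: prune_mirror.
have prU : prune tU (Node L c R) by split.
have prP : prune tP (Node L c R) by split.
have uR' : uniq (verts (mirror R) v c) by rewrite uniq_verts_mirror.
have u2 := prune_uniq pr2 uR'.
have [U gU] := tree_graph (prune_uniq prU us).
have [P gP] := tree_graph (prune_uniq prP us).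
have eU := glued_leaf_edges gU; have eP := glued_leaf_edges gP.
have {}eP : eset P = [set u; v] |: (edges t1 u c :|: [set [set c; v]]) by rewrite eP.
have eU' : eset U = [set u; v] |: (edges t1 u c :|: edges t2 v c).
  by rewrite eU -[in RHS](edges_mirror t2).
have vU := glued_leaf_vset gU; have vP := glued_leaf_vset gP.
have fP : fanlike tP by split=> //; apply: fanlike_fan_ext.
have f2 : fanlike t2 by apply: fanlike_fan_ext.
have ncuv : noncutting G [set u; v] by apply/(glued_noncutting g); right.
have nbr_c x : adj G u x -> adj G v x -> x = c.
  rewrite adj_sym => xu vx; rewrite adj_sym in xu.
  have [[A [B [_ -> _]]]|[A [B //]]] := glued_common g xu (etrans (adj_sym _ _ _) vx).
  by [].
(* If nothing lies beyond cv, the fan must be the empty graph: a single edge is no outerplanar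
   path. *)
have [F2 [vF2 eF2 fanF2]] : exists F2, [/\ vset F2 =i (if R is Leaf then [::] else verts t2 v c),
    eset F2 = (if R is Leaf then set0 else edges t2 v c) & fan G P v F2].
  case eR: R => [|R1 z R2].
    have [F [h1 h2]] := empty_graph; exists F.
    by split; [rewrite h1 => a; rewrite in_set0 in_nil|by []|left].
  have [F gF] := tree_graph u2; exists F.
  have nt2 : t2 <> Leaf by apply: fan_ext_nleaf; rewrite eR.
  have eF := glued_leaf_edges gF; have vF := glued_leaf_vset gF.
  split=> //; right; have [emb dp] := fan_embedding gF f2 nt2; split.
  - by exists (verts t2 v c), (fan_faces t2 v c).
  - move=> x; rewrite vF => xF; case: (x =P v) => [|/eqP xv]; [by left|right].
    have h := fan_nbr f2 u2 xF xv; have := fintype.subsetP (prune_edges v c pr2) _ h.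
    by rewrite edges_mirror /adj eG edges_node !in_setU => ->; rewrite !orbT.
  exists [set v; c]; last exact: set21.
  apply/setP => e; rewrite in_setI in_set1 eF eP.
  apply/andP/eqP => [[he2 heP]|->]; last first.
    by rewrite root_edge !in_setU !in_set1 (setUC [set v]) eqxx !orbT.
  have eR' : e \in edges R c v.
    by rewrite -edges_mirror; apply: fintype.subsetP (prune_edges v c pr2) _ he2.
  move: heP; rewrite !in_setU !in_set1 => /or3P[/eqP ee|h1|/eqP->].
  - by have := edges_verts eR' (_ : u \in e); rewrite ee set21 (negPf unR) => /(_ isT).
  - have h1' := fintype.subsetP (prune_edges u c pr1) _ h1.
    have eGe : e \in eset G by rewrite eG edges_node !in_setU eR' !orbT.
    have [a [b [eab ab]]] := edge_pair eGe.
    have cc x : x \in e -> x = c.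
      by move=> xe; apply: LR; [apply: edges_verts h1' xe|apply: edges_verts eR' xe].
    have ha : a = c by apply: cc; rewrite eab set21.
    have hb : b = c by apply: cc; rewrite eab set22.
    by have := adj_neq ab; rewrite ha hb eqxx.
  - by rewrite setUC.
exists U; split=> //.
- split; first by apply/fintype.subsetP => a; rewrite vU vG; apply: prune_verts.
  by rewrite eU eG; apply: prune_edges.
- have [uU _ _ _ _] := glued_uniq gU; rewrite (eq_card vU) (card_uniqP uU).
  rewrite /verts /= size_cat /= size_cat /=; clear; lia.
- have [F1 [vF1 eF1]] := empty_graph; exists P, F1, F2; split.
  + apply/setP => a; rewrite !in_setU vF1 in_set0 orbF vU vP vF2.
    rewrite !mem_verts_node verts_mirror mem_rev.
    case: (R) @t2 {pr2 pr2' tU prU gU u2 eU' vU eU f2 fanF2 vF2 eF2} => [|R1 z R2] t2; rewrite !mem_verts in_nil;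
      by do !case: (_ \in inn _); do !case: (_ == _).
  + rewrite eF1 setU0 eU' eP eF2.
    case: (R) @t2 {pr2 pr2' tU prU gU u2 eU' vU eU f2 fanF2 vF2 eF2} => [|R1 z R2] t2.
      by rewrite setU0 /= (setUC [set v]).
    rewrite -setUA -setUA; congr (_ :|: (_ :|: _)).
    by apply/esym/setUidPr; apply/fintype.subsetP => e /set1P->; rewrite setUC root_edge.
  + have nt : Node L c R <> Leaf by [].
    have [w [w1 w2 w3 w4]] := fan_last_edge g nt.
    have nP : tP <> Leaf by [].
    have [emb dp] := fan_embedding gP fP nP.
    exists [set u; v], [set u; w]; split; first split=> //.
    * by apply: contra w2 => /eqP/set2_eq[[_ ->]|[_ vu]] //; rewrite vu eqxx in uv.
    * exists (verts tP u v), (fan_faces tP u v); split=> //.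
        rewrite /= face_edges3 //; last exact: uniq_verts_neq uR.
          by rewrite !in_cons (setUC [set v]) eqxx !orbT.
        exact: uniq_verts_neq uL.
      by move: w4; rewrite -fan_faces_fan_ext.
    split.
    * by rewrite vP mem_verts eqxx.
    * by rewrite vP mem_verts eqxx !orbT.
    * by move=> x ux vx; rewrite (nbr_c x ux vx) vP mem_verts /= mem_cat mem_head !orbT.
  + by split=> //; left.
  + by rewrite eF1 set0I.
- move=> x; rewrite vU mem_verts_node verts_mirror mem_rev /adj eG.
  case=> h.
    have := fan_ext_nbr (t' := Leaf) I us h; rewrite mem_verts_node => /orP[->//|].
    by rewrite mem_verts /= => /orP[]/eqP->; rewrite !mem_verts !eqxx ?orbT.
  have us' : uniq (verts (mirror (Node L c R)) v u) by rewrite uniq_verts_mirror.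
  rewrite -edges_mirror in h.
  have := fan_ext_nbr (t' := Leaf) I us' h; rewrite mem_verts_node => /orP[->|].
    by rewrite orbT.
  by rewrite mem_verts /= => /orP[]/eqP->; rewrite !mem_verts !eqxx ?orbT.
Qed.

(** The cut-component away from uv is the side [s] of the located edge, as [glued_locate] keeps uv
    on the other side; it is smaller because that side has inner vertices. *)
Lemma hanging_tree G u v t e : glued G u v t Leaf -> cutting G e -> exists x y s S,
  [/\ e = [set x; y], size (inn s) < size (inn t), s <> Leaf, glued S x y s Leaf &
      hanging G [set u; v] e S].
Proof.
move=> g /andP[eG hcut]; have eE := glued_leaf_edges g; rewrite eE in eG.
have [x [y [s [o [exy g' sub sz]]]]] := glued_locate g eG.
have [us uo xy sh oh] := glued_uniq g'.
have ncut : ~ (s = Leaf \/ o = Leaf).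
  by move=> h; have /andP[_] := (glued_noncutting g').2 h; rewrite -exy (negPf hcut).
have ns : s <> Leaf by move=> h; apply: ncut; left.
have no : o <> Leaf by move=> h; apply: ncut; right.
have [S gS] := tree_graph us; exists x, y, s, S; split=> //.
  have : size (inn s ++ inn o) <= size (inn t).
    by have := glued_card g'; rewrite (glued_card g) /= addn0 size_cat => -[->].
  rewrite size_cat; case: (o) no => // A z B _; rewrite /= size_cat /=; clear; lia.
split; first by rewrite exy; apply: glued_cut_component g' ns no gS.
rewrite (glued_leaf_edges gS); apply/negP => h.
have h' : [set u; v] \in edges o y x.
  by apply: (fintype.subsetP sub); rewrite setUC root_edge.
have e0 := glued_common_edge g' h h'.
have /andP[_] : noncutting G [set u; v] by apply/(glued_noncutting g); right.
by rewrite e0 -exy (negPf hcut).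
Qed.

Lemma bonnet_system_exists G u v t : glued G u v t Leaf -> t <> Leaf ->
  exists d, bonnet_system G [set u; v] d.
Proof.
have [n] := ubnP (size (inn t)); elim: n G u v t => // n IH G u v t lt_t g nt.
have [U hU] := bonnet_exists g nt.
pose good (e : {set V}) (p : graph V * nat) := e \in anchors G U ->
  hanging G [set u; v] e p.1 /\ bonnet_system p.1 e p.2.
have [f fP] : {f & forall e, good e (f e)}.
  apply: boolp.choice => e; case: (boolP (e \in anchors G U)) => he; last first.
    by exists (G, 0) => he'; rewrite he' in he.
  have hcut : cutting G e by move: he; rewrite inE => /and3P[].
  have [x [y [s [S [exy sz ns gS hS]]]]] := hanging_tree g hcut.
  have [d hd] := IH S x y s (leq_trans sz lt_t) gS ns.
  by exists (S, d) => _; split=> //; rewrite exy.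
exists (\max_(e in anchors G U) (f e).2).+1.
apply: (@BonnetSystem _ G _ U (fun e => (f e).1) (fun e => (f e).2)).
- by apply/(glued_noncutting g); right.
- by exists u, v.
- by move=> e /fP[].
- by move=> e /fP[].
Qed.

(** An inhabited set of natural numbers has a least element, so [xget] does not fall back on its
    default value. *)
Lemma minimumP (D : nat -> Prop) k : D k -> D (minimum D).
Proof.
move=> Dk; rewrite /minimum.
suff : exists i, D i /\ forall k, D k -> i <= k.
  by move=> h; have [] := classical_sets.xgetPex 0 h.
have exD : exists i, boolp.asbool (D i) by exists k; apply/boolp.asboolP.
case: (ex_minnP exD) => i /boolp.asboolP Dm hm; exists i; split=> // j /boolp.asboolP.
exact: hm.
Qed.

(** Both minima are attained: some non-cutting edge exists, and each of them is the root-edge of a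
    bonnet system. So [bd_free] is not a junk value. *)
Lemma bd_free_system G : maximal_outerplanar G ->
  exists u v t, [/\ glued G u v t Leaf, t <> Leaf & bonnet_system G [set u; v] (bd_free G)].
Proof.
case=> c /embedding_glued[x [y [t [nt g]]]].
have nc : noncutting G [set x; y] by apply/(glued_noncutting g); right.
have [r ncr er] : exists2 r, noncutting G r & bd_free G = bd G r.
  apply: (@minimumP (fun k => exists2 r, noncutting G r & k = bd G r) (bd G [set x; y])).
  by exists [set x; y].
have [u [v [euv _]]] := edge_pair (proj1 (andP ncr)); rewrite euv in ncr er.
have [t' nt' g'] := noncutting_root g nt ncr.
exists u, v, t'; split=> //; rewrite er.
by have [d hd] := bonnet_system_exists g' nt'; apply: minimumP hd.
Qed.

End Fans.

(** * From bonnets to trees *)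

Section Decomposition.
Variable V : finType.
Implicit Types (G S P F U : graph V) (t s o A B : tree V) (a b u v w x y z m p q : V) (e r : {set V}).
Implicit Types (H : tree V -> Prop).

(* The dual tree of the pruning s of t is a path from the root triangle, and its
   last triangle has, besides the side that leads to it, a side of t. *)
Fixpoint pathlike s t : Prop :=
  match s, t with
  | Node A' _ B', Node A _ B =>
      [/\ A' = Leaf \/ B' = Leaf, A' = Leaf -> B' = Leaf -> A = Leaf \/ B = Leaf,
          pathlike A' A & pathlike B' B]
  | _, _ => True
  end.

(* The parts of t cut off by the pruning s are the hanging subgraphs. *)
Fixpoint hangs H s t : Prop :=
  match s, t with
  | Leaf, _ => H t
  | Node A' _ B', Node A _ B => hangs H A' A /\ hangs H B' B
  | Node _ _ _, Leaf => False
  end.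

Lemma hangs_fan H t : hangs H (fan_ext t Leaf) t -> fan_with H t.
Proof. by elim: t => //= A IHA z B _ [/IHA]. Qed.

(** [ribbon_with] descends to a leaf of [t], whereas [s] may stop earlier. By the end condition of
    [pathlike], the last triangle of [s] has a side with nothing behind it; the descent takes this
    side and leaves the other one to a hanging subgraph. *)
Lemma pathlike_ribbon H s t : H Leaf -> s <> Leaf -> pathlike s t -> hangs H s t -> ribbon_with H t.
Proof.
move=> HL; elim: s t => // A' IHA z B' IHB [|A z' B] //= _ [hAB hl lA lB] [hA hB].
case: A' IHA hAB hl lA hA => [|A1 z1 A2] IHA hAB hl lA hA.
  case: B' IHB hAB hl lB hB => [|B1 z2 B2] IHB hAB hl lB hB.
    by case: (hl erefl erefl) => ->; [left|right].
  by right; split=> //; apply: IHB.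
case: hAB => // eB; subst B'.
by left; split=> //; apply: IHA.
Qed.

(** Ribbon and fan advance together along the left spine. If the ribbon stops there, the fan goes on
    in its place; if it turns away from u, the triangles remaining on the left spine are the fan. *)
Lemma pathlike_fan_ribbon H s t : H Leaf -> prune s t -> pathlike s t ->
  hangs H (fan_ext t s) t -> fan_ribbon_with H t.
Proof.
move=> HL; elim: t s => // A IHA z B _ [|A' z' B'] /=.
  by move=> _ _ [hA hB]; left; split=> //; apply: (IHA Leaf).
case=> _ pA pB [hAB hl lA lB] [hA hB].
case: B' hAB hl lB hB pB => [|B1 z2 B2] hAB hl lB hB pB.
  by left; split=> //; apply: IHA hA.
case: hAB => // eA; subst A'; right; split; first exact: hangs_fan.
exact: pathlike_ribbon HL _ lB hB.
Qed.

Lemma sorted_const (T : eqType) (E : rel T) (C : T -> bool) (l : seq T) :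
  (forall a b : T, a \in l -> b \in l -> E a b -> C a = C b) -> sorted E l ->
  forall a b : T, a \in l -> b \in l -> C a = C b.
Proof.
case: l => // a0 l hC hl; suff h (a : T) : a \in a0 :: l -> C a = C a0.
  by move=> a b /h-> /h->.
elim: l a0 hC hl => [|b l IH] a0 hC; first by move=> _; rewrite mem_seq1 => /eqP->.
move=> /andP[ab bl]; rewrite in_cons => /orP[/eqP->//|al].
rewrite (IH b) //.
  by apply/esym/hC => //; rewrite !in_cons eqxx ?orbT.
by move=> c d hc hd; apply: hC; rewrite in_cons ?hc ?hd orbT.
Qed.

Lemma inn_sorted G x y s o : glued G x y s o -> sorted (adj G) (inn s).
Proof. by move=> g; have := edges_path (glued_subset g); rewrite cat_path => /andP[/path_sorted]. Qed.

Lemma inn_notin G x y s o a : glued G x y s o -> a \in inn s -> a \notin [set x; y].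
Proof.
move=> g ha; have [_ _ _ /(_ a ha) h _] := glued_uniq g; apply: contra h.
by rewrite in_set2 mem_verts => /orP[]->; rewrite ?orbT.
Qed.

(* Removing x and y leaves both sides of the edge xy connected, so each of them
   lies in one of the two cut-components. *)
Lemma hanging_glued G S x y s o r : glued G x y s o -> s <> Leaf ->
  r \in edges o y x -> r != [set x; y] -> hanging G r [set x; y] S -> glued S x y s Leaf.
Proof.
move=> g ns ro nr [[H' [moS moH [uV uE] iV iE]] rS].
have [us uo xy sh oh] := glued_uniq g; have g2 := glued_swap g.
have rG : r \in eset G by rewrite (glued_edges g) ro orbT.
have rH : r \in eset H' by move: rG; rewrite uE in_setU (negPf rS).
have oxy a : a \in inn o -> a \notin [set x; y].
  by move=> /(inn_notin g2); rewrite setUC.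
have sxy a : a \in inn s -> a \notin [set x; y] by apply: inn_notin g.
(* No edge joins the two components away from x and y, so membership in [H'] is constant along paths
   that avoid x and y. *)
have closed a b : a \notin [set x; y] -> b \notin [set x; y] -> adj G a b ->
    (a \in vset H') = (b \in vset H').
  suff h c d : c \notin [set x; y] -> adj G c d -> c \in vset H' -> d \in vset H'.
    by move=> na nb ab; apply/idP/idP; apply: h; rewrite // adj_sym.
  rewrite -iV in_setI => nc cd cH; rewrite cH andbT in nc.
  move: cd; rewrite /adj uE in_setU => /orP[h|h].
    by rewrite (edge_ends h (set21 _ _)) in nc.
  exact: edge_ends h (set22 _ _).
(* The root edge [r] lies in [H'] and has an end inside [o], which puts all of the inside there. *)
have oH a : a \in inn o -> a \in vset H'.
  have [b br bo] : exists2 b, b \in r & b \in inn o.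
    apply/exists_inP; apply: contraNT nr => /exists_inPn h; apply/eqP.
    apply: (edge_in_pair rG) => b br; have := edges_verts ro br.
    by rewrite mem_verts (negPf (h b br)) /= in_set2 orbC.
  move=> ao; have bH : b \in vset H' := edge_ends rH br.
  have -> // : (a \in vset H') = (b \in vset H').
  apply: (sorted_const (C := mem (vset H')) _ (inn_sorted g2)) => // c d hc hd.
  by apply: closed; apply: oxy.
have xyS : [set x; y] \in eset S.
  have : [set x; y] \in eset S :&: eset H' by rewrite iE in_set1.
  by rewrite in_setI => /andP[].
have inS a : a \in vset S -> a \notin [set x; y] -> a \in inn s /\ a \notin vset H'.
  move=> aS na; have naH : a \notin vset H'.
    by move: na; rewrite -iV in_setI aS.
  split=> //; have : a \in vset G by rewrite uV in_setU aS.
  rewrite (glued_vset g) => /orP[|/oH]; last by rewrite (negPf naH).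
  rewrite mem_verts; move: na; rewrite in_set2 negb_or.
  by case/andP=> /negPf-> /negPf->; rewrite orbF.
(* [S] has a third vertex, which lies inside [s] and outside [H']; the whole inside of [s] follows
   it. *)
have sH a : a \in inn s -> a \notin vset H'.
  have [x0 [y0 [t0 [nt0 g0]]]] : exists x0 y0 t0, t0 <> Leaf /\ glued S x0 y0 t0 Leaf.
    by case: moS => c /embedding_glued.
  have [b bS bxy] : exists2 b, b \in vset S & b \notin [set x; y].
    apply/exists_inP; apply: contraT => /exists_inPn h; exfalso.
    have : #|vset S| <= #|[set x; y]|.
      by apply/subset_leq_card/fintype.subsetP => b /h; rewrite negbK.
    rewrite cards2 xy (glued_card g0); case: (t0) nt0 => // A z B _.
    by rewrite /= size_cat /=; clear; lia.
  have [bs nbH] := inS b bS bxy.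
  move=> as_; have -> // : (a \in vset H') = (b \in vset H').
  apply: (sorted_const (C := mem (vset H')) _ (inn_sorted g)) => // c d hc hd.
  by apply: closed; apply: sxy.
have vS : vset S =i verts s x y.
  move=> a; apply/idP/idP.
    case: (boolP (a \in [set x; y])) => [|na].
      by rewrite in_set2 mem_verts => /orP[]->; rewrite ?orbT.
    by move=> aS; have [h _] := inS a aS na; rewrite mem_verts h orbT.
  rewrite mem_verts => /or3P[/eqP->|ha|/eqP->].
  - exact: edge_ends xyS (set21 _ _).
  - have : a \in vset G by rewrite (glued_vset g) mem_verts ha orbT.
    by rewrite uV in_setU (negPf (sH a ha)) orbF.
  - exact: edge_ends xyS (set22 _ _).
split.
- by move: us; rewrite /verts cats1.
- by move=> a; rewrite vS /verts /=.
apply/setP => e; rewrite in_setU in_set1; apply/idP/orP => [eS|[es|/eqP->]].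
- left; have eG : e \in eset G by rewrite uE in_setU eS.
  move: (eG); rewrite (glued_edges g) => /orP[//|eo].
  rewrite (edge_in_pair (x := x) (y := y) eG) ?root_edge // => a ae.
  have := edge_ends eS ae; rewrite vS mem_verts in_set2.
  case/or3P=> [->//|/sh|->]; last by rewrite orbT.
  by rewrite (edges_verts eo ae).
- have : e \in eset G by rewrite (glued_edges g) es.
  move=> eG; move: (eG); rewrite uE in_setU => /orP[//|eH].
  rewrite (edge_in_pair (x := x) (y := y) eG) // => a ae.
  have := edges_verts es ae; rewrite mem_verts in_set2.
  case/or3P=> [->//|/sH|->]; last by rewrite orbT.
  by rewrite (edge_ends eH ae).
- by rewrite setUC.
Qed.

(** An edge that avoids v and has an end other than w on the left side stays on that side. The apex
    of each triangle of [s] is joined to two distinct vertices on the left, one of which is not w,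
    so [s] never gets across. *)
Lemma edges_confined s A w B u v p q : uniq (verts (Node A w B) u v) ->
  edges s p q \subset edges (Node A w B) u v -> uniq (verts s p q) -> v \notin verts s p q ->
  p \in verts A u w -> q \in verts A u w -> edges s p q \subset edges A u w.
Proof.
move=> uq; have [uA uB AB uB' vA] := uniq_verts_node uq.
have step a b : [set a; b] \in edges (Node A w B) u v -> a != v -> b != v ->
    a \in verts A u w -> a != w -> [set a; b] \in edges A u w.
  move=> + av bv aA aw; rewrite edges_node !in_setU in_set1.
  case/or3P=> [/eqP/set2_eq[[_ e]|[e _]]|//|h].
  - by rewrite e eqxx in bv.
  - by rewrite e eqxx in av.
  - by rewrite (AB a aA (edges_verts h (set21 _ _))) eqxx in aw.
have step2 a b : [set a; b] \in edges (Node A w B) u v -> a != b -> a != v -> b != v ->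
    a \in verts A u w -> b \in verts A u w -> [set a; b] \in edges A u w.
  move=> h ab av bv aA bA; case: (a =P w) => [aw|/eqP aw]; last exact: step.
  by rewrite setUC; apply: step; rewrite // ?(setUC [set b]) // -aw eq_sym.
elim: s p q => [|C IHC z D IHD] p q sub us vs pA qA.
  apply/fintype.subsetP => e /set1P->; apply: step2 => //.
  - by apply: (fintype.subsetP sub); rewrite root_edge.
  - exact: uniq_verts_neq us.
  - by apply: contraNneq vs => ->; rewrite mem_verts eqxx.
  - by apply: contraNneq vs => ->; rewrite mem_verts eqxx !orbT.
have [uC uD CD pD qC] := uniq_verts_node us.
have subC : edges C p z \subset edges (Node A w B) u v.
  apply: fintype.subset_trans sub; rewrite edges_node.
  by apply: fintype.subset_trans (subsetUr _ _); apply: subsetUl.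
have subD : edges D z q \subset edges (Node A w B) u v.
  apply: fintype.subset_trans sub; rewrite edges_node.
  by apply: fintype.subset_trans (subsetUr _ _); apply: subsetUr.
have vC : v \notin verts C p z by apply: contra vs; rewrite mem_verts_node => ->.
have vD : v \notin verts D z q by apply: contra vs; rewrite mem_verts_node => ->; rewrite orbT.
have zv : z != v by apply: contraNneq vC => <-; rewrite mem_verts eqxx !orbT.
have pv : p != v by apply: contraNneq vC => <-; rewrite mem_verts eqxx.
have qv : q != v by apply: contraNneq vD => <-; rewrite mem_verts eqxx !orbT.
have pq : p != q := uniq_verts_neq us.
have pz := fintype.subsetP subC _ (root_edge C p z).
have zq := fintype.subsetP subD _ (root_edge D z q).
have zA : z \in verts A u w.
  case: (p =P w) => [pw|/eqP pw].
    have qw : q != w by rewrite -pw eq_sym.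
    rewrite setUC in zq.
    by apply: edges_verts (step _ _ zq qv zv qA qw) (set22 _ _).
  by apply: edges_verts (step _ _ pz pv zv pA pw) (set22 _ _).
rewrite edges_node !subUset IHC // IHD // !andbT.
apply/fintype.subsetP => e /set1P->; apply: step2 => //.
by apply: (fintype.subsetP sub); rewrite root_edge.
Qed.

(** The two root triangles agree by [apex_unique], and [edges_confined] keeps the sides of one
    within those of the other, on the right by mirroring. *)
Lemma edges_prune t s u v : uniq (verts t u v) -> uniq (verts s u v) ->
  edges s u v \subset edges t u v -> prune s t.
Proof.
elim: s t u v => // A' IHA w B' IHB t u v ut us sub.
have [uA' uB' AB' uB1 vA1] := uniq_verts_node us.
have rA : [set u; w] \in edges t u v.
  by apply: (fintype.subsetP sub); rewrite edges_node !in_setU root_edge orbT.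
have rB : [set w; v] \in edges t u v.
  by apply: (fintype.subsetP sub); rewrite edges_node !in_setU root_edge !orbT.
have wu : w != u by rewrite eq_sym; apply: uniq_verts_neq uA'.
have [A [B et]] := apex_unique ut wu (uniq_verts_neq uB') rA rB.
move: sub ut; rewrite et => sub ut; have [uA uB AB uB2 vA2] := uniq_verts_node ut.
have wA : w \in verts A u w by rewrite mem_verts eqxx !orbT.
have wB : w \in verts B w v by rewrite mem_verts eqxx.
split=> //.
- apply: (IHA _ u w) => //; apply: edges_confined ut _ uA' vA1 _ wA; last by rewrite mem_verts eqxx.
  apply: fintype.subset_trans sub; rewrite edges_node.
  by apply: fintype.subset_trans (subsetUr _ _); apply: subsetUl.
- apply: (IHB _ w v) => //.
  have ut' : uniq (verts (Node (mirror B) w (mirror A)) v u).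
    by have := ut; rewrite -uniq_verts_mirror.
  rewrite -(edges_mirror B') -(edges_mirror B).
  apply: edges_confined ut' _ _ _ _ _; rewrite ?uniq_verts_mirror // ?verts_mirror ?mem_rev //;
    last by rewrite mem_verts eqxx !orbT.
  rewrite -[Node _ _ _]/(mirror (Node A w B)) !edges_mirror.
  apply: fintype.subset_trans sub; rewrite edges_node.
  by apply: fintype.subset_trans (subsetUr _ _); apply: subsetUr.
Qed.

(** The two sides of a triangle meet in its apex only, so the ends of an edge determine its side.
    This bounds the edges of a bonnet by its vertices. *)
Lemma prune_induced s t u v a b : uniq (verts t u v) -> prune s t -> a != b ->
  a \in verts s u v -> b \in verts s u v -> [set a; b] \in edges t u v ->
  [set a; b] \in edges s u v.
Proof.
elim: s t u v => [|A' IHA z B' IHB] t u v ut pr ab.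
  rewrite !mem_verts /= in_set1 => /orP[]/eqP ea /orP[]/eqP eb _;
  by move: ab; rewrite ea eb ?eqxx // (setUC [set v]) eqxx.
case: t ut pr => // A z' B ut [ez pA pB]; subst z'.
have [uA uB AB uB2 vA2] := uniq_verts_node ut.
have inA c : c \in verts A u z -> c \in verts (Node A' z B') u v -> c \in verts A' u z.
  rewrite mem_verts_node => cA /orP[//|/(prune_verts pB) cB].
  by rewrite (AB c cA cB) mem_verts eqxx !orbT.
have inB c : c \in verts B z v -> c \in verts (Node A' z B') u v -> c \in verts B' z v.
  rewrite mem_verts_node => cB /orP[/(prune_verts pA) cA|//].
  by rewrite (AB c cA cB) mem_verts eqxx.
move=> ha hb; rewrite !edges_node !in_setU !in_set1 => /or3P[->//|h|h].
- rewrite (IHA A u z) ?orbT //; apply: inA => //; apply: edges_verts h _;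
  by rewrite ?set21 ?set22.
- rewrite (IHB B z v) ?orbT //; apply: inB => //; apply: edges_verts h _;
  by rewrite ?set21 ?set22.
Qed.

Lemma fan_ext_verts t t' u y x : prune t' t -> x \in verts (fan_ext t t') u y ->
  x \in verts t' u y \/ [set u; x] \in edges t u y.
Proof.
elim: t t' y => [|A IHA z B _] t' y.
  by case: t' => // _; left.
case: t' => [_|A' z' B' [ez pA pB]] /=.
  rewrite mem_verts_node => /orP[/(IHA Leaf _ I)[|h]|].
  - rewrite mem_verts /= => /orP[]/eqP->; first by left; rewrite mem_verts eqxx.
    by right; rewrite !in_setU root_edge orbT.
  - by right; rewrite !in_setU h orbT.
  - rewrite mem_verts /= => /orP[]/eqP->; last by left; rewrite mem_verts eqxx !orbT.
    by right; rewrite !in_setU root_edge orbT.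
subst z'; rewrite mem_verts_node => /orP[/(IHA A' _ pA)[h|h]|h].
- by left; rewrite mem_verts_node h.
- by right; rewrite !in_setU h orbT.
- by left; rewrite mem_verts_node h orbT.
Qed.

End Decomposition.

(** * The dual path of a ribbon *)

Section DualPath.
Variable V : finType.
Implicit Types (G S P F U : graph V) (t s o A B : tree V) (a b d u v w x y z m p q : V) (e r : {set V}).
Implicit Types (c f : seq V).

(** Three pairwise adjacent vertices have no diagonals among them, so listed in the order of [c]
    they are an interior face. *)
Lemma triangle_face G c a b d : standard_embedding G c -> adj G a b -> adj G b d -> adj G a d ->
  exists2 f, interior_face G c f & f =i [:: a; b; d].
Proof.
case=> [[_ uc cG _] _] ab bd ad.
have uT : uniq [:: a; b; d].
  by rewrite /= !in_cons in_nil !orbF negb_or (adj_neq ab) (adj_neq ad) (adj_neq bd).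
pose f := [seq x <- c | x \in [:: a; b; d]].
have ef : f =i [:: a; b; d].
  move=> x; rewrite mem_filter andb_idr // cG !in_cons in_nil orbF.
  have [[? ?] [_ ?]] := (adj_vset ab, adj_vset ad).
  by case/or3P=> /eqP->.
have uf : uniq f by apply: filter_uniq.
have sf : size f = 3 by rewrite (perm_size (uniq_perm uf uT ef)).
have adjf x y : x \in f -> y \in f -> x != y -> adj G x y.
  rewrite !ef !in_cons !in_nil !orbF => /or3P[]/eqP-> /or3P[]/eqP->; rewrite ?eqxx //;
  by rewrite adj_sym.
have subf : subseq f c := filter_subseq (mem [:: a; b; d]) c.
exists f => //; case: f sf uf adjf {ef} subf => [|p [|q [|r []]]] // _ uf adjf sub.
have /andP[/andP[pq pr] qr] : (p != q) && (p != r) && (q != r).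
  by move: uf; rewrite /= !in_cons !in_nil !orbF negb_or andbT.
have [np nq nr] := next3 pq qr pr; have ip : p \in [:: p; q; r] by rewrite mem_head.
have iq : q \in [:: p; q; r] by rewrite !in_cons eqxx orbT.
have ir : r \in [:: p; q; r] by rewrite !in_cons eqxx !orbT.
split=> //; first by rewrite /= !adjf // eq_sym.
move=> x y; rewrite !in_cons !in_nil !orbF => /or3P[]/eqP-> /or3P[]/eqP-> /adj_neq;
rewrite ?eqxx // => _; auto.
Qed.

Lemma face_edge3 f p q : size f = 3 -> uniq f -> p \in f -> q \in f -> p != q ->
  [set p; q] \in face_edges f.
Proof.
case: f => [|x [|y [|z []]]] // _ uf.
have /andP[/andP[xy xz] yz] : (x != y) && (x != z) && (y != z).
  by move: uf; rewrite /= !in_cons !in_nil !orbF negb_or andbT.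
rewrite (face_edges3 xy yz xz) !in_cons !in_nil !orbF.
move=> /or3P[]/eqP-> /or3P[]/eqP->; rewrite ?eqxx ?orbT //= => _.
- by rewrite (setUC [set x]) eqxx !orbT.
- by rewrite (setUC [set y]) eqxx ?orbT.
- by rewrite (setUC [set z]) eqxx ?orbT.
Qed.

Lemma face_edge_pair f e : size f = 3 -> uniq f -> e \in face_edges f ->
  exists p q, [/\ e = [set p; q], p != q, p \in f & q \in f].
Proof.
case: f => [|x [|y [|z []]]] // _ uf.
have /andP[/andP[xy xz] yz] : (x != y) && (x != z) && (y != z).
  by move: uf; rewrite /= !in_cons !in_nil !orbF negb_or andbT.
rewrite (face_edges3 xy yz xz) !in_cons !in_nil !orbF => /or3P[]/eqP->.
- by exists x, y; rewrite !in_cons !eqxx ?orbT.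
- by exists y, z; rewrite !in_cons !eqxx ?orbT.
- by exists z, x; rewrite !in_cons !eqxx ?orbT eq_sym.
Qed.

Lemma third_vertex f p q : size f = 3 -> uniq f -> p \in f -> q \in f -> p != q ->
  exists d, [/\ d != p, d != q & f =i [:: p; q; d]].
Proof.
case: f => [|x [|y [|z []]]] // _ uf.
have /andP[/andP[xy xz] yz] : (x != y) && (x != z) && (y != z).
  by move: uf; rewrite /= !in_cons !in_nil !orbF negb_or andbT.
have [yx zx zy] : [/\ y != x, z != x & z != y] by split; rewrite eq_sym.
have eqi p0 q0 d0 : perm_eq [:: p0; q0; d0] [:: x; y; z] -> [:: x; y; z] =i [:: p0; q0; d0].
  by move=> h v0; rewrite (perm_mem h).
rewrite !in_cons !in_nil !orbF => /or3P[]/eqP-> /or3P[]/eqP->; rewrite ?eqxx // => _;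
  [exists z|exists y|exists z|exists x|exists y|exists x]; split=> //; apply: eqi;
  apply/permP => C /=; clear; lia.
Qed.

Variables (P : graph V) (c : seq V) (fs : seq (seq V)).
Hypothesis emb : standard_embedding P c.
Hypothesis dp : dual_path P c fs.

Lemma faceP f : f \in fs -> [/\ size f = 3, uniq f, subseq f c &
  forall p q, p \in f -> q \in f -> p != q -> adj P p q].
Proof.
case: dp => _ /(_ f) [h _] _ /h hf; have [[_ uc _ _] [_ /(_ f hf) sf]] := emb.
case: hf => _ sub cyc _; have uf := subseq_uniq sub uc; split=> // p q.
case: f sf cyc uf {h sub} => [|x [|y [|z []]]] // _ cyc uf.
have [h1 [h2 h3]] : adj P x y /\ adj P y z /\ adj P z x by move: cyc; rewrite /= andbT => /and3P[].
rewrite !in_cons !in_nil !orbF => /or3P[]/eqP-> /or3P[]/eqP->; rewrite ?eqxx //;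
by rewrite adj_sym.
Qed.

Lemma face_ext f f' : f \in fs -> f' \in fs -> f =i f' -> f = f'.
Proof.
move=> /faceP[_ _ hf _] /faceP[_ _ hf' _] eff; case: emb => [[_ uc _ _] _].
have e1 := elimT (subseq_uniqP uc) hf; have e2 := elimT (subseq_uniqP uc) hf'.
by rewrite e1 e2; apply: eq_filter => x; rewrite eff.
Qed.

Lemma triangle_in a b d : adj P a b -> adj P b d -> adj P a d ->
  exists2 f, f \in fs & f =i [:: a; b; d].
Proof.
move=> ab bd ad; have [f hf ef] := triangle_face emb ab bd ad; exists f => //.
by case: dp => _ /(_ f) [_ h] _; apply: h.
Qed.

Lemma share_dual f f' p q : f \in fs -> f' \in fs -> f != f' -> p != q ->
  p \in f -> q \in f -> p \in f' -> q \in f' -> dual_adj f f'.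
Proof.
move=> /faceP[s1 u1 _ _] /faceP[s2 u2 _ _] nf pq p1 q1 p2 q2; rewrite /dual_adj nf.
by apply/existsP; exists [set p; q]; rewrite !face_edge3.
Qed.

Lemma dual_index f f' : f \in fs -> f' \in fs -> dual_adj f f' ->
  ((index f fs).+1 == index f' fs) || ((index f' fs).+1 == index f fs).
Proof.
move=> hf hf' hd; case: dp => _ _ /(_ (index f fs) (index f' fs)) <-; rewrite ?index_mem //.
by rewrite !nth_index.
Qed.

Lemma interior_face_dual f : f \in fs -> f != head [::] fs -> f != last [::] fs ->
  exists f1 f2, [/\ f1 \in fs, f2 \in fs, f1 != f2, dual_adj f f1 & dual_adj f f2].
Proof.
move=> hf h0 hl; case: dp => ufs _ hd; have hi : index f fs < size fs by rewrite index_mem.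
have i0 : 0 < index f fs.
  rewrite lt0n; apply: contra h0 => /eqP h; rewrite -nth0 -h nth_index //.
have il : (index f fs).+1 < size fs.
  rewrite ltn_neqAle hi andbT; apply: contra hl => /eqP h.
  by rewrite -nth_last -h /= nth_index.
have ef : f = nth [::] fs (index f fs) by rewrite nth_index.
exists (nth [::] fs (index f fs).-1), (nth [::] fs (index f fs).+1).
have i1 : (index f fs).-1 < size fs by apply: leq_ltn_trans (leq_pred _) hi.
split; rewrite ?mem_nth //.
- rewrite nth_uniq //; apply/negP => /eqP; clear -i0; lia.
- by rewrite {1}ef hd // prednK // eqxx orbT.
- by rewrite {1}ef hd // eqxx.
Qed.

(** If [s] went on across both xz and zy, the triangle xyz would have three neighbours in the dual
    path, the third one beyond xy. If it stops at xyz, the only neighbour is beyond xy, so xyz is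
    the first or last face and has a side that is non-cutting in G. This side is not xy, behind
    which G continues on both sides; so nothing of [t] lies behind xz or behind zy. *)
Lemma pathlike_pruning G x y s oP t o : eset P \subset eset G ->
  (exists2 e, e \in face_edges (head [::] fs) & noncutting G e) ->
  (exists2 e, e \in face_edges (last [::] fs) & noncutting G e) ->
  glued P x y s oP -> oP <> Leaf -> glued G x y t o -> o <> Leaf -> prune s t -> pathlike s t.
Proof.
move=> PG [e0 he0 nc0] [e1 he1 nc1].
elim: s t x y oP o => // A' IHA z B' IHB [|A z' B] x y oP o gP nP g no // [ez pA pB].
subst z'; have gPA := glued_left gP; have gPB := glued_right gP.
have gA := glued_left g; have gB := glued_right g.
split; last 2 first.
- by apply: IHA gPA _ gA _ pA.
- by apply: IHB gPB _ gB _ pB.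
- case: A' gP gPA {IHA pA gPB} => [|A1 w1 A2] gP gPA; first by left.
  right; case: B' gP gPA {IHB pB} => [//|B1 w2 B2] gP gPA; exfalso.
  have gPB := glued_right gP.
  case: oP nP gP gPA gPB => // O1 w O2 _ gP gPA gPB.
  have [_ _ xy sh oh] := glued_uniq gP.
  have xz := glued_edge gPA; have zy := glued_edge gPB; have xyP := glued_edge gP.
  have xw1 := glued_edge (glued_left gPA); have w1z := glued_edge (glued_right gPA).
  have zw2 := glued_edge (glued_left gPB); have w2y := glued_edge (glued_right gPB).
  have yw := glued_edge (glued_left (glued_swap gP)); have wx := glued_edge (glued_right (glued_swap gP)).
  have [T0 f0 e0T] := triangle_in xz zy xyP.
  have [TL fL eL] := triangle_in xw1 w1z xz.
  have [TR fR eR] := triangle_in zw2 w2y zy.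
  have [TO fO eO] := triangle_in (etrans (adj_sym _ _ _) xyP) (etrans (adj_sym _ _ _) wx) yw.
  have [nxy nxz nzy] : [/\ x != y, x != z & z != y].
    by rewrite (adj_neq xyP) (adj_neq xz) (adj_neq zy).
  have zs : z \in inn (Node (Node A1 w1 A2) z (Node B1 w2 B2)) by rewrite mem_cat mem_head orbT.
  have [_ _ _ _ ohA] := glued_uniq gPA; have [_ _ _ _ ohB] := glued_uniq gPB.
  have inV t0 p0 q0 A0 v0 B0 d0 : t0 = Node A0 v0 B0 -> d0 \in [:: p0; v0; q0] -> d0 \in verts t0 p0 q0.
    move=> -> h; rewrite mem_verts /= mem_cat in_cons.
    by move: h; rewrite !in_cons in_nil orbF; case/or3P=> ->; rewrite ?orbT.
  have yTL : y \notin TL.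
    have yin : y \in inn (Node (Node B1 w2 B2) y (Node O1 w O2)) by rewrite mem_cat mem_head orbT.
    by apply: contra (ohA y yin); rewrite eL; apply: inV.
  have xTR : x \notin TR.
    have xin : x \in inn (Node (Node O1 w O2) x (Node A1 w1 A2)) by rewrite mem_cat mem_head orbT.
    by apply: contra (ohB x xin); rewrite eR; apply: inV.
  have zTO : z \notin TO.
    apply: contra (sh z zs); rewrite eO => h; apply: (inV _ y x O1 w O2) => //.
    by move: h; rewrite !in_cons !in_nil !orbF [(z == w) || _]orbC.
  have [xT0 zT0 yT0] : [/\ x \in T0, z \in T0 & y \in T0] by rewrite !e0T !in_cons !eqxx !orbT.
  have [xTL zTL] : x \in TL /\ z \in TL by rewrite !eL !in_cons !eqxx !orbT.
  have [zTR yTR] : z \in TR /\ y \in TR by rewrite !eR !in_cons !eqxx !orbT.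
  have [yTO xTO] : y \in TO /\ x \in TO by rewrite !eO !in_cons !eqxx !orbT.
  have neq f f' a0 : a0 \in f -> a0 \notin f' -> f != f' by move=> h1; apply: contraNneq => <-.
  (* Three distinct indices cannot all be next to the index of the middle triangle. *)
  have dL := dual_index f0 fL (share_dual f0 fL (neq _ _ _ yT0 yTL) nxz xT0 zT0 xTL zTL).
  have dR := dual_index f0 fR (share_dual f0 fR (neq _ _ _ xT0 xTR) nzy zT0 yT0 zTR yTR).
  have dO := dual_index f0 fO (share_dual f0 fO (neq _ _ _ zT0 zTO) nxy xT0 yT0 xTO yTO).
  have nidx f f' : f \in fs -> f' \in fs -> f != f' -> index f fs <> index f' fs.
    by move=> h1 h2 /eqP nf ei; apply: nf; rewrite -(nth_index [::] h1) ei nth_index.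
  have n1 : index TR fs <> index TL fs := nidx _ _ fR fL (neq _ _ _ yTR yTL).
  have n2 : index TO fs <> index TL fs := nidx _ _ fO fL (neq _ _ _ yTO yTL).
  have n3 : index TO fs <> index TR fs := nidx _ _ fO fR (neq _ _ _ xTO xTR).
  by clear -dL dR dO n1 n2 n3; lia.
move=> eA eB; subst A' B'.
have xz := glued_edge gPA; have zy := glued_edge gPB; have xyP := glued_edge gP.
have [f hf ef] := triangle_in xz zy xyP.
have ncf : exists2 e, e \in face_edges f & noncutting G e.
  case: (f =P head [::] fs) => [->|/eqP fh]; first by exists e0.
  case: (f =P last [::] fs) => [->|/eqP fl]; first by exists e1.
  exfalso; have [f1 [f2 [h1 h2 n12 d1 d2]]] := interior_face_dual hf fh fl.
  case: oP nP gP gPA gPB => // O1 w O2 _ gP gPA gPB.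
  (* Nothing of P lies beyond xz and zy, so the only other triangle at a side of xyz is xyw. *)
  have K1 d : adj P x d -> adj P d z -> d = y.
    by move=> u1 u2; case: (glued_common gPA u1 u2) => -[C [D]] //; case.
  have K2 d : adj P z d -> adj P d y -> d = x.
    by move=> u1 u2; case: (glued_common gPB u1 u2) => -[C [D]] //; case.
  have K3 d : adj P x d -> adj P d y -> d = z \/ d = w.
    by move=> u1 u2; case: (glued_common gP u1 u2) => -[C [D]] //; case; auto.
  have uniq_nb f' : f' \in fs -> dual_adj f f' -> f' =i [:: x; y; w].
    move=> hf' /andP[nff /existsP[e /andP[k1 k2]]]; have [sf uf _ _] := faceP hf.
    have [p [q [epq pq pf qf]]] := face_edge_pair sf uf k1.
    have [sf' uf' _ adjf'] := faceP hf'.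
    have pf' : p \in f' by apply: face_edges_sub k2 _; rewrite epq set21.
    have qf' : q \in f' by apply: face_edges_sub k2 _; rewrite epq set22.
    have [d [dp' dq ef']] := third_vertex sf' uf' pf' qf' pq.
    have df' : d \in f' by rewrite ef' !in_cons eqxx !orbT.
    have pd : adj P p d by apply: adjf'; rewrite // eq_sym.
    have dp0 := etrans (adj_sym P d p) pd.
    have dqa : adj P d q by apply: adjf'.
    have qd := etrans (adj_sym P q d) dqa.
    have same : d \in f -> False.
      move=> df; move/eqP: nff; apply; apply: face_ext => //.
      have sub : {subset f' <= f}.
        by move=> v0; rewrite ef' !in_cons in_nil orbF => /or3P[]/eqP->.
      have sz : size f <= size f' by rewrite sf sf'.
      by have [_ h] := uniq_min_size uf' sub sz; move=> v0; rewrite h.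
    have notin : d != x /\ d != y /\ d != z.
      by split; [|split]; apply/eqP => dd; apply: same; rewrite ef dd !in_cons eqxx ?orbT.
    case: notin => /eqP ndx [/eqP ndy /eqP ndz].
    move: pf qf pq pd dp0 dqa qd ef'; rewrite !ef !in_cons !in_nil !orbF.
    move=> /or3P[]/eqP-> /or3P[]/eqP->; rewrite ?eqxx // => _ v1 v2 v3 v4 ef' v0; rewrite ef'.
    - by case: ndy; apply: K1.
    - by case: (K3 d v1 v3) => // ->; rewrite !in_cons.
    - by case: ndy; apply: K1.
    - by case: ndx; apply: K2.
    - by case: (K3 d v4 v2) => // ->; rewrite !in_cons orbCA.
    - by case: ndx; apply: K2.
  move/eqP: n12; apply; apply: face_ext => // v0.
  by rewrite (uniq_nb f1 h1 d1) (uniq_nb f2 h2 d2).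
case: ncf => e; have [sf uf _ _] := faceP hf => /(face_edge_pair sf uf)[p [q [-> pq pf qf]]].
move: pf qf pq; rewrite !ef !in_cons !in_nil !orbF.
have M1 : noncutting G [set x; z] -> A = Leaf \/ B = Leaf.
  by move/(glued_noncutting gA); case; auto.
have M2 : noncutting G [set z; y] -> A = Leaf \/ B = Leaf.
  by move/(glued_noncutting gB); case; auto.
have M3 : noncutting G [set x; y] -> A = Leaf \/ B = Leaf.
  by move/(glued_noncutting g); case.
move=> /or3P[]/eqP-> /or3P[]/eqP->; rewrite ?eqxx //; rewrite 1?setUC; auto.
Qed.

End DualPath.

(** * Locating ribbon, fans and anchor-edges in the tree *)

Section BonnetDepth.
Variable V : finType.
Implicit Types (G S P F U : graph V) (t s o A B : tree V) (a b u v w x y z m p q : V) (e r : {set V}).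

(** The edge has a triangle on one of its sides, as two empty sides would leave only two
    vertices. *)
Lemma glued_triangle F x0 y0 t0 a b : glued F x0 y0 t0 Leaf -> t0 <> Leaf -> adj F a b ->
  exists2 q, adj F a q & adj F q b.
Proof.
move=> g0 nt0 ab.
have abE : [set a; b] \in edges t0 x0 y0 by rewrite -(glued_leaf_edges g0).
have [x [y [s [o [exy g _ _]]]]] := glued_locate g0 abE.
have apex p q A z B o' : glued F p q (Node A z B) o' -> adj F p z /\ adj F z q.
  by move=> h; split; [exact: glued_edge (glued_left h)|exact: glued_edge (glued_right h)].
have [q xq qy] : exists2 q, adj F x q & adj F q y.
  case: s g => [|A z B] g; last by have [] := apex _ _ _ _ _ _ g; exists z.
  case: o g => [|A z B] g.
    have := glued_card g; rewrite (glued_card g0); case: (t0) nt0 => // A z B _.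
    by rewrite /= size_cat /=; clear; lia.
  have [yz zx] := apex _ _ _ _ _ _ (glued_swap g).
  by exists z; rewrite adj_sym.
by case: (set2_eq exy) => -[-> ->]; exists q; rewrite // adj_sym.
Qed.

(* As F - u is connected and leaves the part of G beyond the edge uy through y
   only, F contains the edge zy; its triangle in F can only be uzy. *)
Lemma fan_forced G P F u y A z B o : eset F \subset eset G -> outerplanar_path F ->
  (forall x, x \in vset F -> x = u \/ adj G u x) ->
  (exists2 e, eset F :&: eset P = [set e] & u \in e) ->
  glued G u y (Node A z B) o -> (forall a, a \in inn (Node A z B) -> a \notin vset P) ->
  z \in vset F -> [set z; y] \in eset F /\ [set u; z] \in eset F.
Proof.
move=> FG [cF [_ [emb _]]] hF [e eFP ue] g hP zF.
have FGa a b : adj F a b -> adj G a b by apply: (fintype.subsetP FG).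
have [us uo uy sh oh] := glued_uniq g.
have [uA uB AB uB' yA] := uniq_verts_node us.
have /setIP[eF eP] : e \in eset F :&: eset P by rewrite eFP in_set1.
have uF : u \in vset F := edge_ends eF ue.
(* The common edge of F and P provides a vertex other than u that is not in the part beyond uy. *)
have [w wu [wF wP]] : exists2 w, w != u & w \in vset F /\ w \in vset P.
  have [a [b [eab ab]]] := edge_pair eF; rewrite eab in eP eF ue.
  have ab' := adj_neq ab.
  move: ue; rewrite in_set2 => /orP[]/eqP uab.
    exists b; first by rewrite uab eq_sym.
    by split; [apply: edge_ends eF _|apply: edge_ends eP _]; apply: set22.
  exists a; first by rewrite uab.
  by split; [apply: edge_ends eF _|apply: edge_ends eP _]; apply: set21.
have zC : z \in inn (Node A z B) by rewrite mem_cat mem_head orbT.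
have uC : u \notin inn (Node A z B).
  by apply/negP => /(inn_notin g); rewrite set21.
have wC : w \notin inn (Node A z B) by apply/negP => /hP; rewrite wP.
have zu : z != u by apply: contraNneq uC => <-.
have [[_ ucF cFV cyc] _] := emb.
have hc := cycle_connected_minus1 ucF cFV cyc uF.
have [a' [b' [ab' au' bu' Ca' Cb']]] : exists a' b', [/\ adj F a' b', a' \notin [set u],
    b' \notin [set u], a' \in inn (Node A z B) & b' \notin inn (Node A z B)].
  by apply: (connected_exit (C := mem (inn (Node A z B))) hc zF wF); rewrite ?in_set1.
rewrite !in_set1 in au' bu'.
have eb : b' = y.
  have := glued_exit g Ca' (FGa _ _ ab'); rewrite mem_verts (negPf bu') /=.
  by rewrite (negPf Cb') => /eqP.
have ea : a' = z.
  have [aF _] := adj_vset ab'.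
  case: (hF a' aF) => [/eqP|ua]; first by rewrite (negPf au').
  have ay : adj G a' y by rewrite -eb; apply: FGa.
  have [[A0 [B0 [_ -> _]]] //|[A0 [B0 eo]]] := glued_common g ua ay.
  have : a' \in inn o by rewrite eo mem_cat mem_head orbT.
  by move/oh; rewrite mem_verts Ca' orbT.
have zyF : adj F z y by rewrite -ea -eb.
split=> //; have [x0 [y0 [t0 [nt0 g0]]]] := embedding_glued emb.
have [q zq qy] := glued_triangle g0 nt0 zyF.
have [_ qF] := adj_vset zq.
case: (hF q qF) => [qu|uq]; first by rewrite setUC -qu.
have gB := glued_right g.
(* A third vertex inside [B] would not be adjacent to u. *)
have [[A0 [B0 eB]]|[A0 [B0 [_ eq _]]]] := glued_common gB (FGa _ _ zq) (FGa _ _ qy).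
  have qB : q \in inn B by rewrite eB mem_cat mem_head orbT.
  have := glued_exit gB qB (etrans (adj_sym _ _ _) uq).
  by rewrite (negPf uB').
by rewrite setUC eq.
Qed.

(** Within the ribbon [t'] the triangles are in U anyway. Beyond it, the hypothesis on U applies to
    every further triangle of the left spine, since it holds for all y. *)
Lemma fan_ext_subset G P U u :
  (forall y A z B o, glued G u y (Node A z B) o ->
     (forall a, a \in inn (Node A z B) -> a \notin vset P) ->
     [set z; y] \in eset U /\ [set u; z] \in eset U) ->
  forall t t' y o, glued G u y t o -> prune t' t ->
  (forall a, a \in inn t -> a \in vset P -> a \in verts t' u y) ->
  edges t' u y \subset eset U -> edges (fan_ext t t') u y \subset eset U.
Proof.
move=> HF; elim=> [|A IHA z B IHB] t' y o g pr hP sub.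
  by case: t' pr sub {hP}.
have [us uo uy sh oh] := glued_uniq g.
have [uA uB AB uB' yA] := uniq_verts_node us.
have inA a : a \in inn A -> a \in verts A u z by rewrite mem_verts => ->; rewrite orbT.
case: t' pr hP sub => [_|A' z' B' [ez pA pB]] hP sub.
  have hP' a : a \in inn (Node A z B) -> a \notin vset P.
    move=> ha; apply/negP => /(hP a ha); rewrite mem_verts /=.
    by have := inn_notin g ha; rewrite in_set2 => /negPf->.
  have [zyU uzU] := HF _ _ _ _ _ g hP'.
  rewrite [fan_ext _ _]/= edges_node !subUset; apply/and3P; split=> //.
  - apply: (IHA Leaf _ _ (glued_left g) I).
      by move=> a ha aP; have := hP' a; rewrite mem_cat ha aP => /(_ isT).
    by apply/fintype.subsetP => e /set1P->.
  - by apply/fintype.subsetP => e /set1P->.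
subst z'; move: sub; rewrite [fan_ext _ _]/= !edges_node !subUset => /and3P[s1 s2 s3].
rewrite s1 s3 andbT /=; apply: IHA (glued_left g) pA _ s2.
move=> a ha aP; have := hP a; rewrite mem_cat ha mem_verts_node => /(_ isT aP) /orP[//|].
move/(prune_verts pB) => aB; have az := AB a (inA a ha) aB.
by rewrite az mem_verts eqxx !orbT.
Qed.

(** A leaf of [s] is an edge with nothing behind it in U, hence non-cutting there; if [t] goes on
    behind it, it is cutting in G and so an anchor-edge. The apex of a triangle crossed on the way
    is no end of [r], which keeps [r] on the far side and different from the current edge. *)
Lemma hangs_anchors G U r (D : nat) :
  (forall x y s o, [set x; y] \in anchors G U -> glued G x y s o -> s <> Leaf ->
     r \in edges o y x -> r != [set x; y] -> depth_le D s) ->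
  forall s t x y oU o, glued U x y s oU -> oU <> Leaf -> glued G x y t o -> o <> Leaf ->
  r \in edges o y x -> r != [set x; y] -> prune s t -> hangs (depth_le D) s t.
Proof.
move=> HA; elim=> [|A' IHA z B' IHB] t x y oU o gU nU g no ro nr pr.
  rewrite /hangs; case: t g pr => [|A z B] g _; first exact: depth_le_leaf.
  apply: (HA x y _ o _ g _ ro nr) => //; rewrite inE.
  rewrite -[_ \in eset U]/(adj U x y) (glued_edge gU) (glued_cutting g) //=.
  have /andP[_ hc] : noncutting U [set x; y] by apply/(glued_noncutting gU); left.
  by rewrite /cutting negb_and negbK hc orbT.
case: t g pr => // A z' B g [ez pA pB]; subst z'.
have [_ _ _ sh _] := glued_uniq g.
have zr : z \notin r.
  have := sh z; rewrite mem_cat mem_head orbT => /(_ isT); apply: contra => zr.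
  exact: edges_verts ro zr.
split.
- apply: (IHA _ _ _ _ _ (glued_left gU) _ (glued_left g) _ _ _ pA) => //.
    by rewrite edges_node !in_setU ro !orbT.
  by apply: contraNneq zr => ->; rewrite set22.
- apply: (IHB _ _ _ _ _ (glued_right gU) _ (glued_right g) _ _ _ pB) => //.
    by rewrite edges_node !in_setU ro !orbT.
  by apply: contraNneq zr => ->; rewrite set21.
Qed.

(* P contains the edge uv because P - c is connected and uv is the only
   connection from u to v in G - c. *)
Lemma ribbon_tree G P u v L c R : glued G u v (Node L c R) Leaf ->
  maximal_outerplanar P -> eset P \subset eset G ->
  u \in vset P -> v \in vset P -> c \in vset P ->
  exists t', [/\ glued P u v t' Leaf, t' <> Leaf & prune t' (Node L c R)].
Proof.
move=> g [cP emb] PG uP vP cc.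
have PGa a b : adj P a b -> adj G a b by apply: (fintype.subsetP PG).
have [us _ uv _ _] := glued_uniq g; have [uL uR LR unR vnL] := uniq_verts_node us.
have uc := uniq_verts_neq uL; have cv := uniq_verts_neq uR.
have [[_ ucP cPV cyc] _] := emb.
have hc := cycle_connected_minus1 ucP cPV cyc cc.
have uvP : adj P u v.
  have [||||a [b [ab ac bc Ca Cb]]] := connected_exit (C := mem (verts L u c)) hc uP vP.
  - by rewrite in_set1.
  - by rewrite in_set1 eq_sym.
  - by rewrite /= mem_verts eqxx.
  - by [].
  rewrite !in_set1 in ac bc.
  have {}Ca : a \in verts L u c := Ca; have {}Cb : b \notin verts L u c := Cb.
  have := PGa _ _ ab => abG; have gL := glued_left g.
  move: Ca; rewrite mem_verts (negPf ac) orbF => /orP[/eqP au|aL].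
    subst a; move: abG; rewrite /adj (glued_leaf_edges g) edges_node !in_setU in_set1.
    case/or3P=> [/eqP/set2_eq[[_ eb]|[eu eb]]|h|h].
    + by rewrite -eb.
    + by rewrite eu eqxx in uv.
    + by case/negP: Cb; apply: edges_verts h (set22 _ _).
    + by have := edges_verts h (set21 _ _); rewrite (negPf unR).
  by case/negP: Cb; exact: (glued_exit gL aL abG).
have [x0 [y0 [t0 [nt0 g0]]]] := embedding_glued emb.
have uvE : [set u; v] \in edges t0 x0 y0 by rewrite -(glued_leaf_edges g0).
have onlyc w : adj P u w -> adj P w v -> w = c.
  move=> h1 h2; have [[A [B [_ -> _]]] //|[A [B //]]] := glued_common g (PGa _ _ h1) (PGa _ _ h2).
(* Triangles of P on both sides of uv would have different apexes, but c is the only common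
   neighbour of u and v. *)
have nc : noncutting P [set u; v].
  have [x [y [s [o [exy gs _ _]]]]] := glued_locate g0 uvE.
  rewrite exy; apply/(glued_noncutting gs).
  case: s gs => [|A z B] gs; first by left.
  case: o gs => [|A1 z1 B1] gs; first by right.
  have e1 := glued_edge (glued_left gs); have e2 := glued_edge (glued_right gs).
  have e3 := glued_edge (glued_left (glued_swap gs)).
  have e4 := glued_edge (glued_right (glued_swap gs)).
  have [_ _ _ _ /(_ z1)] := glued_uniq gs.
  rewrite mem_cat mem_head orbT => /(_ isT); rewrite mem_verts_node mem_verts => hz.
  have [zc z1c] : z = c /\ z1 = c.
    by case: (set2_eq exy) => -[-> ->] in onlyc *; split; apply: onlyc; rewrite // adj_sym.
  by move: hz; rewrite z1c zc eqxx !orbT.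
have [t' nt' g'] := noncutting_root g0 nt0 nc.
exists t'; split=> //; apply: (edges_prune us); first by case: (glued_uniq g').
by rewrite -(glued_leaf_edges g) -(glued_leaf_edges g').
Qed.

End BonnetDepth.

(** * From bonnet systems to the depth of the tree *)

Section SystemDepth.
Variable V : finType.
Implicit Types (G S P F U : graph V) (t s o A B : tree V) (a b u v w x y z m p q : V) (e r : {set V}).

(** Being a neighbour of u outside P, the vertex z lies in one of the fans. The fan at v is
    excluded: it consists of v and neighbours of v, and a neighbour of u among these is v or c, both
    in P. *)
Lemma fan_covers G U P F F' u v c y A z B o :
  eset F \subset eset G -> eset F \subset eset U ->
  vset U =i [predU [predU vset P & vset F] & vset F'] ->
  fan G P u F -> fan G P v F' -> v \in vset P -> c \in vset P ->
  (forall x, adj G u x -> adj G v x -> x = c) -> (forall x, adj G u x -> x \in vset U) ->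
  glued G u y (Node A z B) o -> (forall a, a \in inn (Node A z B) -> a \notin vset P) ->
  [set z; y] \in eset U /\ [set u; z] \in eset U.
Proof.
move=> FG FU vU fF fF' vP cP uvc nbr g hP.
have zC : z \in inn (Node A z B) by rewrite mem_cat mem_head orbT.
have zP := hP z zC; have uz : adj G u z := glued_edge (glued_left g).
have zF : z \in vset F.
  have := nbr z uz; rewrite vU !inE (negPf zP) /= => /orP[//|zF'].
  case: fF' => [e0|[_ h _]]; first by rewrite e0 in_set0 in zF'.
  case: (h z zF') => [zv|vz]; first by rewrite zv vP in zP.
  by rewrite (uvc z uz vz) cP in zP.
case: fF => [e0|[hF hN he]]; first by rewrite e0 in_set0 in zF.
have [h1 h2] := fan_forced FG hF hN he g hP zF.
by split; apply: (fintype.subsetP FU).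
Qed.

(** The bonnet U is recognized as the pruning [sU], the ribbon enlarged by all triangles at u and at
    v. The dual path of the ribbon then gives the shape of each side, and the anchor-edges give what
    hangs there. *)
Lemma bonnet_depth G U u v t D : glued G u v t Leaf -> bonnet_with_cap G u v U ->
  (forall x y s o, [set x; y] \in anchors G U -> glued G x y s o -> s <> Leaf ->
     [set u; v] \in edges o y x -> [set u; v] != [set x; y] -> depth_le D s) ->
  depth_le D.+1 t.
Proof.
case: t => // L c R g [ncuv [UVG UEG] _ [P [F1 [F2 [vU eU rib [fF1 fF2] _]]]] nbr] HA.
have [e0 [e1 [[nc0 nc1 _ [cP [fs [emb dp he0 he1]]]] [uP vP cmn]]]] := rib.
have [us _ uv _ _] := glued_uniq g; have [uL uR LR unR vnL] := uniq_verts_node us.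
have gL := glued_left g; have gR := glued_right g; have g' := glued_mirror g.
have uc := glued_edge gL; have cv := glued_edge gR; have uvG := glued_edge g.
have vc : adj G v c by rewrite adj_sym.
have cinP : c \in vset P by apply: cmn.
have PU : eset P \subset eset U by rewrite eU -setUA subsetUl.
have FU1 : eset F1 \subset eset U.
  by rewrite eU; apply: fintype.subset_trans (subsetUl _ _); apply: subsetUr.
have FU2 : eset F2 \subset eset U by rewrite eU subsetUr.
have PG := fintype.subset_trans PU UEG.
have [t' [gP nt' pr]] := ribbon_tree g (ex_intro _ cP emb) PG uP vP cinP.
case: t' gP nt' pr => // L' c' R' gP _ [ec pL pR]; subst c'.
have gP' := glued_mirror gP; rewrite [mirror (Node _ _ _)]/= in gP'.
have vPE := glued_leaf_vset gP.
have uvc x : adj G u x -> adj G v x -> x = c.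
  move=> ux vx; have xv : adj G x v by rewrite adj_sym.
  by have [[A [B [_ -> _]]] //|[A [B //]]] := glued_common g ux xv.
have vUE : vset U =i [predU [predU vset P & vset F1] & vset F2].
  by move=> x; rewrite vU !in_setU !inE.
have vUE' : vset U =i [predU [predU vset P & vset F2] & vset F1].
  by move=> x; rewrite vUE !inE -!orbA; congr (_ || _); rewrite orbC.
have HF1 y A z B o : glued G u y (Node A z B) o ->
    (forall a, a \in inn (Node A z B) -> a \notin vset P) ->
    [set z; y] \in eset U /\ [set u; z] \in eset U.
  by apply: (fan_covers (fintype.subset_trans FU1 UEG) FU1 vUE fF1 fF2 vP cinP uvc) => x ux; apply: nbr; left.
have HF2 y A z B o : glued G v y (Node A z B) o ->
    (forall a, a \in inn (Node A z B) -> a \notin vset P) ->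
    [set z; y] \in eset U /\ [set v; z] \in eset U.
  apply: (fan_covers (fintype.subset_trans FU2 UEG) FU2 vUE' fF2 fF1 uP cinP) => x vx.
    by move=> ux; apply: uvc.
  by apply: nbr; right.
pose sL := fan_ext L L'; pose sR := fan_ext (mirror R) (mirror R').
have eP := glued_leaf_edges gP.
have pR' : prune (mirror R') (mirror R) by apply: prune_mirror.
have prL : prune sL L by apply: prune_fan_ext.
have prR : prune sR (mirror R) by apply: prune_fan_ext.
have prR2 : prune (mirror sR) R by rewrite -(mirrorK R); apply: prune_mirror.
pose sU := Node sL c (mirror sR).
have prU : prune sU (Node L c R) by split.
have vPL a : a \in inn L -> a \in vset P -> a \in verts L' u c.
  move=> ha; have haL : a \in verts L u c by rewrite mem_verts ha orbT.
  rewrite vPE mem_verts_node => /orP[//|/(prune_verts pR) aR].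
  by rewrite (LR a haL aR) mem_verts eqxx !orbT.
have vPR a : a \in inn (mirror R) -> a \in vset P -> a \in verts (mirror R') v c.
  rewrite inn_mirror mem_rev => ha; have haR : a \in verts R c v by rewrite mem_verts ha orbT.
  rewrite verts_mirror mem_rev vPE mem_verts_node => /orP[/(prune_verts pL) aL|//].
  by rewrite (LR a aL haR) mem_verts eqxx.
have sL'U : edges L' u c \subset eset U.
  apply: fintype.subset_trans PU; rewrite eP edges_node.
  by apply: fintype.subset_trans (subsetUr _ _); apply: subsetUl.
have sR'U : edges (mirror R') v c \subset eset U.
  apply: fintype.subset_trans PU; rewrite eP edges_node edges_mirror.
  by apply: fintype.subset_trans (subsetUr _ _); apply: subsetUr.
have subL := fan_ext_subset HF1 gL pL vPL sL'U.
rewrite [mirror (Node _ _ _)]/= in g'; have g'L := glued_left g'.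
have subR := fan_ext_subset HF2 g'L pR' vPR sR'U.
rewrite -/sL in subL; rewrite -/sR in subR.
have uvU : [set u; v] \in eset U.
  by apply: (fintype.subsetP PU); rewrite eP root_edge.
(* Both sets consist of the vertices of P and the neighbours of u and v: the fans contribute nothing
   else, and a bonnet contains all these neighbours. *)
have vUs : vset U =i verts sU u v.
  have nbrU x : adj G u x -> x \in verts sU u v.
    rewrite /adj (glued_leaf_edges g) => h.
    have pr0 : prune (Node L' c R') (Node L c R) by split.
    have := fan_ext_nbr pr0 us h.
    rewrite [fan_ext _ _]/= !mem_verts_node => /orP[->//|h2].
    rewrite orbC verts_mirror mem_rev (prune_verts (fan_ext_prune pR')) //.
    by rewrite verts_mirror mem_rev.
  have us' : uniq (verts (mirror (Node L c R)) v u) by rewrite uniq_verts_mirror.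
  have nbrV x : adj G v x -> x \in verts sU u v.
    rewrite /adj (glued_leaf_edges g) -edges_mirror => h.
    have pr' : prune (mirror (Node L' c R')) (mirror (Node L c R)) by apply: prune_mirror.
    have := fan_ext_nbr pr' us' h.
    rewrite [fan_ext _ _]/= !mem_verts_node => /orP[h2|h2].
      by rewrite verts_mirror mem_rev h2 orbT.
    rewrite (prune_verts (fan_ext_prune pL)) //.
    by move: h2; rewrite verts_mirror mem_rev.
  have Psub x : x \in vset P -> x \in verts sU u v.
    rewrite vPE !mem_verts_node => /orP[h|h].
      by rewrite (prune_verts (fan_ext_prune pL)).
    rewrite orbC verts_mirror mem_rev (prune_verts (fan_ext_prune pR')) //.
    by rewrite verts_mirror mem_rev.
  have fsub F w x : fan G P w F -> (forall x, adj G w x -> x \in verts sU u v) ->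
      w \in verts sU u v -> x \in vset F -> x \in verts sU u v.
    by case=> [->|[_ h _]]; [rewrite in_set0|move=> hn hw /h[->//|/hn]].
  have uU : u \in verts sU u v by rewrite mem_verts eqxx.
  have vUU : v \in verts sU u v by rewrite mem_verts eqxx !orbT.
  have PUv x : x \in vset P -> x \in vset U by rewrite vUE !inE => ->.
  move=> x; apply/idP/idP.
    rewrite vUE !inE => /orP[/orP[]|]; [exact: Psub|exact: fsub fF1 nbrU uU|exact: fsub fF2 nbrV vUU].
  rewrite mem_verts_node verts_mirror mem_rev => /orP[/(fan_ext_verts pL)|/(fan_ext_verts pR')] [h|h].
  - by apply: PUv; rewrite vPE mem_verts_node h.
  - apply: nbr; left; apply: (fintype.subsetP (glued_subset g)).
    by rewrite edges_node !in_setU h orbT.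
  - by apply: PUv; rewrite vPE mem_verts_node orbC; move: h; rewrite verts_mirror mem_rev => ->.
  - apply: nbr; right; apply: (fintype.subsetP (glued_subset g)).
    by rewrite edges_node -(edges_mirror R) !in_setU h !orbT.
(* A pruning is induced, so U has no further edges; conversely, the fans supply the edges of [sU]
   outside the ribbon. *)
have eUs : eset U = edges sU u v.
  apply/eqP; rewrite eqEsubset; apply/andP; split.
    apply/fintype.subsetP => e eInU; have [a [b [eab ab]]] := edge_pair eInU.
    have [aU bU] := adj_vset ab; rewrite vUs in aU; rewrite vUs in bU.
    rewrite eab; apply: (prune_induced us prU (adj_neq ab) aU bU).
    by rewrite -(glued_leaf_edges g); apply: (fintype.subsetP UEG).
  rewrite edges_node !subUset subL edges_mirror subR !andbT.
  by apply/fintype.subsetP => e /set1P->.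
have gU : glued U u v sU Leaf.
  split.
  - by have := prune_uniq prU us; rewrite /verts cats1.
  - by move=> a; rewrite vUs /verts.
  - rewrite eUs; apply/esym/setUidPl/fintype.subsetP => e /set1P->.
    by rewrite (setUC [set v]) root_edge.
have gU' := glued_mirror gU; rewrite [mirror (Node _ _ _)]/= mirrorK in gU'.
have pathL : pathlike L' L.
  apply: (pathlike_pruning emb dp PG) (glued_left gP) _ gL _ pL => //.
  - by exists e0.
  - by exists e1.
have pathR : pathlike (mirror R') (mirror R).
  apply: (pathlike_pruning emb dp PG) (glued_left gP') _ g'L _ pR' => //.
  - by exists e0.
  - by exists e1.
have cnuv : c \notin [set u; v].
  apply: (inn_notin g); by rewrite mem_cat mem_head orbT.
split.
- apply: pathlike_fan_ribbon pL pathL _; first exact: depth_le_leaf.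
  apply: (hangs_anchors HA (glued_left gU) _ gL _ _ _ prL) => //.
    by rewrite edges_node !in_setU (setUC [set u]) root_edge !orbT.
  by apply: contraNneq cnuv => ->; rewrite set22.
- apply: pathlike_fan_ribbon pR' pathR _; first exact: depth_le_leaf.
  apply: (hangs_anchors HA (glued_left gU') _ g'L _ _ _ prR) => //.
    by rewrite edges_node !in_setU root_edge !orbT.
  by apply: contraNneq cnuv => ->; rewrite set22.
Qed.

(** A root-edge is an unordered pair and its bonnet may name the ends in either order; hence the
    quantification over u and v, and the mirror. Smaller depths of hanging subgraphs are raised to
    the maximum by monotonicity. *)
Lemma system_depth G r d : bonnet_system G r d -> forall u v t, r = [set u; v] ->
  glued G u v t Leaf -> depth_le d t.
Proof.
elim=> {G r d} G r U S d ncr [u0 [v0 [er hU]]] hS _ IH.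
have main t : glued G u0 v0 t Leaf -> depth_le (\max_(e in anchors G U) d e).+1 t.
  move=> g; apply: (bonnet_depth g hU) => x y s o anch gs ns ro nr; rewrite -er in ro nr.
  have gS := hanging_glued gs ns ro nr (hS _ anch).
  apply: depth_le_mono (IH _ anch x y s erefl gS).
  exact: (@leq_bigmax_cond _ _ d).
move=> u v t; rewrite er => /set2_eq[[eu ev]|[eu ev]]; subst u v => g; first exact: main.
by rewrite -(mirrorK t); apply: depth_le_mirror; apply: main; exact: (glued_mirror g).
Qed.

End SystemDepth.

Theorem theorem1 (R : realType) (V : finType) (G : graph V)
    (hG : maximal_outerplanar G) :
  exists D : drawing R V,
    [/\ flat_visibility_representation G D, planar_drawing G D &
        height_at_most G D (2 * bd_free G + 1)].
Proof.
have [u [v [t [g _ sys]]]] := bd_free_system hG.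
have [us _ _ _ _] := glued_uniq g.
have [w [ok _ _]] := depth_layout (system_depth sys erefl g) us.
have [|D hD] := word_drawing R (glued_leaf_vset g) (w := w) (h := 2 * bd_free G + 1).
  by rewrite (glued_leaf_edges g) addn1 mul2n.
by exists D.
Qed.
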